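(* Let $S$ be a densely defined linear operator in a complex Hilbert space $\mathcal H$ with domain $\mathscr D(S)$ such that $S(\mathscr D(S))\subset\mathscr D(S)$. If $Z\subset\mathbb C\setminus\{0\}$ is a determining set for $\mathbb C[z,\bar z]$, then the following conditions are equivalent: (i) $S$ is subnormal; (ii) for every system $\{a_{p,q}^{i,j}\}_{p,q=0,\dots,n}^{i,j=1,\dots,m}\subset\mathbb C$ (with arbitrary integers $m\ge1$, $n\ge0$), if $$\sum_{i,j=1}^m\sum_{p,q=0}^na_{p,q}^{i,j}\lambda^p\bar\lambda^qz_i\bar z_j\ge0,\quad\lambda,z_1,\dots,z_m\in\mathbb C,$$ then $$\sum_{i,j=1}^m\sum_{p,q=0}^na_{p,q}^{i,j}\langle S^pf_i,S^qf_j\rangle\ge0,\quad f_1,\dots,f_m\in\mathscr D(S);$$ (iii) for every system $\{a_{p,q}^{i,j}\}_{p,q=0,\dots,n}^{i,j=1,\dots,m}\subset\mathbb C$ (with arbitrary integers $m\ge1$, $n\ge0$), if there is a finite matrix $[q_{i,l}]_{i=1,\dots,m;\ l=1,\dots,k}$ with entries in $\mathbb C_{\mathfrak N_+}(z,\bar z)$ such that $$\sum_{p,q=0}^na_{p,q}^{i,j}\lambda^p\bar\lambda^q=\sum_{l=1}^kq_{i,l}(\lambda,\bar\lambda)\overline{q_{j,l}(\lambda,\bar\lambda)},\quad\lambda\in Z,\ i,j=1,\dots,m,$$ then $$\sum_{i,j=1}^m\sum_{p,q=0}^na_{p,q}^{i,j}\langle S^pf_i,S^qf_j\rangle\ge0,\quad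 f_1,\dots,f_m\in\mathscr D(S).$$
   Context: A densely defined linear operator $S$ in a complex Hilbert space $\mathcal H$ with domain $\mathscr D(S)$ is subnormal if there exist a complex Hilbert space $\mathcal K$ and a (possibly unbounded) normal operator $N$ in $\mathcal K$ such that $\mathcal H\subset\mathcal K$ (isometric embedding), $\mathscr D(S)\subset\mathscr D(N)$ and $Sh=Nh$ for all $h\in\mathscr D(S)$. $\mathbb C[z,\bar z]$ is the ring of all complex polynomials in $z$ and $\bar z$; a set $Z\subset\mathbb C$ is determining for $\mathbb C[z,\bar z]$ if every $p\in\mathbb C[z,\bar z]$ with $p(z,\bar z)=0$ for all $z\in Z$ vanishes identically. $\mathbb C_{\mathfrak N_+}(z,\bar z)$ is the set of all functions on $\mathbb C\setminus\{0\}$ of the form $z\mapsto\sum_{m,n\in\mathbb Z,\ m+n\ge0}a_{m,n}z^m\bar z^n$ with only finitely many nonzero coefficients $a_{m,n}\in\mathbb C$. *)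

(* Defs.v *)
From HB Require Import structures.
From mathcomp Require Export all_boot all_order all_algebra.
From mathcomp Require Export all_classical all_reals all_analysis.
From mathcomp Require Export complex polyXY.

Set Implicit Arguments.
Unset Strict Implicit.
Unset Printing Implicit Defensive.

Export Order.TTheory GRing.Theory Num.Theory.
Export numFieldNormedType.Exports.

Local Open Scope classical_set_scope.
Local Open Scope ring_scope.

(* Complex Hilbert spaces; norms of [completeNormedModType R[i]] take values in
   [R[i]].  The inner product is linear in its first argument and conjugate
   linear in its second one. *)
HB.mixin Record CompleteNormedModule_isHilbert (R : realType) H
    of CompleteNormedModule R[i] H := {
  dotp : {dot H for Num.conj};
  dotp_norm : forall x : H, dotp x x = `|x| ^+ 2
}.

#[short(type="hilbertType")]
HB.structure Definition Hilbert (R : realType) :=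
  {H of CompleteNormedModule R[i] H & CompleteNormedModule_isHilbert R H}.

Definition inner (R : realType) (H : hilbertType R) (x y : H) : R[i] :=
  @dotp R H x y.

Notation "''[' x , y ]" := (inner x y) : ring_scope.

(* Possibly unbounded linear operators in H.  The operator is given by a total
   function whose values outside the domain [dom] are meaningless. *)
Record linop (R : realType) (H : hilbertType R) := Linop {
  dom : set H;
  linop_fun :> H -> H;
  dom0 : dom 0;
  dom_linear : forall (c : R[i]) (x y : H),
    dom x -> dom y -> dom (c *: x + y);
  linop_linear : forall (c : R[i]) (x y : H), dom x -> dom y ->
    linop_fun (c *: x + y) = c *: linop_fun x + linop_fun y
}.

Section Operators.
Variables (R : realType) (H : hilbertType R).
Implicit Type N : linop H.

Definition densely_defined N : Prop := dense (dom N).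

Definition graph N : set (H * H) := [set xy | dom N xy.1 /\ N xy.1 = xy.2].

Definition closed_op N : Prop := closed (graph N).

(* The adjoint N^*: y is in its domain iff x |-> <Nx, y> is represented on
   D(N) by some vector z, and then N^* y = z; this z is unique when N is densely
   defined. *)
Definition adjoint_at N (y : H) : set H :=
  [set z | forall x : H, dom N x -> '[N x, y] = '[x, z]].

Definition adjoint_dom N : set H := [set y | adjoint_at N y !=set0].

Definition adjoint N (y : H) : H := xget 0 (adjoint_at N y).

(* N is densely defined and closed, and N^* N = N N^* (including equality of the
   natural domains of these two products). *)
Definition normal_op N : Prop :=
  [/\ densely_defined N,
      closed_op N,
      forall x : H, dom N x /\ adjoint_dom N (N x) <->
                    adjoint_dom N x /\ dom N (adjoint N x)
    & forall x : H, dom N x -> adjoint_dom N (N x) ->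
        adjoint N (N x) = N (adjoint N x)].

End Operators.

Definition isometric_embedding (R : realType) (H K : hilbertType R)
    (J : {linear H -> K}) : Prop :=
  forall x y : H, '[J x, J y] = '[x, y].

(* Subnormality is a notion for densely defined S only. *)
Definition subnormal (R : realType) (H : hilbertType R) (S : linop H) : Prop :=
  densely_defined S /\
  exists (K : hilbertType R) (J : {linear H -> K}) (N : linop K),
    [/\ isometric_embedding J, normal_op N
      & forall h : H, dom S h -> dom N (J h) /\ J (S h) = N (J h)].

Definition determining (R : realType) (Z : set R[i]) : Prop :=
  forall p : {poly {poly R[i]}},
    (forall z : R[i], Z z -> p.[z, z^*] = 0) ->
    forall z : R[i], p.[z, z^*] = 0.

(* The functions on C \ {0} of the form
   z |-> \sum_(m + n >= 0) a_{m,n} z^m conj(z)^n with almost all a_{m,n} zero; they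
   are represented by total functions whose value at 0 is irrelevant. *)
Definition laurentNplus (R : realType) : set (R[i] -> R[i]) :=
  [set f | exists2 a : int * int -> R[i], finite_set [set mn | a mn != 0] &
    forall z : R[i], z != 0 ->
      f z = \sum_(mn \in [set mn : int * int | 0 <= mn.1 + mn.2])
              a mn * z ^ mn.1 * z^* ^ mn.2].

(* Main.v *)
(* (iii) => (i).  The functional mapping z^p conj(z)^q (x) f (x) g to <S^p f, S^q g>
   is nonnegative on those sums of squares of elements of C_{N_+} (x) D(S) that are
   polynomial; by M. Riesz' theorem it extends to all z^m conj(z)^n (x) f (x) g with
   m + n >= 0 so as to be nonnegative on all such sums of squares, which makes it a
   positive definite kernel on N_+ x D(S).  In the Hilbert
   space of this kernel the multiplication M by z is closable and that by z / conj z
   is a unitary operator U commuting with M.  The operator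
   (x, y) |-> (M y, U M^* x), M being replaced by its closure, is normal, and on
   the diagonal it extends M.

   (ii) => (iii).  After multiplication by a power of |z|^2 the identity assumed on Z
   is one between polynomials, so it holds for all z <> 0 and shows that the
   polynomial matrix is positive semidefinite there, and by continuity at 0 as well.

   (i) => (ii).  No spectral theorem is needed: with T = (1 + s^2 N^* N)^{-1} and
   W = s N T, one writes (W, T) as the barycenter of finitely many points of
   C x [0, oo[ with commuting positive weights of sum 1.  The n-fold product of these
   weights, attached to the averages of the points, is a random walk obeying the law
   of large numbers, that is, an approximate joint spectral measure of (W, T);
   positivity of the homogenized polynomial at its points passes to the limit.
   Finally T converges strongly to 1 as s tends to 0. *)
From mathcomp Require Import freeg spectral zify ring lra.
Require Import Defs.
From HB Require Import structures.

Set Implicit Arguments.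
Unset Strict Implicit.
Unset Printing Implicit Defensive.

Local Open Scope classical_set_scope.
Local Open Scope ring_scope.

(** * Convergence of complex sequences *)

(** The obstacle on the way from (iii) to (i) is that positivity on polynomials in z and conj z
    alone yields only a formally normal multiplication operator, which may have no normal extension.
    The monomials of N_+ supply the unitary z / conj z, and z = (z / conj z) conj z then makes the
    block operator normal by algebra. The restriction m + n >= 0 is what lets Riesz' theorem apply:
    |z^m conj(z)^n|^2 = (z conj z)^(m+n) is a polynomial, so polynomials dominate all these
    monomials. For (i) => (ii), with t = 1 / (1 + s^2 |l|^2) and w = s l t, one has l^p t^n = s^(-p)
    w^p t^(n-p): damping by T^n makes every term bounded. The spectral values satisfy |w|^2 = t -
    t^2, but the averages of the walk do not. This is why the inequality is used in homogenized
    form, where it holds for all w in C and t >= 0. The relation |w|^2 = t - t^2 is used only to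
    write the weights as sums of squares. *)

Section CplxSeq.
Variable R : realType.
Implicit Types (u v : nat -> R[i]) (l m e c : R[i]).

(** Since [0 < e] in [R[i]] forces [e] to be real, this is ordinary convergence. *)
Definition tends u l :=
  forall e, 0 < e -> exists N : nat, forall n, (N <= n)%N -> `|u n - l| < e.

Lemma tends_cst l : tends (fun=> l) l.
Proof. by move=> e e0; exists 0%N => n _; rewrite subrr normr0. Qed.

Lemma tends_lin c u v l m : tends u l -> tends v m ->
  tends (fun n => c * u n + v n) (c * l + m).
Proof.
move=> ul vm e e0.
have c0 : 0 < `|c| + 1 by rewrite ltr_wpDl.
have e1 : 0 < e / 2 / (`|c| + 1) by rewrite !divr_gt0.
have e2 : 0 < e / 2 by rewrite divr_gt0.
have [N1 N1P] := ul _ e1; have [N2 N2P] := vm _ e2.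
exists (maxn N1 N2) => n; rewrite geq_max => /andP[/N1P h1 /N2P h2].
rewrite opprD addrACA -mulrBr.
apply: le_lt_trans (ler_normD _ _) _; rewrite normrM [e]splitr ltr_leD//; last exact: ltW.
move: h1; rewrite ltr_pdivlMr// mulrC => h1.
by apply: le_lt_trans h1; rewrite ler_wpM2r// lerDl.
Qed.

Lemma tends_conj u l : tends u l -> tends (fun n => (u n)^*) l^*.
Proof.
move=> ul e /ul[N NP]; exists N => n /NP.
by rewrite -rmorphB norm_conjC.
Qed.

Lemma tends_ext u v l : u =1 v -> tends u l -> tends v l.
Proof. by move=> /funext ->. Qed.

Lemma tends_uniq u l m : tends u l -> tends u m -> l = m.
Proof.
move=> ul um; apply/eqP; rewrite -subr_eq0 -normr_eq0; apply/negPn/negP => n0.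
have e0 : 0 < `|l - m| / 2 by rewrite divr_gt0// lt_def n0 normr_ge0.
have [N1 N1P] := ul _ e0; have [N2 N2P] := um _ e0.
have := N1P _ (leq_maxl N1 N2); have := N2P _ (leq_maxr N1 N2).
set n := maxn _ _ => h2 h1.
have : `|l - m| < `|l - m|; last by rewrite ltxx.
rewrite {2}[`|l - m|]splitr; apply: le_lt_trans (ltrD h2 h1).
have -> : l - m = (u n - m) - (u n - l) by ring.
exact: ler_normB.
Qed.

Lemma tends_norm u l : tends u l -> tends (fun n => `|u n|) `|l|.
Proof.
move=> ul e /ul[N NP]; exists N => n /NP; apply: le_lt_trans.
exact: ler_dist_dist.
Qed.

Lemma tends_ge0 u l : (forall n, 0 <= u n) -> tends u l -> 0 <= l.
Proof.
move=> u0 ul; have -> : l = `|l| by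
  apply: (tends_uniq ul); apply: tends_ext (tends_norm ul) => n; rewrite ger0_norm.
exact: normr_ge0.
Qed.

Lemma real_cauchy_cvg (x : nat -> R) :
  (forall e : R, 0 < e -> exists N : nat, forall i j,
    (N <= i)%N -> (N <= j)%N -> `|x i - x j| < e) ->
  exists l : R, forall e : R, 0 < e -> exists N : nat, forall n,
    (N <= n)%N -> `|x n - l| < e.
Proof.
move=> xC; have /cvg_ex[l xl] : cvg (x @ \oo).
  apply: cauchy_cvg; apply: cauchy_exP => e /xC[N NP].
  exists (x N); exists N => // n /= Nn; exact: NP.
exists l => e e0; move/cvgrPdist_lt : xl => /(_ e e0)[N _ NP].
by exists N => n Nn; rewrite distrC; exact: NP.
Qed.

Lemma ltr_cplx_real e : 0 < e -> e = (complex.Re e)%:C%C /\ 0 < complex.Re e.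
Proof. by case: e => a b; rewrite ltcE /= => /andP[/eqP -> ->]. Qed.

Lemma normc_real (x : R) : `|x%:C%C : R[i]| = `|x|%:C%C.
Proof. by rewrite normc_def /= expr0n /= addr0 sqrtr_sqr. Qed.

Lemma norm_imc : `|'i%C : R[i]| = 1.
Proof. by rewrite normc_def /= expr0n expr1n add0r sqrtr1. Qed.

Lemma normc_ge_Im (z : R[i]) : `|complex.Im z|%:C%C <= `|z|.
Proof.
by have := normc_ge_Re (z * 'i%C); rewrite ReiNIm normrN normrM norm_imc mulr1.
Qed.

Lemma normc_le_ReIm (z : R[i]) :
  `|z| <= (`|complex.Re z| + `|complex.Im z|)%:C%C.
Proof.
rewrite {1}[z]complexE; apply: le_trans (ler_normD _ _) _.
by rewrite normrM norm_imc mul1r !normc_real rmorphD.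
Qed.

Lemma tends_cauchy u :
  (forall e, 0 < e -> exists N : nat, forall i j,
    (N <= i)%N -> (N <= j)%N -> `|u i - u j| < e) -> exists l, tends u l.
Proof.
move=> uC.
have [a aP] : exists a : R, forall e : R, 0 < e -> exists N : nat, forall n,
    (N <= n)%N -> `|complex.Re (u n) - a| < e.
  apply: real_cauchy_cvg => e e0; have [|N NP] := uC e%:C%C; first by rewrite ltcR.
  exists N => i j Ni Nj; rewrite -ltcR -raddfB /=.
  by apply: le_lt_trans (normc_ge_Re _) _; exact: NP.
have [b bP] : exists b : R, forall e : R, 0 < e -> exists N : nat, forall n,
    (N <= n)%N -> `|complex.Im (u n) - b| < e.
  apply: real_cauchy_cvg => e e0; have [|N NP] := uC e%:C%C; first by rewrite ltcR.
  exists N => i j Ni Nj; rewrite -ltcR -raddfB /=.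
  by apply: le_lt_trans (normc_ge_Im _) _; exact: NP.
exists (a +i* b)%C => e /ltr_cplx_real[-> e0].
have e2 : 0 < complex.Re e / 2 by rewrite divr_gt0.
have [N1 N1P] := aP _ e2; have [N2 N2P] := bP _ e2.
exists (maxn N1 N2) => n; rewrite geq_max => /andP[/N1P h1 /N2P h2].
apply: le_lt_trans (normc_le_ReIm _) _; rewrite ltcR [ltRHS]splitr.
by rewrite !raddfB /= ltrD.
Qed.

Lemma cplx_natSinv e : 0 < e ->
  exists N : nat, forall n, (N <= n)%N -> (n.+1%:R : R[i])^-1 < e.
Proof.
move=> /ltr_cplx_real[-> e0].
have [N _ NP] := @near_infty_natSinv_lt R (PosNum e0).
exists N => n Nn; have := NP n Nn; rewrite /= -ltcR fmorphV.
by rewrite rmorph_nat.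
Qed.

End CplxSeq.

(** * Semi-inner products *)

(* The hypothesis says that [q (x + t y)] is nonnegative, for [q] a quadratic form
   with [q x = a] and [q y = c]. *)
Lemma disc_le (R : realType) (a b c : R[i]) : 0 <= c ->
  (forall t, 0 <= a + t^* * b + t * b^* + t * t^* * c) -> `|b| ^+ 2 <= a * c.
Proof.
move=> c0 H; rewrite normCK.
case: (eqVneq c 0) H => [->|cn0] H; last first.
  have cp : 0 < c by rewrite lt_def cn0.
  have cR : c^* = c by apply: conj_Creal; rewrite realE c0.
  have := H (- b / c); rewrite rmorphM rmorphN fmorphV /= cR.
  have -> : a + - b^* / c * b + - b / c * b^* + - b / c * (- b^* / c) * c =
    (a * c - b * b^*) / c by field.
  by rewrite pmulr_lge0 ?invr_gt0// subr_ge0.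
have {}H t : 0 <= a + t^* * b + t * b^* by have := H t; rewrite mulr0 addr0.
have [d dE] : exists d, d = b * b^* by exists (b * b^*).
rewrite mulr0 -dE; have d0 : 0 <= d by rewrite dE -normCK exprn_ge0.
have dR : d^* = d by apply: conj_Creal; rewrite realE d0.
have [->//|dn0] := eqVneq d 0.
have dp : 0 < d by rewrite lt_def dn0.
have := H 0; rewrite conjC0 !mul0r !addr0 => a0.
have aR : a^* = a by apply: conj_Creal; rewrite realE a0.
(* For [c = 0] the form is real-affine in [t]; this multiple of [b] sends it to [- (a + 2)], which
   is negative. *)
have := H (- (a + 1) / d * b).
rewrite !(rmorphM, rmorphN, rmorphD) /= rmorph1 fmorphV /= dR aR.
have -> : a + - (a + 1) / d * b^* * b + - (a + 1) / d * b * b^* =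
    a - 2 * (a + 1) / d * (b * b^*) by ring.
rewrite -dE mulfVK//.
have -> : a - 2 * (a + 1) = - (a + 2) by ring.
by rewrite oppr_ge0 => /(lt_le_trans (ltr_wpDl a0 (ltr0Sn _ 1))); rewrite ltxx.
Qed.

Lemma eq_from_diff (V : zmodType) (x y u v : V) : x - y = u - v -> u = v -> x = y.
Proof. by move=> h uv; apply/eqP; rewrite -subr_eq0 h uv subrr. Qed.

(* Hermitian symmetry follows from nonnegativity, see [sipC]. *)
Record sip (R : realType) (E : lmodType R[i]) := Sip {
  sipB :> E -> E -> R[i];
  sip_linl : forall c x y z, sipB (c *: x + y) z = c * sipB x z + sipB y z;
  sip_linr : forall c x y z, sipB z (c *: x + y) = c^* * sipB z x + sipB z y;
  sip_ge0 : forall x, 0 <= sipB x x }.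

Section SipTheory.
Variables (R : realType) (E : lmodType R[i]) (B : sip E).
Implicit Types (x y z : E) (c : R[i]).

Lemma sipDl x y z : B (x + y) z = B x z + B y z.
Proof. by rewrite -[x]scale1r sip_linl scale1r mul1r. Qed.

Lemma sipDr x y z : B z (x + y) = B z x + B z y.
Proof. by rewrite -[x]scale1r sip_linr scale1r rmorph1 mul1r. Qed.

Lemma sip0l z : B 0 z = 0.
Proof. by apply: (addrI (B 0 z)); rewrite -sipDl !addr0. Qed.

Lemma sip0r z : B z 0 = 0.
Proof. by apply: (addrI (B z 0)); rewrite -sipDr !addr0. Qed.

Lemma sipZl c x z : B (c *: x) z = c * B x z.
Proof. by rewrite -[c *: x]addr0 sip_linl sip0l addr0. Qed.

Lemma sipZr c x z : B z (c *: x) = c^* * B z x.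
Proof. by rewrite -[c *: x]addr0 sip_linr sip0r addr0. Qed.

Lemma sipNl x z : B (- x) z = - B x z.
Proof. by rewrite -scaleN1r sipZl mulN1r. Qed.

Lemma sipNr x z : B z (- x) = - B z x.
Proof. by rewrite -scaleN1r sipZr rmorphN rmorph1 mulN1r. Qed.

Lemma sipBl x y z : B (x - y) z = B x z - B y z.
Proof. by rewrite sipDl sipNl. Qed.

Lemma sipBr x y z : B z (x - y) = B z x - B z y.
Proof. by rewrite sipDr sipNr. Qed.

Lemma sip_suml I (r : seq I) (F : I -> E) z :
  B (\sum_(i <- r) F i) z = \sum_(i <- r) B (F i) z.
Proof.
by elim: r => [|i r IH]; rewrite ?big_nil ?sip0l// !big_cons sipDl IH.
Qed.

Lemma sip_sumr I (r : seq I) (F : I -> E) z :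
  B z (\sum_(i <- r) F i) = \sum_(i <- r) B z (F i).
Proof.
by elim: r => [|i r IH]; rewrite ?big_nil ?sip0r// !big_cons sipDr IH.
Qed.

Lemma sip_quad x y t :
  B (x + t *: y) (x + t *: y) =
  B x x + t^* * B x y + t * B y x + t * t^* * B y y.
Proof. by rewrite sipDl !sipDr !sipZl !sipZr; ring. Qed.

(** Reality of the form at [x + y] and at [x + 'i *: y] gives two linear relations between [B x y],
    [B y x] and their conjugates; adding them gives the symmetry. *)
Lemma sipC x y : B x y = (B y x)^*.
Proof.
have real z : (B z z)^* = B z z by apply: conj_Creal; rewrite realE sip_ge0.
have h1 := real (x + 1 *: y); have h2 := real (x + 'i *: y).
move: h1 h2; rewrite !sip_quad !(rmorphD, rmorphM) /= !real conjCK conjCi !rmorph1 rmorphN /= conjCi.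
move: (B x x) (B y y) (B x y) (B y x) => a b c d h1 h2.
have i0 : 'i != 0 :> R[i] by apply: neq0Ci.
have {}h1 : c^* + d^* = c + d by apply: (addrI a); apply: (addIr b); move: h1; rewrite !mul1r !addrA.
have {}h2 : c^* - d^* = d - c.
  apply: (mulfI i0); apply: (addrI a); apply: (addIr (- 'i * 'i * b)).
  by apply: (eq_from_diff _ h2); ring.
apply: (mulfI (x := 2)); first by rewrite pnatr_eq0.
by have e := congr2 (fun s t => s - t) h1 h2; apply: (eq_from_diff _ (esym e)); ring.
Qed.

Definition snorm x : R[i] := sqrtC (B x x).

Lemma snorm_ge0 x : 0 <= snorm x.
Proof. by rewrite sqrtC_ge0 sip_ge0. Qed.

Lemma sqr_snorm x : snorm x ^+ 2 = B x x.
Proof. exact: sqrtCK. Qed.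

Lemma sip_CS x y : `|B x y| <= snorm x * snorm y.
Proof.
rewrite -(@ler_pXn2r _ 2) ?nnegrE ?mulr_ge0 ?snorm_ge0// exprMn !sqrtCK.
apply: disc_le => [|t]; first exact: sip_ge0.
by have := sip_ge0 B (x + t *: y); rewrite sip_quad [B y x]sipC.
Qed.

Lemma snormZ c x : snorm (c *: x) = `|c| * snorm x.
Proof.
by rewrite /snorm sipZl sipZr mulrA -normCK rootCMl ?exprn_ge0// sqrCK.
Qed.

Lemma snorm0 : snorm 0 = 0.
Proof. by rewrite /snorm sip0l sqrtC0. Qed.

Lemma snormN x : snorm (- x) = snorm x.
Proof. by rewrite -scaleN1r snormZ normrN1 mul1r. Qed.

Lemma snormD x y : snorm (x + y) <= snorm x + snorm y.
Proof.
rewrite -(@ler_pXn2r _ 2) ?nnegrE ?addr_ge0 ?snorm_ge0//.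
rewrite sqrrD !sqrtCK -[y]scale1r sip_quad scale1r [B y x]sipC.
have := sip_CS x y; move: (B x y) => z zz.
rewrite rmorph1 !mul1r -addrA addrA lerD2r -addrA lerD2l.
have zzR : z + z^* \is Num.real by rewrite CrealE rmorphD /= conjCK addrC.
apply: le_trans (real_ler_norm zzR) (le_trans (ler_normD _ _) _).
by rewrite norm_conjC mulr2n lerD.
Qed.

Lemma snorm_dist x y z : snorm (x - z) <= snorm (x - y) + snorm (y - z).
Proof. by rewrite -[x - z](subrKA y) snormD. Qed.

Lemma snormC x y : snorm (x - y) = snorm (y - x).
Proof. by rewrite -snormN opprB. Qed.

End SipTheory.

(** * Hilbert spaces from complete inner product spaces *)

Record ips (R : realType) := Ips {
  ips_sort :> lmodType R[i];
  ips_dot :> sip ips_sort;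
  ips_dot_eq0 : forall x, ips_dot x x = 0 -> x = 0;
  ips_complete : forall u : nat -> ips_sort,
    (forall e, 0 < e -> exists N : nat, forall i j, (N <= i)%N -> (N <= j)%N ->
      snorm ips_dot (u i - u j) < e) ->
    exists l, forall e, 0 < e -> exists N : nat, forall i, (N <= i)%N ->
      snorm ips_dot (u i - l) < e }.

(* An alias of [X], to carry the topology of its norm. *)
Definition hilb (R : realType) (X : ips R) : Type := X.
HB.instance Definition _ (R : realType) (X : ips R) := GRing.Lmodule.on (hilb X).

Section HilbBuild.
Variables (R : realType) (X : ips R).
Definition hdot : hilb X -> hilb X -> R[i] := ips_dot X.

Lemma hdot_bilinear : bilinear_for
  (GRing.Scale.Law.clone _ _ *%R _) (GRing.Scale.Law.clone _ _ (Num.conj \; *%R) _) hdot.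
Proof.
by split=> [z c x y|x c y z] /=; [exact: sip_linl|exact: sip_linr].
Qed.

HB.instance Definition _ := bilinear_isBilinear.Build R[i] (hilb X) (hilb X) R[i] _ _ hdot hdot_bilinear.

Lemma hdot_herm (x y : hilb X) : hdot x y = (-1) ^+ false * (hdot y x)^*.
Proof. by rewrite expr0 mul1r; exact: sipC. Qed.

Lemma hdot_gt0 (x : hilb X) : x != 0 -> 0 < hdot x x.
Proof.
move=> xn0; rewrite lt_def sip_ge0 andbT; apply: contra_neq xn0.
exact: (@ips_dot_eq0 R X x).
Qed.

HB.instance Definition _ := isHermitianSesquilinear.Build R[i] (hilb X) false Num.conj hdot hdot_herm.
HB.instance Definition _ := isDotProduct.Build R[i] (hilb X) hdot hdot_gt0.

Lemma snorm_eq0 (x : hilb X) : snorm X x = 0 -> x = 0.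
Proof. by move/eqP; rewrite sqrtC_eq0 => /eqP; exact: (@ips_dot_eq0 R X x). Qed.

HB.instance Definition _ :=
  Lmodule_isNormed.Build R[i] (hilb X) (snormD X) (snormZ X) snorm_eq0.

Lemma hilb_normE (x : hilb X) : `|x| ^+ 2 = hdot x x.
Proof. exact: sqr_snorm. Qed.

(** Sequential completeness is carried over to filters: pick [A n] in [F] with mutual distances
    below 1/(n+1) and [u n] in the intersection of [A 0], ..., [A n]. The sequence [u] is Cauchy,
    and [F] converges to its limit. *)
Lemma hilb_complete (F : set_system (hilb X)) : ProperFilter F -> cauchy F -> cvg F.
Proof.
move=> FF /cauchy_ballP F_cauchy.
have Fn (n : nat) : exists A, F A /\ forall x y, A x -> A y -> `|x - y| < n.+1%:R^-1.
  have n0 : 0 < (n.+1%:R : R[i])^-1 / 2 by rewrite divr_gt0 ?invr_gt0// ltr0Sn.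
  have /cauchyP/(_ _ n0)[x Fx] : cauchy F by apply/cauchy_ballP.
  exists (ball x (n.+1%:R^-1 / 2)); split=> // y z.
  rewrite -!ball_normE /= => xy xz.
  have -> : y - z = (x - z) - (x - y) by rewrite opprB [RHS]addrC subrKA.
  apply: le_lt_trans (ler_normB _ _) _.
  by rewrite [ltRHS]splitr ltrD.
have [A AP] := choice Fn.
have Bn (n : nat) : exists x, forall i, (i <= n)%N -> A i x.
  have /filter_ex[x Ax] : F [set x | forall i : 'I_n.+1, A i x].
    by apply: filter_forall => i; exact: (AP i).1.
  by exists x => i ni; exact: (Ax (Ordinal (ni : (i < n.+1)%N))).
have [u uP] := choice Bn.
have [l lP] : exists l : hilb X, forall e, 0 < e -> exists N : nat, forall i, (N <= i)%N ->
      `|u i - l| < e.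
  apply: (@ips_complete R X) => e e0.
  have [N NP] := cplx_natSinv e0.
  exists N => i j Ni Nj; apply: lt_trans (NP _ (leqnn N)).
  by apply: (AP N).2; exact: uP.
apply/cvg_ex; exists l.
apply/cvgrPdist_lt => e e0.
have e2 : 0 < e / 2 by rewrite divr_gt0.
have [N1 N1P] := cplx_natSinv e2.
have [|N2 N2P] := lP (e / 2); first by [].
pose N := maxn N1 N2; apply: filterS (AP N).1 => x ANx.
have -> : l - x = (u N - x) - (u N - l) by rewrite opprB [RHS]addrC subrKA.
apply: le_lt_trans (ler_normB _ _) _; rewrite [e]splitr ltrD//.
  apply: lt_trans (N1P _ (leq_maxl N1 N2)).
  by apply: (AP N).2 => //; exact: uP.
exact: N2P (leq_maxr _ _).
Qed.

HB.instance Definition _ := Uniform_isComplete.Build (hilb X) hilb_complete.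

HB.instance Definition _ :=
  CompleteNormedModule_isHilbert.Build R (hilb X) (fun x => esym (hilb_normE x)).

End HilbBuild.

(** * Completion of a semi-inner product space *)

Section TendsMore.
Variable R : realType.
Implicit Types (u v a : nat -> R[i]) (l e M : R[i]).

Lemma tends_dom M a u l : 0 <= M -> tends a 0 ->
  (exists N : nat, forall n, (N <= n)%N -> `|u n - l| <= M * `|a n|) -> tends u l.
Proof.
move=> M0 a0 [N NP] e e0.
have M1 : 0 < M + 1 by rewrite ltr_wpDl.
have [N' N'P] := a0 _ (divr_gt0 e0 M1).
exists (maxn N N') => n; rewrite geq_max => /andP[/NP h /N'P].
rewrite subr0 ltr_pdivlMr// mulrC => h'.
by apply: le_lt_trans h (le_lt_trans _ h'); rewrite ler_wpM2r// lerDl.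
Qed.

Lemma tends_le u l M : (exists N : nat, forall n, (N <= n)%N -> 0 <= u n <= M) ->
  tends u l -> 0 <= l <= M.
Proof.
move=> [N NP] ul.
have ul' : tends (fun n => u (n + N)%N) l.
  by move=> e /ul[N' N'P]; exists N' => n Nn; apply: N'P; rewrite (leq_trans Nn)// leq_addr.
apply/andP; split.
  by apply: tends_ge0 ul' => n; have /andP[] := NP _ (leq_addl n N).
rewrite -subr_ge0 -[M - l]addrC -mulN1r.
have := tends_lin (-1) ul' (tends_cst M); apply: tends_ge0 => n.
by rewrite mulN1r addrC subr_ge0; have /andP[] := NP _ (leq_addl n N).
Qed.

End TendsMore.

Section Completion.
Variables (R : realType) (E : lmodType R[i]) (B : sip E).
Local Notation "`[ x ]" := (snorm B x).
Implicit Types (x y z : nat -> E) (F G : E -> R[i]).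

Definition scauchy x := forall e, 0 < e ->
  exists N : nat, forall i j, (N <= i)%N -> (N <= j)%N -> `[x i - x j] < e.

(** A point of the completion is encoded by the functional that its inner product defines on [E].
    Cauchy sequences with null difference define the same functional, so equality of functions takes
    the place of a quotient. *)
Definition represents x F := scauchy x /\ forall w, tends (fun n => B (x n) w) (F w).

Lemma scauchy_lin c x y : scauchy x -> scauchy y -> scauchy (fun n => c *: x n + y n).
Proof.
move=> xC yC e e0.
have c0 : 0 < `|c| + 1 by rewrite ltr_wpDl.
have e2 : 0 < e / 2 by rewrite divr_gt0.
have e1 : 0 < e / 2 / (`|c| + 1) by rewrite divr_gt0.
have [N1 N1P] := xC _ e1; have [N2 N2P] := yC _ e2.
exists (maxn N1 N2) => i j; rewrite !geq_max => /andP[i1 i2] /andP[j1 j2].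
rewrite opprD addrACA -scalerBr; apply: le_lt_trans (snormD _ _ _) _.
rewrite snormZ [e]splitr ltr_leD//; last exact/ltW/N2P.
have := N1P _ _ i1 j1; rewrite ltr_pdivlMr// mulrC => h1.
by apply: le_lt_trans h1; rewrite ler_wpM2r ?snorm_ge0// lerDl.
Qed.

Lemma scauchy_bound x : scauchy x ->
  exists N : nat, exists2 M, 0 <= M & forall n, (N <= n)%N -> `[x n] <= M.
Proof.
move=> /(_ 1 ltr01)[N NP]; exists N, (1 + `[x N]).
  by rewrite addr_ge0 ?snorm_ge0.
move=> n Nn; rewrite -[x n](subrK (x N)); apply: le_trans (snormD _ _ _) _.
by rewrite lerD2r ltW// NP.
Qed.

Lemma scauchy_cst (w : E) : scauchy (fun=> w).
Proof. by move=> e e0; exists 0%N => i j _ _; rewrite subrr snorm0. Qed.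

Lemma represents_lin c x y F G : represents x F -> represents y G ->
  represents (fun n => c *: x n + y n) (fun w => c * F w + G w).
Proof.
move=> [xC xF] [yC yG]; split; first exact: scauchy_lin.
by move=> w; apply: tends_ext (tends_lin c (xF w) (yG w)) => n; rewrite sip_linl.
Qed.

Lemma represents_cst (w : E) : represents (fun=> w) (B w).
Proof. by split=> [|v]; [exact: scauchy_cst|exact: tends_cst]. Qed.

Lemma tends_sqrt (u : nat -> R[i]) : (forall n, 0 <= u n) -> tends u 0 ->
  tends (fun n => sqrtC (u n)) 0.
Proof.
move=> u0 uc e e0; have [|N NP] := uc (e ^+ 2); first by rewrite exprn_gt0.
exists N => n /NP; rewrite !subr0 ger0_norm// ger0_norm ?sqrtC_ge0//.
by rewrite -(@ltr_pXn2r _ 2 _ (sqrtC _)) ?nnegrE ?sqrtC_ge0 ?(ltW e0)// sqrtCK.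
Qed.

(** A weakly null Cauchy sequence is null in norm: in [B (z n) (z n) = B (z n) (z n - z N) + B (z n)
    (z N)] the first term is small because [z] is Cauchy and bounded, the second by weak
    convergence. *)
Lemma represents0 z : represents z (fun=> 0) -> tends (fun n => `[z n]) 0.
Proof.
move=> [zC z0]; apply: tends_sqrt => [n|]; first exact: sip_ge0.
move=> e e0; have [N1 [M M0 MP]] := scauchy_bound zC.
have M1 : 0 < M + 1 by rewrite ltr_wpDl.
have e2 : 0 < e / 2 by rewrite divr_gt0.
have [N2 N2P] := zC _ (divr_gt0 e2 M1).
have [N3 N3P] := z0 (z N2) _ e2.
exists (maxn N1 (maxn N2 N3)) => n; rewrite !geq_max => /and3P[n1 n2 n3].
rewrite subr0 -{2}[z n](subrK (z N2)) sipDr.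
apply: le_lt_trans (ler_normD _ _) _; rewrite [e]splitr ltrD//; last first.
  by have := N3P _ n3; rewrite subr0.
apply: le_lt_trans (sip_CS _ _ _) _.
have := N2P _ _ n2 (leqnn _); rewrite ltr_pdivlMr// mulrC; apply: le_lt_trans.
by rewrite ler_wpM2r ?snorm_ge0// (le_trans (MP _ n1))// lerDl.
Qed.

Lemma scauchy_dot x y : scauchy x -> scauchy y -> exists l, tends (fun n => B (x n) (y n)) l.
Proof.
move=> xC yC; apply: tends_cauchy => e e0.
have [N1 [M1 M10 M1P]] := scauchy_bound xC; have [N2 [M2 M20 M2P]] := scauchy_bound yC.
have M1' : 0 < M1 + 1 by rewrite ltr_wpDl.
have M2' : 0 < M2 + 1 by rewrite ltr_wpDl.
have e2 : 0 < e / 2 by rewrite divr_gt0.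
have [N3 N3P] := xC _ (divr_gt0 e2 M2'); have [N4 N4P] := yC _ (divr_gt0 e2 M1').
exists (maxn (maxn N1 N2) (maxn N3 N4)) => i j; rewrite !geq_max.
move=> /andP[/andP[i1 i2] /andP[i3 i4]] /andP[/andP[j1 j2] /andP[j3 j4]].
have -> : B (x i) (y i) - B (x j) (y j) = B (x i - x j) (y i) + B (x j) (y i - y j).
  by rewrite sipBl sipBr addrA subrK.
apply: le_lt_trans (ler_normD _ _) _; rewrite [e]splitr ltrD//.
  apply: le_lt_trans (sip_CS _ _ _) _.
  have := N3P _ _ i3 j3; rewrite ltr_pdivlMr//; apply: le_lt_trans.
  by rewrite ler_wpM2l ?snorm_ge0// (le_trans (M2P _ i2))// lerDl.
apply: le_lt_trans (sip_CS _ _ _) _.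
have := N4P _ _ i4 j4; rewrite ltr_pdivlMr// mulrC; apply: le_lt_trans.
by rewrite ler_wpM2r ?snorm_ge0// (le_trans (M1P _ j1))// lerDl.
Qed.

Lemma tends_null_dot z y : tends (fun n => `[z n]) 0 -> scauchy y ->
  tends (fun n => B (z n) (y n)) 0.
Proof.
move=> z0 /scauchy_bound[N [M M0 MP]]; apply: (tends_dom M0 z0); exists N => n /MP h.
rewrite subr0 [`| `[_] |]ger0_norm ?snorm_ge0//; apply: le_trans (sip_CS _ _ _) _.
by rewrite mulrC ler_wpM2r ?snorm_ge0.
Qed.

Definition cdot F G : R[i] := xget 0 [set l | forall x y,
  represents x F -> represents y G -> tends (fun n => B (x n) (y n)) l].

Lemma cdotP x y F G : represents x F -> represents y G ->
  tends (fun n => B (x n) (y n)) (cdot F G).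
Proof.
move=> xF yG; rewrite /cdot; case: xgetP => [l _ lP|/(_ _)H]; first exact: lP.
have [l lP] := scauchy_dot xF.1 yG.1; case: (H l) => x' y' x'F y'G.
(* Sequences with the same functional have a null difference, so the limit defining [cdot] does not
   depend on the representatives. *)
have nul a b K : represents a K -> represents b K -> tends (fun n => `[a n - b n]) 0.
  move=> aK bK; apply: represents0; have := represents_lin (-1) bK aK.
  rewrite /represents => -[h1 h2]; split.
    by move=> e /h1[N NP]; exists N => i j Ni Nj; have := NP i j Ni Nj; rewrite !scaleN1r ![- _ + _]addrC.
  move=> w; have := h2 w; rewrite mulN1r addNr; apply: tends_ext => n.
  by rewrite scaleN1r addrC.
have h1 := tends_null_dot (nul _ _ _ x'F xF) y'G.1.
have h2 := tends_conj (tends_null_dot (nul _ _ _ y'G yG) xF.1).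
have := tends_lin 1 (tends_lin 1 h1 h2) lP; rewrite conjC0 !(mulr0, add0r).
apply: tends_ext => n; rewrite !mul1r -sipC sipBl sipBr; ring.
Qed.

End Completion.

(** * The completion as a space of functionals *)

Section ComplType.
Variables (R : realType) (E : lmodType R[i]) (B : sip E).

Definition representable : {pred E -> R[i]} := [pred F | `[< exists x, represents B x F >]].

Lemma representableP F : reflect (exists x, represents B x F) (F \in representable).
Proof. exact: asboolP. Qed.

Lemma representable_submod : submod_closed representable.
Proof.
split=> [|c F G].
  apply/representableP; exists (fun=> 0); have := represents_cst B 0.
  by rewrite (_ : sipB B 0 = 0)//; apply/funext => w; rewrite sip0l.
move=> /representableP[x xF] /representableP[y yG]; apply/representableP; exists (fun n => c *: x n + y n).
exact: represents_lin.
Qed.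

HB.instance Definition _ := GRing.isSubmodClosed.Build R[i] (E -> R[i]) representable
  representable_submod.

Record compl := Compl { cfun :> E -> R[i]; cfunP : cfun \in representable }.
HB.instance Definition _ := [isSub for cfun].
HB.instance Definition _ := [Choice of compl by <:].
HB.instance Definition _ := [SubChoice_isSubLmodule of compl by <:].

Lemma compl_rep (F : compl) : exists x, represents B x F.
Proof. exact/representableP/cfunP. Qed.

Lemma cdotlin c (F G K : compl) : cdot B (c *: F + G) K = c * cdot B F K + cdot B G K.
Proof.
have [[x xF] [y yG] [z zK]] := And3 (compl_rep F) (compl_rep G) (compl_rep K).
have xyr : represents B (fun n => c *: x n + y n) (c *: F + G) by exact: (represents_lin c xF yG).
apply: tends_uniq (cdotP xyr zK) _.
apply: tends_ext (tends_lin c (cdotP xF zK) (cdotP yG zK)) => n.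
by rewrite sip_linl.
Qed.

Lemma cdotC (F G : compl) : cdot B F G = (cdot B G F)^*.
Proof.
have [[x xF] [y yG]] := conj (compl_rep F) (compl_rep G).
apply: tends_uniq (cdotP xF yG) _.
by apply: tends_ext (tends_conj (cdotP yG xF)) => n; rewrite -sipC.
Qed.

Lemma cdotrin c (F G K : compl) : cdot B K (c *: F + G) = c^* * cdot B K F + cdot B K G.
Proof. by rewrite cdotC cdotlin rmorphD rmorphM /= -!cdotC. Qed.

Lemma cdot_ge0 (F : compl) : 0 <= cdot B F F.
Proof.
have [x xF] := compl_rep F.
by apply: tends_ge0 (cdotP xF xF) => n; exact: sip_ge0.
Qed.

Definition csip : sip compl := @Sip R compl (cdot B) cdotlin cdotrin cdot_ge0.

Lemma csip_eq0 (F : compl) : csip F F = 0 -> F = 0.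
Proof.
have [x xF] := compl_rep F => /= F0; apply/val_inj/funext => w /=.
apply: tends_uniq (xF.2 w) _.
have := cdotP xF xF; rewrite F0 => /tends_sqrt h.
apply: (tends_dom (snorm_ge0 B w) (h _)) => [n|]; first exact: sip_ge0.
exists 0%N => n _; rewrite subr0 [`| sqrtC _|]ger0_norm ?snorm_ge0// mulrC.
exact: sip_CS.
Qed.

Lemma cemb_subproof (w : E) : sipB B w \in representable.
Proof. by apply/representableP; exists (fun=> w); exact: represents_cst. Qed.

Definition cemb (w : E) : compl := Compl (cemb_subproof w).

(** The reproducing property of the completion; it turns identities between inner products into
    identities between values of functionals. *)
Lemma cdot_emb (F : compl) (w : E) : csip F (cemb w) = F w.
Proof.
have [x xF] := compl_rep F.
exact: tends_uniq (cdotP xF (represents_cst B w)) (xF.2 w).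
Qed.

Lemma cemb_lin c (v w : E) : cemb (c *: v + w) = c *: cemb v + cemb w.
Proof. by apply/val_inj/funext => z; rewrite [LHS]sip_linl. Qed.

Lemma cembB (v w : E) : cemb (v - w) = cemb v - cemb w.
Proof. by rewrite addrC -scaleN1r cemb_lin scaleN1r addrC. Qed.

Lemma snorm_emb (w : E) : snorm csip (cemb w) = snorm B w.
Proof. by rewrite /snorm cdot_emb. Qed.

Lemma represents_dist (x : nat -> E) (F : compl) : represents B x F ->
  tends (fun n => snorm csip (F - cemb (x n))) 0.
Proof.
move=> xF e e0; have e2 : 0 < e / 2 by rewrite divr_gt0.
have [N NP] := xF.1 _ e2; exists N => n Nn.
rewrite subr0 ger0_norm ?snorm_ge0//.
have rep : represents B (fun k => x k - x n) (F - cemb (x n)).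
  have := represents_lin (-1) (represents_cst B (x n)) xF.
  rewrite (_ : (fun _ => _ + F _) = F - cemb (x n)); last first.
    by apply/funext => w; rewrite mulN1r addrC.
  by rewrite (_ : (fun k => _ + x k) = fun k => x k - x n)//; apply/funext => k; rewrite scaleN1r addrC.
apply: (@le_lt_trans _ _ (e / 2)); last by rewrite ltr_pdivrMr// ltr_pMr// ltr1n.
rewrite -(@ler_pXn2r _ 2) ?nnegrE ?snorm_ge0 ?(ltW e2)// sqr_snorm.
suff /andP[] : 0 <= csip (F - cemb (x n)) (F - cemb (x n)) <= (e / 2) ^+ 2 by [].
apply: tends_le (cdotP rep rep); exists N => k Nk.
by rewrite sip_ge0/= -sqr_snorm ler_pXn2r ?nnegrE ?snorm_ge0 ?(ltW e2)// ltW// NP.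
Qed.

Lemma cemb_dense (F : compl) e : 0 < e -> exists w, snorm csip (F - cemb w) < e.
Proof.
move=> e0; have [x /represents_dist/(_ _ e0)[N NP]] := compl_rep F.
by exists (x N); have := NP N (leqnn N); rewrite subr0 ger0_norm ?snorm_ge0.
Qed.

(** Approximate [u n] within 1/(n+1) by an embedded vector [z n]; the sequence [z] is Cauchy in [E],
    and the functional it represents is the limit. *)
Lemma compl_complete (u : nat -> compl) :
  (forall e, 0 < e -> exists N : nat, forall i j, (N <= i)%N -> (N <= j)%N ->
    snorm csip (u i - u j) < e) ->
  exists l, forall e, 0 < e -> exists N : nat, forall i, (N <= i)%N ->
    snorm csip (u i - l) < e.
Proof.
move=> uC.
have [z zP] := choice (fun n => @cemb_dense (u n) (n.+1%:R^-1)
  (ltac:(by rewrite invr_gt0 ltr0Sn))).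
have zC : scauchy B z.
  move=> e e0; have e3 : 0 < e / 2 / 2 by rewrite !divr_gt0.
  have e2 : 0 < e / 2 by rewrite !divr_gt0.
  have [N1 N1P] := cplx_natSinv e3; have [N2 N2P] := uC _ e2.
  exists (maxn N1 N2) => i j; rewrite !geq_max => /andP[i1 i2] /andP[j1 j2].
  rewrite -snorm_emb cembB.
  apply: le_lt_trans (snorm_dist _ _ (u i) _) _; rewrite [e]splitr.
  apply: le_lt_trans (lerD (lexx _) (snorm_dist _ _ (u j) _)) _.
  have -> : e / 2 + e / 2 = e / 2 / 2 + (e / 2 + e / 2 / 2) by field.
  apply: ltrD; first by rewrite snormC; exact: lt_trans (zP i) (N1P _ i1).
  apply: ltrD; first exact: N2P.
  exact: lt_trans (zP j) (N1P _ j1).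
have [F FP] := choice (fun w => scauchy_dot zC (scauchy_cst B w)).
have zF : represents B z F by [].
have FR : F \in representable by apply/representableP; exists z.
exists (Compl FR) => e e0; have e2 : 0 < e / 2 by rewrite divr_gt0.
have [N1 N1P] := @represents_dist z (Compl FR) zF _ e2.
have [N2 N2P] := cplx_natSinv e2.
exists (maxn N1 N2) => n; rewrite geq_max => /andP[n1 n2].
apply: le_lt_trans (snorm_dist csip _ (cemb (z n)) _) _; rewrite [e]splitr ltrD//.
  exact: lt_trans (zP n) (N2P _ n2).
by have := N1P _ n1; rewrite subr0 ger0_norm ?snorm_ge0// snormC.
Qed.

Definition cips : ips R := @Ips R compl csip csip_eq0 compl_complete.

End ComplType.

(** * The M. Riesz extension theorem *)

Section RieszExtension.
Variables (R : realType) (V : lmodType R[i]) (C V0 : set V) (f : V -> R).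
Hypothesis C0 : C 0.
Hypothesis CD : forall u v, C u -> C v -> C (u + v).
Hypothesis CZ : forall (c : R) u, 0 < c -> C u -> C (c%:C%C *: u).
Hypothesis V00 : V0 0.
Hypothesis V0P : forall (c : R) u v, V0 u -> V0 v -> V0 (c%:C%C *: u + v).
Hypothesis fP : forall (c : R) u v, V0 u -> V0 v ->
  f (c%:C%C *: u + v) = c * f u + f v.
Hypothesis f_ge0 : forall v, V0 v -> C v -> 0 <= f v.
Hypothesis cofinal : forall v, exists2 u, V0 u & C (u - v).

(** A partial extension is encoded as a graph. That it is single-valued follows from the other
    conditions: a pair with first component 0 has a nonnegative second component, and so has its
    opposite. *)
Let good (G : set (V * R)) := [/\ [set p | V0 p.1 /\ p.2 = f p.1] `<=` G,
  forall (c : R) p q, G p -> G q -> G (c%:C%C *: p.1 + q.1, c * p.2 + q.2) &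
  forall p, G p -> C p.1 -> 0 <= p.2].

Let G0 := [set p : V * R | V0 p.1 /\ p.2 = f p.1].

Let good0 : good G0.
Proof.
split=> // [c p q [p0 pf] [q0 qf]|p [p0 ->]]; last exact: f_ge0.
by split=> /=; [exact: V0P|rewrite fP// pf qf].
Qed.

Let good_step G v0 : good G -> (forall r, ~ G (v0, r)) ->
  exists G', [/\ good G', G `<=` G' & exists r, G' (v0, r)].
Proof.
move=> [G0G Glin Gpos] nG.
have f0 : f 0 = 0 by have := fP 1 V00 V00; rewrite scaler0 addr0 mul1r => /eqP; rewrite -subr_eq subrr => /eqP.
have G00 : G (0, 0) by apply: G0G; split=> //=.
have GZ (c : R) v r : G (v, r) -> G (c%:C%C *: v, c * r).
  by move=> h; have := Glin c _ _ h G00; rewrite /= !addr0.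
have GN v r : G (v, r) -> G (- v, - r).
  by move=> /(GZ (-1)); rewrite rmorphN rmorph1 scaleN1r mulN1r.
have GB v r v' r' : G (v, r) -> G (v', r') -> G (v - v', r - r').
  by move=> h /GN h'; have := Glin 1 _ _ h h'; rewrite /= rmorph1 scale1r mul1r.
pose A := [set r | exists2 v, G (v, r) & C (v0 - v)].
have [w Vw Cw] := cofinal v0.
have GV v : V0 v -> G (v, f v) by move=> Vv; apply: G0G.
have Aub : ubound A (f w).
  move=> r [v Gv Cv]; have := Gpos _ (GB _ _ _ _ (GV _ Vw) Gv); rewrite /= subr_ge0; apply.
  by rewrite -[w](subrK v0) -addrA; exact: CD.
have supA : has_sup A.
  split; last by exists (f w).
  have [u Vu Cu] := cofinal (- v0).
  exists (- f u), (- u); first exact/GN/GV.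
  by rewrite opprK addrC -[v0]opprK.
exists [set p | exists v r (t : R), G (v, r) /\ p = (v + t%:C%C *: v0, r + t * sup A)].
split.
- split.
  + move=> [v r] [/= Vv ->]; exists v, (f v), 0; split; first exact: GV.
    by rewrite rmorph0 scale0r mul0r !addr0.
  + move=> c _ _ [v [r [t [Gv ->]]]] [v' [r' [t' [Gv' ->]]]] /=.
    exists (c%:C%C *: v + v'), (c * r + r'), (c * t + t'); split; first exact: (Glin c _ _ Gv Gv').
    congr (_, _); last by ring.
    by rewrite scalerDr addrACA scalerA -scalerDl -rmorphM -rmorphD.
  + move=> _ [v [r [t [Gv ->]]]] /= Ct.
    have [t0|t0|t0] := ltgtP t 0.
    * have t0' : 0 < - t by rewrite oppr_gt0.
      have ti : 0 < (- t)^-1 by rewrite invr_gt0.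
      have Gv' := GZ (- t)^-1 _ _ Gv.
      have : sup A <= (- t)^-1 * r.
        apply: ge_sup; first exact: supA.1.
        move=> r' [v' Gv'' Cv'']; rewrite -subr_ge0.
        apply: (Gpos _ (GB _ _ _ _ Gv' Gv'')) => /=.
        have := CD (CZ ti Ct) Cv''.
        have tE : (- t)^-1 * t = -1 by rewrite invrN mulNr mulVf ?lt_eqF.
        rewrite scalerDr scalerA -rmorphM tE rmorphN rmorph1 scaleN1r.
        by rewrite addrA subrK.
      by rewrite mulrC ler_pdivlMr//; lra.
    * have ti : 0 < t^-1 by rewrite invr_gt0.
      have Gv' := GN _ _ (GZ t^-1 _ _ Gv).
      have : - (t^-1 * r) <= sup A.
        apply: (sup_upper_bound supA); exists (- (t^-1%:C%C *: v)) => //.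
        have := CZ ti Ct; rewrite scalerDr scalerA -rmorphM mulVf ?gt_eqF//.
        by rewrite rmorph1 scale1r opprK addrC.
      by rewrite -mulrN mulrC ler_pdivrMr//; lra.
    * move: Ct; rewrite t0 rmorph0 scale0r mul0r !addr0; exact: (Gpos _ Gv).
- by move=> [v r] Gv; exists v, r, 0; rewrite rmorph0 scale0r mul0r !addr0.
- exists (sup A), 0, 0, 1; split=> //.
  by rewrite rmorph1 scale1r mul1r !add0r.
Qed.

Lemma riesz_extension : exists g : V -> R,
  [/\ forall (c : R) u v, g (c%:C%C *: u + v) = c * g u + g v,
      forall v, V0 v -> g v = f v & forall v, C v -> 0 <= g v].
Proof.
(* Joining [G0] makes the property hold for the union of the empty chain as well. *)
pose P := [set X | good (X `|` G0)].
have [|A [/= gA Amax]] := @Zorn_bigcup _ P.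
  move=> F FP Ftot; rewrite /P /=.
  pose F' := F `|` [set set0].
  have FP' X : F' X -> good (X `|` G0) by move=> [/FP//|->]; rewrite set0U.
  have mem p : (\bigcup_(X in F) X `|` G0) p -> exists2 X, F' X & (X `|` G0) p.
    by move=> [[X FX Xp]|G0p]; [exists X; left|exists set0; right].
  have sub X : F' X -> X `|` G0 `<=` \bigcup_(X in F) X `|` G0.
    by move=> [FX p [Xp|]|-> p [//|]]; [left; exists X|right|right].
  split=> [p G0p|c p q /mem[X FX Xp] /mem[Y FY Yq]|p /mem[X FX Xp]]; first by right.
    have [XY|YX] : X `<=` Y \/ Y `<=` X.
      case: FX FY => [FX|->] [FY|->]; [exact: Ftot|by right|by left|by left].
      apply: (sub Y FY); have [_ lin _] := FP' _ FY; apply: lin => //.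
      by case: Xp => [/XY|]; [left|right].
    apply: (sub X FX); have [_ lin _] := FP' _ FX; apply: lin => //.
    by case: Yq => [/YX|]; [left|right].
  by have [_ _ pos] := FP' _ FX; exact: pos.
pose G := A `|` G0.
have tot v : exists r, G (v, r).
  apply: contrapT => /forallNP nG.
  have [G' [gG' GG' [r G'v]]] := good_step gA nG.
  apply: (Amax G').
    split; first by move=> p Ap; apply: GG'; left.
    by move=> /(_ _ G'v) Avr; apply: (nG r); left.
  rewrite /P /= (_ : _ `|` _ = G')//; apply/seteqP; split; last exact: subsetUl.
  by move=> p [//|]; case: gG' => + _ _; exact.
have [G0G Glin Gpos] := gA.
have [g gP] := choice tot; exists g.
have G00 : G (0, 0).
  have := Glin (-1) _ _ (gP 0) (gP 0).
  by rewrite rmorphN rmorph1 scaleN1r oppr0 addr0 mulN1r addNr.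
have uniq v r r' : G (v, r) -> G (v, r') -> r = r'.
  suff ge v1 r1 r2 : G (v1, r1) -> G (v1, r2) -> r1 <= r2.
    by move=> h h'; apply/eqP; rewrite eq_le !(ge v).
  move=> h h'; have := Gpos _ (Glin (-1) _ _ h h') => /=.
  by rewrite rmorphN rmorph1 scaleN1r addNr mulN1r addrC subr_ge0; apply.
split=> [c u v|v Vv|v Cv].
- exact: uniq (gP _) (Glin c _ _ (gP u) (gP v)).
- by apply: uniq (gP v) _; apply: G0G.
- exact: (Gpos _ (gP v)).
Qed.

End RieszExtension.

(** * Inner products and operators in a Hilbert space *)

Section HilbertLemmas.
Variables (R : realType) (H : hilbertType R).
Implicit Types (x y : H) (N : linop H).

Lemma inner_linl c x y z : '[c *: x + y, z] = c * '[x, z] + '[y, z].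
Proof. by rewrite /inner linearPl. Qed.

Lemma innerC x y : '[x, y] = ('[y, x])^*.
Proof. by rewrite /inner hermC expr0 mul1r. Qed.

Lemma inner_linr c x y z : '[z, c *: x + y] = c^* * '[z, x] + '[z, y].
Proof. by rewrite innerC inner_linl rmorphD rmorphM /= -!innerC. Qed.

Lemma inner_ge0 x : 0 <= '[x, x].
Proof. by rewrite /inner dotp_norm exprn_ge0. Qed.

Definition inner_sip : sip H := Sip inner_linl inner_linr inner_ge0.

Lemma innerBl x y z : '[x - y, z] = '[x, z] - '[y, z].
Proof. exact: (sipBl inner_sip). Qed.

Lemma innerBr x y z : '[z, x - y] = '[z, x] - '[z, y].
Proof. exact: (sipBr inner_sip). Qed.

Lemma innerZl c x y : '[c *: x, y] = c * '[x, y].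
Proof. exact: (sipZl inner_sip). Qed.

Lemma innerZr c x y : '[x, c *: y] = c^* * '[x, y].
Proof. exact: (sipZr inner_sip). Qed.

Lemma snorm_inner x : snorm inner_sip x = `|x|.
Proof. by rewrite /snorm /= /inner dotp_norm sqrCK. Qed.

Lemma inner_norm x : '[x, x] = `|x| ^+ 2.
Proof. exact: dotp_norm. Qed.

Lemma inner_CS x y : `|'[x, y]| <= `|x| * `|y|.
Proof. by rewrite -!snorm_inner; exact: sip_CS. Qed.

Lemma densely_definedP N : densely_defined N <->
  forall x e, 0 < e -> exists2 x', dom N x' & `|x - x'| < e.
Proof.
split=> [dN x e e0|dN O [x Ox] Oo].
  have [||x' [/= /interior_subset bx' dx']] := dN (ball x e)^°.
  - by exists x; exact: nbhsx_ballx.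
  - exact: open_interior.
  - by exists x' => //; move: bx'; rewrite -ball_normE.
have /nbhs_ballP[e /= e0 eO] : nbhs x O by apply: open_nbhs_nbhs.
by have [x' dx' xx'] := dN x e e0; exists x'; split => //; apply: eO; rewrite -ball_normE.
Qed.

Lemma closed_opP N : closed_op N <->
  forall x y, (forall e, 0 < e -> exists x', [/\ dom N x', `|x - x'| < e & `|y - N x'| < e]) ->
    dom N x /\ N x = y.
Proof.
split=> [cN x y xy|cN [x y] xy].
  apply: (cN (x, y)) => B /nbhs_ballP[e /= e0 eB].
  have [x' [dx' xx' yx']] := xy e e0; exists (x', N x'); split=> //; apply: eB.
  by split; rewrite /= -ball_normE.
apply: cN => e e0; have [|[x' y'] [[/= dx' <-] [/= bx by']]] := xy (ball (x, y) e).
  exact: nbhsx_ballx.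
by exists x'; split=> //; [move: bx|move: by']; rewrite -ball_normE.
Qed.

Lemma hilbert_complete (u : nat -> H) :
  (forall e, 0 < e -> exists N : nat, forall i j, (N <= i)%N -> (N <= j)%N ->
    `|u i - u j| < e) ->
  exists l, forall e, 0 < e -> exists N : nat, forall i, (N <= i)%N -> `|u i - l| < e.
Proof.
move=> uC; have /cvg_ex[l ul] : cvg (u @ \oo).
  apply: cauchy_cvg; apply: cauchy_exP => e /uC[N NP].
  exists (u N); exists N => // n /= Nn.
  by rewrite -ball_normE; exact: NP.
exists l => e e0; move/cvgrPdist_lt : ul => /(_ e e0)[N _ NP].
by exists N => n Nn; rewrite distrC; exact: NP.
Qed.

Lemma inner_tends (u v : nat -> H) x y :
  tends (fun n => `|u n - x|) 0 -> tends (fun n => `|v n - y|) 0 ->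
  tends (fun n => '[u n, v n]) '[x, y].
Proof.
move=> ux vy.
have a0 : tends (fun n => (`|y| + 1) * `|u n - x| + `|x| * `|v n - y|) 0.
  have := tends_lin (`|y| + 1) ux (tends_lin `|x| vy (tends_cst 0)).
  by rewrite !mulr0 !addr0; apply: tends_ext => n; rewrite addr0.
apply: (tends_dom ler01 a0); have [N NP] := vy _ ltr01; exists N => n /NP.
rewrite subr0 normr_id mul1r [leRHS]ger0_norm; last by rewrite addr_ge0 ?mulr_ge0 ?addr_ge0.
move=> vn; have -> : '[u n, v n] - '[x, y] = '[u n - x, v n] + '[x, v n - y].
  by rewrite innerBl innerBr; ring.
apply: le_trans (ler_normD _ _) _; rewrite lerD ?inner_CS//.
apply: le_trans (inner_CS _ _) _; rewrite mulrC ler_wpM2r//.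
rewrite -[v n](subrK y) addrC; apply: le_trans (ler_normD _ _) _.
by rewrite lerD2l ltW.
Qed.

End HilbertLemmas.

(** * Extension of an isometry from a dense set *)

Section IsometricExtension.
Variables (R : realType) (H K : hilbertType R) (D : set H) (iota : H -> K).
Hypothesis D_dense : forall x e, 0 < e -> exists2 x', D x' & `|x - x'| < e.
Hypothesis iota_iso : forall f g, D f -> D g -> '[iota f, iota g] = '[f, g].

Let J_rel h x := exists f : nat -> H,
  [/\ forall n, D (f n), tends (fun n => `|f n - h|) 0 & tends (fun n => `|iota (f n) - x|) 0].

Let J_rel_iso h x h' x' : J_rel h x -> J_rel h' x' -> '[x, x'] = '[h, h'].
Proof.
move=> [f [Df fh fx]] [g [Dg gh gx]]; apply: (tends_uniq (inner_tends fx gx)).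
by apply: tends_ext (inner_tends fh gh) => n; rewrite iota_iso.
Qed.

Let norm_iota f g : D f -> D g -> `|iota f - iota g| = `|f - g|.
Proof.
move=> Df Dg; apply/eqP; rewrite -(@eqrXn2 _ 2)// -!inner_norm.
rewrite !(innerBl, innerBr).
by rewrite !iota_iso.
Qed.

Let J_rel_ex h : exists x, J_rel h x.
Proof.
have [f fP] := choice (fun n => let: ex_intro2 x p q := @D_dense h (n.+1%:R^-1)
  (ltac:(by rewrite invr_gt0 ltr0Sn)) in ex_intro (fun x => D x /\ `|h - x| < n.+1%:R^-1) x (conj p q)).
have [l lP] : exists l, forall e, 0 < e -> exists N : nat, forall i, (N <= i)%N -> `|iota (f i) - l| < e.
  apply: hilbert_complete => e e0; have e2 : 0 < e / 2 by rewrite divr_gt0.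
  have [N NP] := cplx_natSinv e2; exists N => i j Ni Nj.
  rewrite (norm_iota (fP i).1 (fP j).1).
  have -> : f i - f j = (h - f j) - (h - f i) by rewrite opprB [RHS]addrC subrKA.
  apply: le_lt_trans (ler_normB _ _) _; rewrite [e]splitr; apply: ltrD.
    exact: lt_trans (fP j).2 (NP _ Nj).
  exact: lt_trans (fP i).2 (NP _ Ni).
exists l, f; split=> [n|e e0|e e0]; first exact: (fP n).1.
  have [N NP] := cplx_natSinv e0; exists N => n Nn.
  rewrite subr0 normr_id distrC; exact: lt_trans (fP n).2 (NP _ Nn).
by have [N NP] := lP _ e0; exists N => n Nn; rewrite subr0 normr_id NP.
Qed.

(** Linearity comes from preservation of inner products: the squared norm of
    [J (c *: x + y) - (c *: J x + J y)] equals that of the corresponding combination in [H], which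
    is 0. *)
Lemma isometric_extension :
  exists J : {linear H -> K}, isometric_embedding J /\ forall f, D f -> J f = iota f.
Proof.
have [J JP] := choice J_rel_ex.
have J_iso x y : '[J x, J y] = '[x, y] by exact: J_rel_iso.
have eq0 (x : K) : '[x, x] = 0 -> x = 0.
  by rewrite inner_norm => /eqP; rewrite sqrf_eq0 normr_eq0 => /eqP.
have J_lin : linear J.
  move=> c x y; apply/eqP; rewrite -subr_eq0; apply/eqP/eq0.
  rewrite !(innerBl, innerBr, inner_linl, inner_linr) !J_iso.
  by rewrite !(inner_linl, inner_linr); ring.
pose m := GRing.isLinear.Build _ _ _ _ J J_lin.
pose Jl : {linear H -> K} := HB.pack J m.
exists Jl; split=> // f Df /=.
have JD : J_rel f (iota f).
  exists (fun=> f); split=> //; under eq_fun do rewrite subrr normr0; exact: tends_cst.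
apply/eqP; rewrite -subr_eq0; apply/eqP/eq0.
rewrite !(innerBl, innerBr).
rewrite !(J_rel_iso (JP f) (JP f), J_rel_iso (JP f) JD, J_rel_iso JD (JP f), J_rel_iso JD JD).
by rewrite !subrr.
Qed.

End IsometricExtension.

(** * Positive kernels on N_+ *)

Section FreeModule.
Variables (R : realType) (K : choiceType).
Local Notation E := {freeg K / R[i]}.

HB.instance Definition _ (M : lmodType R[i]) (h : K -> M) :=
  GRing.isZmodMorphism.Build E M (fglift h) (lift_is_additive h).

Lemma fgliftE (M : lmodType R[i]) (h : K -> M) (x : E) :
  fglift h x = \sum_(z <- freeg.dom x) coeff z x *: h z.
Proof.
rewrite -{1}[x]freeg_sumE raddf_sum /=; apply: eq_bigr => z _.
by rewrite liftU.
Qed.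

Lemma fgliftEw (M : lmodType R[i]) (h : K -> M) (r : seq K) (x : E) : uniq r ->
  (forall z, z \in freeg.dom x -> z \notin r -> h z = 0) ->
  fglift h x = \sum_(z <- r) coeff z x *: h z.
Proof.
move=> ur hr; rewrite fgliftE (bigID [in r]) /= [X in _ + X]big1_seq ?addr0; last first.
  by move=> z /andP[zr zx]; rewrite hr// scaler0.
rewrite [RHS](bigID [in freeg.dom x]) /= [X in _ = _ + X]big1_seq ?addr0; last first.
  by move=> z /andP[zx _]; rewrite coeff_outdom// scale0r.
rewrite -big_filter -[RHS]big_filter; apply: perm_big; apply: uniq_perm.
- exact/filter_uniq/uniq_dom.
- exact: filter_uniq.
- by move=> z; rewrite !mem_filter andbC.
Qed.

Lemma fgliftP (M : lmodType R[i]) (h : K -> M) c (x y : E) :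
  fglift h (c *: x + y) = c *: fglift h x + fglift h y.
Proof.
rewrite raddfD /=; congr (_ + _).
rewrite [fglift h x]fgliftE (@fgliftEw _ h (freeg.dom x)) ?uniq_dom//.
  by rewrite scaler_sumr; apply: eq_bigr => z _; rewrite coeffZ scalerA.
by move=> z /domZ_subset ->.
Qed.

Lemma fgliftZ (M : lmodType R[i]) (h : K -> M) c (x : E) :
  fglift h (c *: x) = c *: fglift h x.
Proof. by have := fgliftP h c x 0; rewrite raddf0 !addr0. Qed.

Lemma fglift1 (M : lmodType R[i]) (h : K -> M) z :
  fglift h (<< z >> : E) = h z.
Proof. by rewrite liftU scale1r. Qed.

(** The two conjugations turn the linear lift into one that is conjugate linear in [y]. *)
Definition kform (k : K -> K -> R[i]) (x y : E) : R[i] :=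
  fglift (fun s => (fglift (fun t => (k s t)^*) y)^*) x.

Lemma kform_linl k c x y z : kform k (c *: x + y) z = c * kform k x z + kform k y z.
Proof. exact: fgliftP. Qed.

Lemma kformE k x y : kform k x y =
  \sum_(s <- freeg.dom x) \sum_(t <- freeg.dom y) coeff s x * (coeff t y)^* * k s t.
Proof.
rewrite /kform fgliftE; apply: eq_bigr => s _; rewrite fgliftE rmorph_sum /= scaler_sumr.
by apply: eq_bigr => t _; rewrite -[X in X^*]/(_ * _) rmorphM /= conjCK; exact: mulrA.
Qed.

Lemma kform_linr k c x y z : kform k z (c *: x + y) = c^* * kform k z x + kform k z y.
Proof.
rewrite /kform !fgliftE mulr_sumr -big_split /=; apply: eq_bigr => s _.
rewrite fgliftP rmorphD rmorphM /= -![_ *: _]/(_ * _); ring.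
Qed.

Lemma kform1 k s t : kform k << s >> << t >> = k s t.
Proof. by rewrite /kform !fglift1 conjCK. Qed.

End FreeModule.

(* [(j, k)] encodes z^j (z / conj z)^k = z^(j+k) (conj z)^(-k): these are the
   monomials z^m (conj z)^n with m + n >= 0. *)
Notation nplus := (nat * int)%type.

Definition npl_eval (R : realType) (s : nplus) (z : R[i]) : R[i] :=
  z ^+ s.1 * (z / z^*) ^ s.2.

(** From conj z = z (z / conj z)^(-1), the conjugate of the monomial (j, k) is (j, - k - j). For the
    same reason [npl_mon p q] below encodes z^p (conj z)^q. *)
Definition npl_mulstar (s t : nplus) : nplus :=
  ((s.1 + t.1)%N, s.2 - t.2 - t.1%:Z).

Definition npl_mon (p q : nat) : nplus := ((p + q)%N, - q%:Z).

(** One list serves all functions supported in [A], so that several such sums can be added term by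
    term. *)
Lemma fsum_seq (W : zmodType) (I : choiceType) (P A : set I) : finite_set A ->
  exists r : seq I, forall F : I -> W, (forall i, F i != 0 -> A i) ->
    \sum_(i \in P) F i = \sum_(i <- r) F i.
Proof.
move=> Af; exists (finmap.enum_fset (fset_set (P `&` A))) => F FA.
rewrite -(fsbig_widen (P `&` A) P) ?fsbig_finite//; first exact: finite_setIr.
move=> i /= [Pi nA]; apply/eqP; apply/negPn/negP => /FA Ai; apply: nA; split=> //.
Qed.

Section Nplus.
Variable R : realType.
Implicit Types (z : R[i]).

Lemma npl_eval_mulstar s t z : z != 0 ->
  npl_eval (npl_mulstar s t) z = npl_eval s z * (npl_eval t z)^*.
Proof.
move=> z0; have zc0 : z^* != 0 by rewrite conjC_eq0.
have u0 : z / z^* != 0 by rewrite mulf_neq0 ?invr_eq0.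
rewrite /npl_eval /npl_mulstar /= rmorphM rmorphXn fmorphXz /= rmorphM fmorphV /= conjCK.
have -> : z^* / z = (z / z^*)^-1 by rewrite invf_div.
rewrite -addrA -opprD !expfzDr// exprD -invr_expz exprz_inv expfzDr// invfM.
rewrite -!mulrA; congr (_ * _).
rewrite mulrCA; congr (_ * _); rewrite [RHS]mulrC mulrCA; congr (_ * _).
  by rewrite invr_expz.
by rewrite -exprnP expr_div_n invf_div mulrCA divff ?mulr1// expf_neq0.
Qed.

Lemma npl_eval_mon p q z : z != 0 -> npl_eval (npl_mon p q) z = z ^+ p * z^* ^+ q.
Proof.
move=> z0; have zc0 : z^* != 0 by rewrite conjC_eq0.
rewrite /npl_eval /npl_mon /= exprD -exprnN expr_div_n invf_div.
by rewrite -mulrA; congr (_ * _); rewrite mulrCA divff ?mulr1// expf_neq0.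
Qed.

Lemma npl_mon_inj p q p' q' : npl_mon p q = npl_mon p' q' -> p = p' /\ q = q'.
Proof. by case=> e /oppr_inj[qE]; move: e; rewrite qE => /addIn ->. Qed.

Lemma laurentNplus_cst0 : laurentNplus (fun=> 0 : R[i]).
Proof.
exists (fun=> 0) => [|z z0].
  by rewrite (_ : [set _ | _] = set0)//; apply/seteqP; split=> // mn /=; rewrite eqxx.
by rewrite fsbig1// => mn _; rewrite !mul0r.
Qed.

Lemma laurentNplus_lin c (f g : R[i] -> R[i]) : laurentNplus f -> laurentNplus g ->
  laurentNplus (fun z => c * f z + g z).
Proof.
move=> [a fa aP] [b fb bP]; exists (fun mn => c * a mn + b mn) => [|z z0].
  apply: sub_finite_set (_ : finite_set ([set mn | a mn != 0] `|` [set mn | b mn != 0])).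
    move=> mn /=; apply: contraNP => /not_orP[/negP]; rewrite negbK => /eqP -> /negP.
    by rewrite negbK => /eqP ->; rewrite mulr0 addr0.
  by rewrite finite_setU.
rewrite aP// bP//.
have AB : finite_set ([set mn | a mn != 0] `|` [set mn | b mn != 0]) by rewrite finite_setU.
have [r rP] := @fsum_seq R[i] _ [set mn : int * int | 0 <= mn.1 + mn.2] _ AB.
have nz k (x y : R[i]) : k * x * y != 0 -> k != 0.
  by apply: contra_neq => ->; rewrite !mul0r.
have abP mn : c * a mn + b mn != 0 -> a mn != 0 \/ b mn != 0.
  case: (eqVneq (a mn) 0) => [->|? _]; [|by left].
  by rewrite mulr0 add0r; right.
rewrite (rP (fun mn => _ mn * _ * _)) => [|mn /nz]; last by left.
rewrite (rP (fun mn => b mn * _ * _)) => [|mn /nz]; last by right.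
rewrite rP => [|mn /nz/abP//].
by rewrite mulr_sumr -big_split; apply: eq_bigr => mn _ /=; rewrite !mulrDl !mulrA.
Qed.

Lemma laurentNplus_mon s : laurentNplus (npl_eval s : R[i] -> R[i]).
Proof.
exists (fun mn => (mn == (s.1%:Z + s.2, - s.2))%:R) => [|z z0].
  apply: sub_finite_set (finite_set1 (s.1%:Z + s.2, - s.2)) => mn /=.
  by case: (mn =P _) => // _; rewrite eqxx.
set m0 := (_, _); rewrite -(fsbig_widen [set m0]) ?fsbig_set1.
- have zc0 : z^* != 0 by rewrite conjC_eq0.
  rewrite eqxx mul1r /npl_eval /= expfzDr// -exprnP -mulrA; congr (_ * _).
  by rewrite expfzMl exprz_inv.
- by move=> _ ->; rewrite /= addrK.
- move=> mn /= [_ /eqP]; case: (mn =P m0) => // _ _; by rewrite !mul0r.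
Qed.

End Nplus.

(** * Extension of the moment functional to the monomials of N_+ *)

Section KernelExtension.
Variables (R : realType) (H : hilbertType R) (S : linop H) (Z : set R[i]).
Hypothesis Z_neq0 : Z `<=` [set z | z != 0].
Hypothesis S_sos :
  forall (m n : nat) (a : 'I_m -> 'I_m -> 'I_n.+1 -> 'I_n.+1 -> R[i]),
    (0 < m)%N ->
    (exists (k : nat) (Q : 'I_m -> 'I_k -> R[i] -> R[i]),
       [/\ (0 < k)%N,
           forall i l, laurentNplus (Q i l)
         & forall lambda : R[i], Z lambda -> forall i j : 'I_m,
             \sum_(p < n.+1) \sum_(q < n.+1)
               a i j p q * lambda ^+ p * lambda^* ^+ q =
             \sum_(l < k) Q i l lambda * (Q j l lambda)^*]) ->
    forall f : 'I_m -> H, (forall i, Defs.dom S (f i)) ->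
      0 <= \sum_(i < m) \sum_(j < m) \sum_(p < n.+1) \sum_(q < n.+1)
             a i j p q * '[iter p S (f i), iter q S (f j)].

Local Notation D := (set_type (Defs.dom S)).
Local Notation E := {freeg (nplus * D) / R[i]}.
Local Notation V := {freeg (nplus * (D * D)) / R[i]}.

(** The coefficient of f (x) g in [v], as a Laurent function of z. Vectors of [D] are mere labels
    here; the linear structure of D(S) reappears only with the isometric embedding. *)
Definition Vev (z : R[i]) (f g : D) (v : V) : R[i] :=
  fglift (fun w : nplus * (D * D) => (w.2 == (f, g))%:R * npl_eval w.1 z : R[i]) v.

Definition Eev (z : R[i]) (f : D) (x : E) : R[i] :=
  fglift (fun w : nplus * D => (w.2 == f)%:R * npl_eval w.1 z : R[i]) x.

(* Elements of [V] whose hermitian part is a sum of squares as a kernel-valued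
   function on the punctured plane. *)
Definition sos_cone : set V := [set v | exists (k : nat) (x : 'I_k.+1 -> E),
  forall z f g, z != 0 ->
    Vev z f g v + (Vev z g f v)^* = \sum_l Eev z f (x l) * (Eev z g (x l))^*].

Definition poly_part : set V := [set v | forall w, w \in freeg.dom v ->
  exists p q, w.1 = npl_mon p q].

(** On [npl_mon p q], which is the pair (p + q, -q), the two iteration counts are p and q. *)
Definition poly_form (v : V) : R[i] := fglift (fun w : nplus * (D * D) =>
  '[iter (w.1.1 - `|w.1.2|)%N S (val w.2.1), iter `|w.1.2|%N S (val w.2.2)] : R[i]) v.

Lemma EevP z f c u v : Eev z f (c *: u + v) = c * Eev z f u + Eev z f v.
Proof. exact: fgliftP. Qed.

Lemma VevD z f g u v : Vev z f g (u + v) = Vev z f g u + Vev z f g v.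
Proof. exact: raddfD. Qed.

Lemma VevN z f g u : Vev z f g (- u) = - Vev z f g u.
Proof. exact: raddfN. Qed.

Lemma VevZ z f g c v : Vev z f g (c *: v) = c * Vev z f g v.
Proof. exact: fgliftZ. Qed.

Lemma EevZ z f c v : Eev z f (c *: v) = c * Eev z f v.
Proof. exact: fgliftZ. Qed.

Lemma sos_cone0 : sos_cone 0.
Proof.
exists 0%N, (fun=> 0) => z f g z0; rewrite big_ord1 /Vev /Eev !raddf0.
by rewrite mul0r addr0.
Qed.

Lemma sos_coneD u v : sos_cone u -> sos_cone v -> sos_cone (u + v).
Proof.
move=> [k1 [x1 e1]] [k2 [x2 e2]].
exists (k1 + k2.+1)%N, (fun l : 'I_(k1.+1 + k2.+1) =>
  match fintype.split l with inl i => x1 i | inr j => x2 j end) => z f g z0.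
rewrite !VevD rmorphD addrACA e1// e2//.
rewrite (@big_split_ord _ _ _ k1.+1 k2.+1) /=; congr (_ + _); apply: eq_bigr => l _.
  by rewrite (unsplitK (inl l : 'I_k1.+1 + 'I_k2.+1)).
by rewrite (unsplitK (inr l : 'I_k1.+1 + 'I_k2.+1)).
Qed.

Lemma sos_coneZ (c : R) u : 0 < c -> sos_cone u -> sos_cone (c%:C%C *: u).
Proof.
move=> c0 [k [x e]]; have cc : 0 <= c%:C%C :> R[i] by rewrite lecR ltW.
exists k, (fun l => sqrtC c%:C%C *: x l) => z f g z0.
have sr : (sqrtC c%:C%C)^* = sqrtC c%:C%C :> R[i].
  by apply: conj_Creal; rewrite realE sqrtC_ge0 cc.
have cr : c%:C%C^* = c%:C%C :> R[i] by apply: conj_Creal; rewrite realE cc.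
rewrite !VevZ rmorphM /= cr -mulrDr e// mulr_sumr; apply: eq_bigr => l _.
by rewrite !EevZ rmorphM /= sr mulrACA -expr2 sqrtCK.
Qed.

Lemma poly_part0 : poly_part 0.
Proof. by move=> w; rewrite freeg.dom0. Qed.

Lemma poly_partP c u v : poly_part u -> poly_part v -> poly_part (c *: u + v).
Proof.
move=> pu pv w /domD_subset; rewrite mem_cat => /orP[/domZ_subset|]; [exact: pu|exact: pv].
Qed.

Lemma poly_part1 w p q : w.1 = npl_mon p q -> poly_part << w >>.
Proof. by move=> e w'; rewrite domU1 inE => /eqP ->; exists p, q. Qed.

(* The difference has the single square |c s f - g|^2 as its hermitian part. *)
Lemma cofinal1 c s f g : exists2 u, poly_part u & sos_cone (u - << c *g (s, (f, g)) >>).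
Proof.
pose u : V := (`|c| ^+ 2 / 2) *: << (npl_mon s.1 s.1, (f, f)) >> +
     2^-1 *: << (npl_mon 0 0, (g, g)) >>.
exists u.
  apply: poly_partP; first exact: poly_part1.
  by rewrite -[_ *: _]addr0; apply: poly_partP; [exact: poly_part1|exact: poly_part0].
exists 0%N, (fun=> - c *: << (s, f) >> + << ((0%N, 0), g) >>) => z f' g' z0.
rewrite big_ord1 !EevP.
have -> : << c *g (s, (f, g)) >> = c *: << (s, (f, g)) >> :> V.
  by apply/eqP/freeg_eqP => w; rewrite coeffZ !coeffU mul1r.
rewrite /u !VevD !VevN !VevZ /Vev /Eev !fglift1 /= !npl_eval_mon//.
rewrite !xpair_eqE !expr0.
have b (x y : bool) : (x && y)%:R = x%:R * y%:R :> R[i] by rewrite -mulnb natrM.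
have zs : npl_eval s z * (npl_eval s z)^* = z ^+ s.1 * z^* ^+ s.1.
  by rewrite -npl_eval_mulstar// -npl_eval_mon//; congr npl_eval; rewrite /npl_mulstar subrr sub0r.
have br (x : bool) : (x%:R : R[i])^* = x%:R by rewrite conjC_nat.
rewrite !b; move: (br (f == f')) (br (g == f')) (br (f == g')) (br (g == g')).
move: (f == f')%:R (g == f')%:R (f == g')%:R (g == g')%:R => a1 a2 a3 a4 r1 r2 r3 r4.
have r5 : (2^-1 : R[i])^* = 2^-1 by rewrite fmorphV /= conjC_nat.
have r6 : (z ^+ s.1)^* = z^* ^+ s.1 by rewrite rmorphXn.
have r7 : (z^* ^+ s.1)^* = z ^+ s.1 by rewrite -r6 conjCK.
rewrite normCK.
move: (npl_eval s z) zs => e zs.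
rewrite !(rmorphD, rmorphM, rmorphN) /= ?conjCK ?r1 ?r2 ?r3 ?r4 ?r5 ?r6 ?r7 ?rmorph1.
by apply: (eq_from_diff _ (congr1 (fun t => c * c^* * a1 * a3 * t) (esym zs))); field.
Qed.

Lemma cofinal v : exists2 u, poly_part u & sos_cone (u - v).
Proof.
rewrite -[v]freeg_sumE; elim: (freeg.dom v) => [|[s [f g]] r [u pu cu]].
  by exists 0; rewrite ?big_nil ?subrr; [exact: poly_part0|exact: sos_cone0].
have [w pw cw] := cofinal1 (coeff (s, (f, g)) v) s f g.
exists (w + u); first by rewrite -[w]scale1r; exact: poly_partP.
by rewrite big_cons opprD addrACA; exact: sos_coneD.
Qed.

Lemma laurentNplus_Eev f x : laurentNplus (fun z => Eev z f x).
Proof.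
rewrite (_ : (fun z => _) = fun z => \sum_(w <- freeg.dom x)
    (coeff w x * (w.2 == f)%:R) * npl_eval w.1 z); last first.
  apply/funext => z; rewrite /Eev fgliftE; apply: eq_bigr => w _.
  by rewrite -[LHS]/(_ * _) mulrA.
elim: (freeg.dom x) => [|w r IH].
  rewrite (_ : (fun z => _) = fun=> 0); first exact: laurentNplus_cst0.
  by apply/funext => z; rewrite big_nil.
rewrite (_ : (fun z => _) = fun z => (coeff w x * (w.2 == f)%:R) * npl_eval w.1 z +
  \sum_(w <- r) (coeff w x * (w.2 == f)%:R) * npl_eval w.1 z); last first.
  by apply/funext => z; rewrite big_cons.
by apply: laurentNplus_lin => //; exact: laurentNplus_mon.
Qed.

(** List the finitely many vectors that occur in [v] and symmetrize its coefficients. The cone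
    identity becomes the matrix identity of (iii), and the form with symmetrized coefficients is
    twice the real part of [poly_form v]. *)
Lemma poly_form_ge0 v : poly_part v -> sos_cone v -> 0 <= complex.Re (poly_form v).
Proof.
move=> pv [k [x xP]].
have D0 : D by exists 0; apply: mem_set; exact: Defs.dom0.
(* The zero vector is added to make the list nonempty, as (iii) speaks of m >= 1 only. *)
pose ds : seq D := undup (D0 :: [seq w.2.1 | w <- freeg.dom v] ++ [seq w.2.2 | w <- freeg.dom v]).
pose m := size ds.
have m0 : (0 < m)%N.
  by rewrite lt0n size_eq0; apply/eqP => e; have := mem_undup (D0 :: [seq w.2.1 | w <- freeg.dom v] ++ [seq w.2.2 | w <- freeg.dom v]) D0; rewrite -/ds e inE mem_head.
pose F (i : 'I_m) : D := nth D0 ds i.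
pose n := \max_(w <- freeg.dom v) w.1.1.
pose cf (i j : 'I_m) (p q : nat) := coeff (npl_mon p q, (F i, F j)) v.
pose a (i j : 'I_m) (p q : 'I_n.+1) := cf i j p q + (cf j i q p)^*.
have F_inj : injective F.
  by move=> i j /eqP; rewrite nth_uniq ?undup_uniq// => /eqP/val_inj.
have F_surj f : f \in ds -> exists i, F i = f.
  move=> fds; have lt : (index f ds < m)%N by rewrite index_mem.
  by exists (Ordinal lt); rewrite /F nth_index.
have bd w : w \in freeg.dom v -> exists (p q : 'I_n.+1), w.1 = npl_mon p q.
  move=> wv; have [p [q e]] := pv w wv.
  have : (w.1.1 <= n)%N by rewrite /n (big_rem w wv) /= leq_maxl.
  rewrite e /= -ltnS => lt.
  exists (Ordinal (leq_ltn_trans (leq_addr q p) lt)).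
  by exists (Ordinal (leq_ltn_trans (leq_addl p q) lt)).
have vE z i j : z != 0 -> Vev z (F i) (F j) v =
    \sum_(p < n.+1) \sum_(q < n.+1) cf i j p q * z ^+ p * z^* ^+ q.
  move=> z0; pose h (t : 'I_n.+1 * 'I_n.+1) := (npl_mon t.1 t.2, (F i, F j)).
  have h_inj : injective h.
    move=> [p q] [p' q'] e; have /npl_mon_inj[/= /val_inj ->] := congr1 fst e.
    by move=> /val_inj ->.
  rewrite /Vev (@fgliftEw _ _ _ _ [seq h t | t <- index_enum _]).
  - rewrite big_map pair_bigA; apply: eq_bigr => -[p q] _ /=.
    by rewrite eqxx mul1r npl_eval_mon// -[LHS]/(_ * _) mulrA.
  - by rewrite map_inj_uniq ?index_enum_uniq.
  - move=> w /bd[p [q e]]; case: eqP => [e2 /negP[]|_ _]; last by rewrite mul0r.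
    apply/mapP; exists (p, q); first by rewrite mem_index_enum.
    by rewrite /h -e -e2 -surjective_pairing.
have fE : poly_form v = \sum_(i < m) \sum_(j < m) \sum_(p < n.+1) \sum_(q < n.+1)
    cf i j p q * '[iter p S (val (F i)), iter q S (val (F j))].
  pose h (t : ('I_m * 'I_m) * ('I_n.+1 * 'I_n.+1)) :=
    (npl_mon t.2.1 t.2.2, (F t.1.1, F t.1.2)).
  have h_inj : injective h.
    move=> [[i j] [p q]] [[i' j'] [p' q']] e.
    have /npl_mon_inj[/= /val_inj -> /val_inj ->] := congr1 fst e.
    have := congr1 (fun t => t.2.1) e; have := congr1 (fun t => t.2.2) e => /=.
    by move=> /F_inj -> /F_inj ->.
  rewrite /poly_form (@fgliftEw _ _ _ _ [seq h t | t <- index_enum _]).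
  - rewrite big_map pair_bigA /=.
    under [RHS]eq_bigr do rewrite pair_bigA /=.
    rewrite pair_bigA; apply: eq_bigr => -[[i j] [p q]] _ /=.
    by rewrite abszN absz_nat addnK.
  - by rewrite map_inj_uniq ?index_enum_uniq.
  - move=> w wv; have [p [q e]] := bd w wv; case/negP.
    have [i iE] : exists i, F i = w.2.1.
      apply: F_surj; rewrite mem_undup inE mem_cat; apply/orP; right; apply/orP; left.
      exact: (map_f (fun w : nplus * (D * D) => w.2.1)).
    have [j jE] : exists j, F j = w.2.2.
      apply: F_surj; rewrite mem_undup inE mem_cat; apply/orP; right; apply/orP; right.
      exact: (map_f (fun w : nplus * (D * D) => w.2.2)).
    apply/mapP; exists ((i, j), (p, q)); first by rewrite mem_index_enum.
    by rewrite /h /= iE jE -e -!surjective_pairing.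
have fin : \sum_(i < m) \sum_(j < m) \sum_(p < n.+1) \sum_(q < n.+1)
    a i j p q * '[iter p S (val (F i)), iter q S (val (F j))] =
    poly_form v + (poly_form v)^*.
  have -> : (poly_form v)^* = \sum_(i < m) \sum_(j < m) \sum_(p < n.+1) \sum_(q < n.+1)
      (cf j i q p)^* * '[iter p S (val (F i)), iter q S (val (F j))].
    rewrite fE exchange_big /= rmorph_sum; apply: eq_bigr => i _.
    rewrite rmorph_sum; apply: eq_bigr => j _; rewrite exchange_big /= rmorph_sum.
    apply: eq_bigr => p _; rewrite rmorph_sum; apply: eq_bigr => q _.
    by rewrite rmorphM /= -innerC.
  rewrite fE -big_split; apply: eq_bigr => i _.
  rewrite -big_split; apply: eq_bigr => j _; rewrite -big_split; apply: eq_bigr => p _.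
  by rewrite -big_split; apply: eq_bigr => q _; rewrite mulrDl.
suff : 0 <= poly_form v + (poly_form v)^*.
  by rewrite addcJ pmulr_rge0// ler0c.
rewrite -fin; apply: (S_sos m0) => [|i]; last exact/set_mem/valP.
exists k.+1, (fun i l z => Eev z (F i) (x l)); split=> // [i l|z Zz i j].
  exact: laurentNplus_Eev.
have z0 := Z_neq0 Zz.
rewrite -xP// !vE// [X in _ + X^*]exchange_big /= rmorph_sum -big_split.
apply: eq_bigr => p _; rewrite rmorph_sum -big_split; apply: eq_bigr => q _ /=.
by rewrite !rmorphM /= !rmorphXn /= conjCK /a !mulrDl [_ * z^* ^+ q * _]mulrAC.
Qed.

Lemma kernel_extension : exists phi : nplus -> D -> D -> R[i],
  (forall x : E,
     0 <= kform (fun s t => phi (npl_mulstar s.1 t.1) s.2 t.2) x x) /\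
  (forall p q f g, phi (npl_mon p q) f g = '[iter p S (val f), iter q S (val g)]).
Proof.
have flin (c : R) (u v : V) : poly_part u -> poly_part v ->
    complex.Re (poly_form (c%:C%C *: u + v)) =
    c * complex.Re (poly_form u) + complex.Re (poly_form v).
  move=> _ _; rewrite /poly_form fgliftP raddfD /=; congr (_ + _).
  by rewrite -[_ *: _]/(_ * _); case: (fglift _ u) => a b /=; rewrite mul0r subr0.
have [g [glin gext gpos]] := riesz_extension sos_cone0 sos_coneD sos_coneZ poly_part0
    (fun c => @poly_partP c%:C%C) flin poly_form_ge0 cofinal.
have g0 : g 0 = 0.
  by have := glin 1 0 0; rewrite scaler0 addr0 mul1r => /eqP; rewrite -subr_eq subrr => /eqP.
have gZ (c : R) u : g (c%:C%C *: u) = c * g u.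
  by have := glin c u 0; rewrite !addr0 g0 addr0.
have gD u v : g (u + v) = g u + g v.
  by have := glin 1 u v; rewrite rmorph1 scale1r mul1r.
(* Riesz' theorem extends the real part only; a complex-linear functional is recovered from its real
   part [g]. *)
pose L v : R[i] := (g v -i* g ('i%C *: v))%C.
have gC a b u : g ((a +i* b)%C *: u) = a * g u + b * g ('i%C *: u).
  have -> : (a +i* b)%C = a%:C%C + b%:C%C * 'i%C by simpc.
  by rewrite scalerDl -scalerA gD (gZ a) gZ.
have LD u v : L (u + v) = L u + L v.
  by rewrite /L scalerDr !gD opprD.
have LZ c u : L (c *: u) = c * L u.
  case: c => a b; rewrite /L (gC a b) scalerA.
  have -> : 'i%C * (a +i* b)%C = (- b +i* a)%C by simpc.
  by rewrite (gC (- b) a); simpc; congr (_ +i* _)%C; ring.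
have L0 : L 0 = 0 by rewrite -[0 in LHS](scale0r (0 : V)) LZ mul0r.
have Lsum I (r : seq I) (F : I -> V) : L (\sum_(i <- r) F i) = \sum_(i <- r) L (F i).
  by elim: r => [|i r IH]; rewrite ?big_nil// !big_cons LD IH.
exists (fun s f h => L << (s, (f, h)) >>); split=> [x|p q f h]; last first.
  rewrite /L !gext; last 2 first.
  - by rewrite -[_ *: _]addr0; apply: poly_partP; [exact: poly_part1|exact: poly_part0].
  - exact: poly_part1.
  rewrite /poly_form fgliftZ !fglift1 /= abszN absz_nat addnK.
  rewrite -[_ *: _]/(_ * _); case: '[_, _] => a b /=; congr (_ +i* _)%C.
  by rewrite mul0r mul1r sub0r opprK.
pose M : V := \sum_(s <- freeg.dom x) \sum_(t <- freeg.dom x)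
  (coeff s x * (coeff t x)^*) *: << (npl_mulstar s.1 t.1, (s.2, t.2)) >>.
have -> : kform (fun s t => L << (npl_mulstar s.1 t.1, (s.2, t.2)) >>) x x = L M.
  rewrite kformE Lsum; apply: eq_bigr => s _; rewrite Lsum; apply: eq_bigr => t _.
  by rewrite LZ.
have VM z f h : z != 0 -> Vev z f h M = Eev z f x * (Eev z h x)^*.
  move=> z0; rewrite /Vev raddf_sum /Eev !fgliftE rmorph_sum mulr_suml.
  apply: eq_bigr => s _; rewrite raddf_sum mulr_sumr; apply: eq_bigr => t _ /=.
  rewrite fgliftZ fglift1 /= npl_eval_mulstar// -![_ *: _]/(_ * _) !rmorphM /= xpair_eqE.
  rewrite conjC_nat -mulnb natrM; ring.
(* Both i M and - i M have hermitian part 0 and hence lie in the cone, so [L M] is real. *)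
have iM : g ('i%C *: M) = 0.
  have pm (c : R[i]) : c^* = - c -> sos_cone (c *: M).
    move=> cc; exists 0%N, (fun=> 0) => z f h z0; rewrite big_ord1 !VevZ !VM// /Eev !raddf0 mul0r.
    by rewrite !rmorphM /= cc conjCK; ring.
  have ic : ('i%C : R[i])^* = - 'i%C by rewrite complexiE conjCi.
  apply/eqP; rewrite eq_le -oppr_ge0 (gpos _ (pm _ ic)) andbT.
  have -> : - g ('i%C *: M) = g (- 'i%C *: M).
    by rewrite -mulN1r -gZ scalerA rmorphN rmorph1 mulN1r.
  by apply/gpos/pm; rewrite rmorphN /= ic.
rewrite /L iM oppr0 ler0c; apply: gpos.
(* The hermitian part of [M] is twice a square, hence two copies of [x]. *)
exists 1%N, (fun=> x) => z f h z0; rewrite !VM// big_ord_recl big_ord1.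
by rewrite rmorphM /= conjCK [X in _ + X]mulrC.
Qed.

End KernelExtension.

(** * Normal block operators *)

Lemma hilb_norm (R : realType) (X : ips R) (x : hilb X) : `|x| = snorm X x.
Proof. by []. Qed.

Section PairSpace.
Variables (R : realType) (X : ips R).
Implicit Types (x y z : (X * X)%type).

(* The factor 1/2 makes the diagonal embedding [X -> X * X] isometric. *)
Definition pair_dot x y : R[i] := (ips_dot X x.1 y.1 + ips_dot X x.2 y.2) / 2.

Lemma pair_dotl c x y z : pair_dot (c *: x + y) z = c * pair_dot x z + pair_dot y z.
Proof. by rewrite /pair_dot /= !sip_linl; field. Qed.

Lemma pair_dotr c x y z : pair_dot z (c *: x + y) = c^* * pair_dot z x + pair_dot z y.
Proof. by rewrite /pair_dot /= !sip_linr; field. Qed.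

Lemma pair_dot_ge0 x : 0 <= pair_dot x x.
Proof. by rewrite /pair_dot divr_ge0// addr_ge0// sip_ge0. Qed.

Definition pair_sip : sip (X * X)%type := Sip pair_dotl pair_dotr pair_dot_ge0.

Lemma pair_dot_eq0 x : pair_sip x x = 0 -> x = 0.
Proof.
rewrite /= /pair_dot => /eqP; rewrite mulf_eq0 invr_eq0 pnatr_eq0 orbF.
rewrite paddr_eq0 ?sip_ge0// => /andP[/eqP/ips_dot_eq0 e1 /eqP/ips_dot_eq0 e2].
by case: x e1 e2 => a b /= -> ->.
Qed.

Lemma snorm_pair x : snorm pair_sip x <= snorm X x.1 + snorm X x.2.
Proof.
have n0 (w : X) : 0 <= snorm X w by exact: snorm_ge0.
rewrite -(@ler_pXn2r _ 2) ?nnegrE ?addr_ge0 ?snorm_ge0// sqrrD !sqr_snorm /= /pair_dot.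
rewrite ler_pdivrMr// -!sqr_snorm -subr_ge0.
rewrite (_ : _ - _ = snorm X x.1 ^+ 2 + snorm X x.2 ^+ 2 + snorm X x.1 * snorm X x.2 *+ 4); last by ring.
by rewrite !addr_ge0 ?exprn_ge0 ?mulrn_wge0 ?mulr_ge0.
Qed.

Lemma snorm_fst x : snorm X x.1 <= 2 * snorm pair_sip x.
Proof.
rewrite -(@ler_pXn2r _ 2) ?nnegrE ?mulr_ge0 ?snorm_ge0// exprMn !sqr_snorm /= /pair_dot.
rewrite -subr_ge0 (_ : _ - _ = ips_dot X x.1 x.1 + ips_dot X x.2 x.2 *+ 2); last by field.
by rewrite addr_ge0 ?mulrn_wge0 ?sip_ge0.
Qed.

Lemma snorm_snd x : snorm X x.2 <= 2 * snorm pair_sip x.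
Proof.
rewrite -(@ler_pXn2r _ 2) ?nnegrE ?mulr_ge0 ?snorm_ge0// exprMn !sqr_snorm /= /pair_dot.
rewrite -subr_ge0 (_ : _ - _ = ips_dot X x.2 x.2 + ips_dot X x.1 x.1 *+ 2); last by field.
by rewrite addr_ge0 ?mulrn_wge0 ?sip_ge0.
Qed.

Lemma pair_complete (u : nat -> (X * X)%type) :
  (forall e, 0 < e -> exists N : nat, forall i j, (N <= i)%N -> (N <= j)%N ->
    snorm pair_sip (u i - u j) < e) ->
  exists l, forall e, 0 < e -> exists N : nat, forall i, (N <= i)%N ->
    snorm pair_sip (u i - l) < e.
Proof.
move=> uC.
have [|l1 l1P] := @ips_complete R X (fun n => (u n).1).
  move=> e e0; have [|N NP] := uC (e / 2); first by rewrite divr_gt0.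
  exists N => i j Ni Nj; apply: le_lt_trans (snorm_fst (u i - u j)) _.
  by rewrite mulrC -ltr_pdivlMr// NP.
have [|l2 l2P] := @ips_complete R X (fun n => (u n).2).
  move=> e e0; have [|N NP] := uC (e / 2); first by rewrite divr_gt0.
  exists N => i j Ni Nj; apply: le_lt_trans (snorm_snd (u i - u j)) _.
  by rewrite mulrC -ltr_pdivlMr// NP.
exists (l1, l2) => e e0; have e2 : 0 < e / 2 by rewrite divr_gt0.
have [N1 N1P] := l1P _ e2; have [N2 N2P] := l2P _ e2.
exists (maxn N1 N2) => i; rewrite geq_max => /andP[i1 i2].
apply: le_lt_trans (snorm_pair _) _; rewrite [e]splitr ltrD//.
  exact: N1P.
exact: N2P.
Qed.

Definition pair_ips : ips R := @Ips R (X * X)%type pair_sip pair_dot_eq0 pair_complete.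

End PairSpace.

Section BlockNormal.
Variables (R : realType) (X : ips R) (A A' : X -> X -> Prop) (U U' : X -> X).
Local Notation "<< x , y >>" := (ips_dot X x y).
Hypothesis A'P : forall f g, A' f g <-> forall x y, A x y -> << y, f >> = << x, g >>.
Hypothesis AP : forall x y, A x y <-> forall f g, A' f g -> << y, f >> = << x, g >>.
Hypothesis A_dense : forall x e, 0 < e -> exists x' y', A x' y' /\ snorm X (x - x') < e.
Hypothesis A'_dense : forall x e, 0 < e -> exists x' y', A' x' y' /\ snorm X (x - x') < e.
Hypothesis U_lin : forall c x y, U (c *: x + y) = c *: U x + U y.
Hypothesis UU' : cancel U' U.
Hypothesis U'U : cancel U U'.
Hypothesis U_adj : forall x y, << U x, y >> = << x, U' y >>.
Hypothesis AU : forall x y, A x y -> A (U x) (U y).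
Hypothesis AU' : forall x y, A x y -> A (U' x) (U' y).

Lemma dense_eq0 (P : X -> Prop) :
  (forall x e, 0 < e -> exists2 x', P x' & snorm X (x - x') < e) ->
  forall y, (forall x, P x -> << y, x >> = 0) -> y = 0.
Proof.
move=> Pd y yP; apply/(@ips_dot_eq0 R X)/eqP; rewrite -normr_eq0; apply/negPn/negP => n0.
have y0 : 0 < snorm X y.
  rewrite lt_def snorm_ge0 andbT; apply: contra_neq n0 => e.
  by apply/normr0P; rewrite -sqr_snorm e expr0n.
have [x Px xy] := Pd y _ y0.
have : << y, y >> < << y, y >>; last by rewrite ltxx.
rewrite -{2}[<< y, y >>]sqr_snorm expr2.
have -> : << y, y >> = `| << y, y - x >> |.
  by rewrite sipBr (yP x Px) subr0 ger0_norm ?sip_ge0.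
by apply: le_lt_trans (sip_CS _ _ _) _; rewrite ltr_pM2l.
Qed.

Lemma A_uniq x y y' : A x y -> A x y' -> y = y'.
Proof.
move=> /AP h /AP h'; apply/eqP; rewrite -subr_eq0; apply/eqP.
apply: (@dense_eq0 (fun f => exists g, A' f g)) => [f e e0|f [g fg]].
  by have [f' [g [fg fe]]] := A'_dense f e0; exists f' => //; exists g.
by rewrite sipBl (h _ _ fg) (h' _ _ fg) subrr.
Qed.

Lemma A'_uniq f g g' : A' f g -> A' f g' -> g = g'.
Proof.
move=> /A'P h /A'P h'; apply/eqP; rewrite -subr_eq0; apply/eqP.
apply: (@dense_eq0 (fun x => exists y, A x y)) => [x e e0|x [y xy]].
  by have [x' [y [xy xe]]] := A_dense x e0; exists x' => //; exists y.
by rewrite sipC sipBr -(h _ _ xy) -(h' _ _ xy) subrr conjC0.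
Qed.

Lemma A_lin c x y x' y' : A x y -> A x' y' -> A (c *: x + x') (c *: y + y').
Proof.
move=> /AP h /AP h'; apply/AP => f g fg.
by rewrite !sip_linl (h _ _ fg) (h' _ _ fg).
Qed.

Lemma A'_lin c x y x' y' : A' x y -> A' x' y' -> A' (c *: x + x') (c *: y + y').
Proof.
move=> /A'P h /A'P h'; apply/A'P => f g fg.
by rewrite !sip_linr (h _ _ fg) (h' _ _ fg).
Qed.

Lemma A0 : A 0 0. Proof. by apply/AP => f g _; rewrite !sip0l. Qed.
Lemma A'0 : A' 0 0. Proof. by apply/A'P => f g _; rewrite !sip0r. Qed.

Lemma U'_adj x y : << U' x, y >> = << x, U y >>.
Proof. by rewrite sipC -U_adj -sipC. Qed.

Lemma A'U f g : A' f g -> A' (U f) (U g).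
Proof. by move=> /A'P h; apply/A'P => x y xy; rewrite -!U'_adj; apply: h; exact: AU'. Qed.

Lemma A'U' f g : A' f g -> A' (U' f) (U' g).
Proof. by move=> /A'P h; apply/A'P => x y xy; rewrite -!U_adj; apply: h; exact: AU. Qed.

Definition opA x : X := xget 0 [set y | A x y].
Definition opA' x : X := xget 0 [set y | A' x y].

Lemma opAE x y : A x y -> opA x = y.
Proof. by move=> xy; apply: (A_uniq _ xy); rewrite /opA; case: xgetP => [//|/(_ y)]. Qed.

Lemma opA'E x y : A' x y -> opA' x = y.
Proof. by move=> xy; apply: (A'_uniq _ xy); rewrite /opA'; case: xgetP => [//|/(_ y)]. Qed.

Local Notation K := (hilb (pair_ips X)).

(* If [A] is the multiplication by z, [A'] its adjoint and [U] the multiplication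
   by z / conj z, then z = (z / conj z) conj z makes [(A x.2, U (A' x.1))] an
   extension of the multiplication by z on the diagonal. *)
Definition block_dom : set K := [set x | (exists y, A' x.1 y) /\ (exists y, A x.2 y)].
Definition block_fun (x : K) : K := (opA x.2, U (opA' x.1)).

Lemma block_funE x y1 y2 : A' x.1 y1 -> A x.2 y2 -> block_fun x = (y2, U y1).
Proof. by move=> /opA'E h1 /opAE h2; rewrite /block_fun h1 h2. Qed.

Lemma block_dom0 : block_dom 0.
Proof. by split; exists 0; [exact: A'0|exact: A0]. Qed.

Lemma block_dom_lin c (x y : K) : block_dom x -> block_dom y -> block_dom (c *: x + y).
Proof.
move=> [[x1 h1] [x2 h2]] [[y1 k1] [y2 k2]]; split.
  by exists (c *: x1 + y1); exact: A'_lin.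
by exists (c *: x2 + y2); exact: A_lin.
Qed.

Lemma block_fun_lin c (x y : K) : block_dom x -> block_dom y ->
  block_fun (c *: x + y) = c *: block_fun x + block_fun y.
Proof.
move=> [[x1 h1] [x2 h2]] [[y1 k1] [y2 k2]].
rewrite (block_funE h1 h2) (block_funE k1 k2).
by rewrite (@block_funE (c *: x + y) _ _ (A'_lin c h1 k1) (A_lin c h2 k2)) U_lin.
Qed.

Definition block : linop K := Linop block_dom0 block_dom_lin block_fun_lin.

Lemma blockE (x : K) y1 y2 : A' x.1 y1 -> A x.2 y2 -> block x = (y2, U y1).
Proof. exact: block_funE. Qed.

Lemma U0 : U 0 = 0.
Proof. by have := U_lin (-1) 0 0; rewrite scaler0 addr0 scaleN1r addNr. Qed.

Lemma pair_innerE (x y : K) : '[x, y] = (<< x.1, y.1 >> + << x.2, y.2 >>) / 2.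
Proof. by []. Qed.

(** Formally the adjoint is (y1, y2) |-> (A U' y2, A' y1). Testing on vectors with one component 0
    separates its two entries, and [AP] and [A'P] recognize each of them. *)
Lemma block_adjointP (y z : K) : adjoint_at block y z <-> A' y.1 z.2 /\ A (U' y.2) z.1.
Proof.
split=> [yz|[h1 h2] x [[x1 k1] [x2 k2]]]; last first.
  rewrite (blockE k1 k2) !pair_innerE /=; congr (_ / _).
  rewrite addrC; congr (_ + _); last by move/A'P : h1; apply.
  by rewrite U_adj sipC; move/AP: h2 => /(_ _ _ k1) <-; rewrite -sipC.
have eq2 (a b : R[i]) : a / 2 = b / 2 -> a = b by apply: mulIf; rewrite invr_eq0 pnatr_eq0.
split.
  apply/A'P => x2 y2 xy; have dx : block_dom (0, x2).
    by split; [exists 0; exact: A'0|exists y2].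
  have := yz _ dx; rewrite (@blockE (0, x2) _ _ A'0 xy) !pair_innerE /= => /eq2.
  by rewrite U0 !sip0l addr0 add0r.
apply/AP => f g fg; have dx : block_dom (f, 0).
  by split; [exists g|exists 0; exact: A0].
have := yz _ dx; rewrite (@blockE (f, 0) _ _ fg A0) !pair_innerE /= => /eq2.
by rewrite !sip0l addr0 add0r U_adj => e; rewrite sipC -e -sipC.
Qed.

Lemma block_adjointE (y z : K) : A' y.1 z.2 -> A (U' y.2) z.1 -> adjoint block y = z.
Proof.
move=> h1 h2; rewrite /adjoint; case: xgetP => [z' _ /block_adjointP[k1 k2]|/(_ z)[]]; last exact/block_adjointP.
by rewrite [z']surjective_pairing [z]surjective_pairing (A'_uniq h1 k1) (A_uniq h2 k2).
Qed.

(** Invariance of the domain of [A] under [U] and [U'] gives the adjoint the same domain as the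
    block operator. *)
Lemma block_adjoint_domP (y : K) :
  adjoint_dom block y <-> (exists z, A' y.1 z) /\ (exists z, A y.2 z).
Proof.
split=> [[z /block_adjointP[h1 h2]]|[[z2 h1] [z1 h2]]].
  by split; [exists z.2|exists (U z.1); rewrite -[y.2]UU'; exact: AU].
by exists (U' z1, z2); apply/block_adjointP; split=> //; exact: AU'.
Qed.

Lemma small_eq0 (a C : R[i]) : 0 <= C -> (forall e, 0 < e -> `|a| <= C * e) -> a = 0.
Proof.
move=> C0 aC; apply/eqP; rewrite -normr_eq0; apply/negPn/negP => an0.
have a0 : 0 < `|a| by rewrite lt_def an0 normr_ge0.
have C1 : 0 < C + 1 by rewrite ltr_wpDl.
have := aC _ (divr_gt0 a0 C1); rewrite mulrCA ler_pMr// ler_pdivlMr// mul1r.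
by rewrite gerDl ler10.
Qed.

(** By [A'P] and [AP] the two graphs are cut out by equations that are continuous in the point, so
    membership passes to limits. *)
Lemma block_closed : closed_op block.
Proof.
apply/closed_opP => x y xy.
have h1 : A' x.1 (U' y.2).
  apply/A'P => p q pq; apply/eqP; rewrite -subr_eq0; apply/eqP.
  apply: (@small_eq0 _ (2 * snorm X q + 2 * snorm X (U p))) => [|e e0].
    by rewrite addr_ge0// mulr_ge0// snorm_ge0.
  have [x' [[[z1 k1] [z2 k2]]]] := xy e e0.
  rewrite (blockE k1 k2) !hilb_norm => xx yy.
  have -> : << q, x.1 >> - << p, U' y.2 >> = << q, (x - x').1 >> - << U p, (y - (z2, U z1)).2 >>.
    rewrite /= !sipBr !U_adj U'U; move/A'P: k1 => /(_ _ _ pq) ->; ring.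
  apply: le_trans (ler_normB _ _) _; rewrite mulrDl lerD//.
    apply: le_trans (sip_CS _ _ _) _; rewrite mulrAC [leLHS]mulrC ler_wpM2r ?snorm_ge0//.
    by apply: le_trans (snorm_fst _) _; rewrite ler_pM2l// ltW.
  apply: le_trans (sip_CS _ _ _) _; rewrite mulrAC [leLHS]mulrC ler_wpM2r ?snorm_ge0//.
  by apply: le_trans (snorm_snd _) _; rewrite ler_pM2l// ltW.
have h2 : A x.2 y.1.
  apply/AP => p q pq; apply/eqP; rewrite -subr_eq0; apply/eqP.
  apply: (@small_eq0 _ (2 * snorm X p + 2 * snorm X q)) => [|e e0].
    by rewrite addr_ge0// mulr_ge0// snorm_ge0.
  have [x' [[[z1 k1] [z2 k2]]]] := xy e e0.
  rewrite (blockE k1 k2) !hilb_norm => xx yy.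
  have -> : << y.1, p >> - << x.2, q >> = << (y - (z2, U z1)).1, p >> - << (x - x').2, q >>.
    rewrite /= !sipBl; move/AP: k2 => /(_ _ _ pq) ->; ring.
  apply: le_trans (ler_normB _ _) _; rewrite mulrDl lerD//.
    apply: le_trans (sip_CS _ _ _) _; rewrite mulrAC ler_wpM2r ?snorm_ge0//.
    by apply: le_trans (snorm_fst _) _; rewrite ler_pM2l// ltW.
  apply: le_trans (sip_CS _ _ _) _; rewrite mulrAC ler_wpM2r ?snorm_ge0//.
  by apply: le_trans (snorm_snd _) _; rewrite ler_pM2l// ltW.
split; first by split; [exists (U' y.2)|exists y.1].
by rewrite (blockE h1 h2) UU' -surjective_pairing.
Qed.

(** Both products act as (x1, x2) |-> (A A' x1, A' A x2). In N^* N the factors [U'] and [U] are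
    adjacent and cancel; in N N^* they enclose A' A, with which they commute. *)
Lemma block_normal : normal_op block.
Proof.
split.
- apply/densely_definedP => x e e0; have e2 : 0 < e / 2 by rewrite divr_gt0.
  have [x1 [y1 [h1 k1]]] := A'_dense x.1 e2; have [x2 [y2 [h2 k2]]] := A_dense x.2 e2.
  exists (x1, x2); first by split; [exists y1|exists y2].
  rewrite hilb_norm; apply: le_lt_trans (snorm_pair _) _; rewrite [e]splitr ltrD//.
- exact: block_closed.
- move=> x; split=> [[[[y1 h1] [y2 h2]]]|[/block_adjoint_domP[[y1 h1] [y2 h2]]]].
    rewrite (blockE h1 h2) => /block_adjoint_domP[/= [z1 k1] [z2 k2]].
    split; first by apply/block_adjoint_domP; split; [exists y1|exists y2].
    rewrite (@block_adjointE x (U' y2, y1) h1 (AU' h2)); split => /=.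
      by exists (U' z1); exact: A'U'.
    by exists (U' z2); rewrite -[y1]U'U; exact: AU'.
  rewrite (@block_adjointE x (U' y2, y1) h1 (AU' h2)) => -[/= [z1 k1] [z2 k2]].
  have dx : block_dom x by split; [exists y1|exists y2].
  split; first exact: dx.
  rewrite (block_funE h1 h2); apply/block_adjoint_domP; split => /=.
    by exists (U z1); rewrite -[y2]UU'; exact: A'U.
  by exists (U z2); exact: AU.
- move=> x [[y1 h1] [y2 h2]]; rewrite (blockE h1 h2).
  move=> /block_adjoint_domP[/= [z1 k1] [z2 k2]].
  rewrite (@block_adjointE x (U' y2, y1) h1 (AU' h2)).
  have k2' : A y1 (U' z2) by rewrite -[y1]U'U; exact: AU'.
  rewrite (@block_adjointE (y2, U y1) (U' z2, z1))//=; last by rewrite U'U.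
  by rewrite (@block_funE (U' y2, y1) _ _ (A'U' k1) k2') UU'.
Qed.

End BlockNormal.

(** * The dilation attached to a positive kernel *)

Section LMap.
Variables (R : realType) (K : choiceType).
Local Notation E := {freeg K / R[i]}.

Definition lmap (h : K -> K) (x : E) : E := fglift (fun s => << h s >> : E) x.

Lemma lmapB h x y : lmap h (x - y) = lmap h x - lmap h y.
Proof. exact: raddfB. Qed.

Lemma lmap1 h s : lmap h << s >> = << h s >>.
Proof. exact: fglift1. Qed.

Lemma lmap_comp h k x : lmap h (lmap k x) = lmap (h \o k) x.
Proof.
rewrite /lmap [in RHS]fgliftE [X in fglift _ X]fgliftE raddf_sum /=.
by apply: eq_bigr => s _; rewrite fgliftZ fglift1.
Qed.

Lemma lmap_id x : lmap id x = x.
Proof.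
rewrite /lmap fgliftE -[RHS]freeg_sumE; apply: eq_bigr => s _.
by apply/eqP/freeg_eqP => w; rewrite coeffZ !coeffU mul1r.
Qed.

Lemma lmap_adj (B : sip E) h h' x y :
  (forall s t, B << h s >> << t >> = B << s >> << h' t >>) ->
  B (lmap h x) y = B x (lmap h' y).
Proof.
move=> hh'; have fr (w : E) : w = \sum_(s <- freeg.dom w) coeff s w *: << s >>.
  by rewrite -{1}[w]lmap_id /lmap fgliftE.
rewrite /lmap [in LHS]fgliftE sip_suml [in RHS](fr x) sip_suml; apply: eq_bigr => s _.
rewrite !sipZl; congr (_ * _); rewrite [in RHS]fgliftE [in LHS](fr y) !sip_sumr.
by apply: eq_bigr => t _; rewrite !sipZr hh'.
Qed.

End LMap.

Section ComplLift.
Variables (R : realType) (K : choiceType).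
Local Notation E := {freeg K / R[i]}.
Variables (B : sip E) (h h' : K -> K).
Hypothesis hh' : forall s t, B << h s >> << t >> = B << s >> << h' t >>.
Hypothesis h'h : cancel h h'.

Lemma lmap_iso x y : B (lmap h x) (lmap h y) = B x y.
Proof.
rewrite (lmap_adj _ _ hh') lmap_comp (_ : h' \o h = id) ?lmap_id//.
by apply/funext => s /=; rewrite h'h.
Qed.

Lemma represents_lift x F : represents B x F ->
  represents B (fun n => lmap h (x n)) (fun w => F (lmap h' w)).
Proof.
move=> [xC xF]; split=> [e /xC[N NP]|w].
  by exists N => i j Ni Nj; rewrite -lmapB /snorm lmap_iso; exact: NP.
by apply: tends_ext (xF (lmap h' w)) => n; rewrite (lmap_adj _ _ hh').
Qed.

Lemma clift_subproof (F : compl B) : (fun w => F (lmap h' w)) \in representable B.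
Proof.
have [x xF] := compl_rep F; apply/representableP; exists (fun n => lmap h (x n)).
exact: represents_lift.
Qed.

(** As [lmap h'] is the adjoint of [lmap h], precomposing functionals with it extends [lmap h] to
    the completion. *)
Definition clift (F : compl B) : compl B := Compl (clift_subproof F).

Lemma cliftE F w : clift F w = F (lmap h' w).
Proof. by []. Qed.

Lemma clift_lin c F G : clift (c *: F + G) = c *: clift F + clift G.
Proof. by apply/val_inj/funext. Qed.

Lemma clift_iso F G : csip B (clift F) (clift G) = csip B F G.
Proof.
have [[x xF] [y yG]] := conj (compl_rep F) (compl_rep G).
apply: tends_uniq (cdotP (represents_lift xF) (represents_lift yG)) _.
by apply: tends_ext (cdotP xF yG) => n; rewrite lmap_iso.
Qed.

End ComplLift.

Section Dilation.
Variables (R : realType) (D : choiceType) (phi : nplus -> D -> D -> R[i]).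
Local Notation E := {freeg (nplus * D) / R[i]}.
Definition phi_kernel (s t : nplus * D) : R[i] := phi (npl_mulstar s.1 t.1) s.2 t.2.
Hypothesis phi_ge0 : forall x : E, 0 <= kform phi_kernel x x.

Definition phi_sip : sip E :=
  Sip (@kform_linl _ _ phi_kernel) (@kform_linr _ _ phi_kernel) phi_ge0.
Local Notation B := phi_sip.

Definition zmul (s : nplus * D) : nplus * D := ((s.1.1.+1, s.1.2), s.2).
Definition umul (s : nplus * D) : nplus * D := ((s.1.1, s.1.2 + 1), s.2).
Definition umul' (s : nplus * D) : nplus * D := ((s.1.1, s.1.2 - 1), s.2).

Lemma umulK : cancel umul umul'.
Proof. by move=> [[j k] f]; rewrite /umul /umul' /= addrK. Qed.

Lemma umul'K : cancel umul' umul.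
Proof. by move=> [[j k] f]; rewrite /umul /umul' /= subrK. Qed.

Lemma umul_adj s t : B << umul s >> << t >> = B << s >> << umul' t >>.
Proof.
rewrite /= !kform1 /phi_kernel; congr phi; rewrite /npl_mulstar /=; congr pair; ring.
Qed.

Lemma umul'_adj s t : B << umul' s >> << t >> = B << s >> << umul t >>.
Proof.
rewrite /= !kform1 /phi_kernel; congr phi; rewrite /npl_mulstar /=; congr pair; ring.
Qed.

(** [umul'] after [zmul] is the multiplication by conj z = z (z / conj z)^(-1). *)
Lemma zmul_adj s t : B << umul' (zmul s) >> << t >> = B << s >> << zmul t >>.
Proof.
rewrite /= !kform1 /phi_kernel; congr phi; rewrite /npl_mulstar /=; congr pair.
  by rewrite addSnnS.
by rewrite -addn1 PoszD opprD; ring.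
Qed.

Local Notation U := (clift umul_adj umulK).
Local Notation U' := (clift umul'_adj umul'K).

(* The adjoint of the multiplication by z and, below, the adjoint of [zadj], which
   is the closure of the multiplication by z. *)
Definition zadj (F G : compl B) := forall w, G w = F (lmap zmul w).

Definition zext (x y : compl B) := forall F G, zadj F G -> csip B y F = csip B x G.

Lemma zext_emb w : zext (cemb B w) (cemb B (lmap zmul w)).
Proof. by move=> F G FG; rewrite ![csip B (cemb B _) _]sipC !cdot_emb FG. Qed.

Lemma zadj_emb w : zadj (cemb B w) (cemb B (lmap (umul' \o zmul) w)).
Proof. by move=> v; rewrite [LHS](lmap_adj _ _ zmul_adj). Qed.

Lemma zadjP F G : zadj F G <-> forall x y, zext x y -> csip B y F = csip B x G.
Proof.
split=> [FG x y|H w]; first by apply.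
by have := H _ _ (zext_emb w); rewrite ![csip B (cemb B _) _]sipC !cdot_emb => /(inv_inj conjCK).
Qed.

Lemma zext_dense (x : compl B) e : 0 < e ->
  exists x' y', zext x' y' /\ snorm (csip B) (x - x') < e.
Proof.
by move=> /(cemb_dense x)[w we]; exists (cemb B w), (cemb B (lmap zmul w)); split=> //; exact: zext_emb.
Qed.

Lemma zadj_dense (x : compl B) e : 0 < e ->
  exists x' y', zadj x' y' /\ snorm (csip B) (x - x') < e.
Proof.
move=> /(cemb_dense x)[w we]; exists (cemb B w), (cemb B (lmap (umul' \o zmul) w)).
by split=> //; exact: zadj_emb.
Qed.

Lemma UU' : cancel U' U.
Proof.
move=> F; apply/val_inj/funext => w /=; rewrite lmap_comp.
by rewrite (_ : umul \o umul' = id) ?lmap_id//; apply/funext => s /=; rewrite umul'K.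
Qed.

Lemma U'U : cancel U U'.
Proof.
move=> F; apply/val_inj/funext => w /=; rewrite lmap_comp.
by rewrite (_ : umul' \o umul = id) ?lmap_id//; apply/funext => s /=; rewrite umulK.
Qed.

Lemma U_adj F G : csip B (U F) G = csip B F (U' G).
Proof. by rewrite -{1}[G]UU' clift_iso. Qed.

Lemma U'_csip F G : csip B (U' F) G = csip B F (U G).
Proof. by rewrite -{1}[G]U'U clift_iso. Qed.

Lemma zextU x y : zext x y -> zext (U x) (U y).
Proof.
move=> xy F G FG; rewrite !U_adj; apply: xy => w.
by rewrite !cliftE FG !lmap_comp; congr (F (lmap _ _)); apply/funext.
Qed.

Lemma zextU' x y : zext x y -> zext (U' x) (U' y).
Proof.
move=> xy F G FG; rewrite !U'_csip; apply: xy => w.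
by rewrite !cliftE FG !lmap_comp; congr (F (lmap _ _)); apply/funext.
Qed.

Definition dilation : linop (hilb (pair_ips (cips B))) :=
  @block R (cips B) zext zadj U zadjP (fun x y => iff_refl _) zext_dense zadj_dense
    (@clift_lin _ _ _ _ _ umul_adj umulK).

Lemma dilation_normal : normal_op dilation.
Proof.
exact: (@block_normal R (cips B) zext zadj U U' zadjP _ zext_dense zadj_dense _
  UU' U'U U_adj zextU zextU').
Qed.

Definition dilation_vec (w : E) : hilb (pair_ips (cips B)) := (cemb B w, cemb B w).

Lemma dilation_dom w : dom dilation (dilation_vec w).
Proof.
by split; [exists (cemb B (lmap (umul' \o zmul) w)); exact: zadj_emb
          |exists (cemb B (lmap zmul w)); exact: zext_emb].
Qed.

Lemma dilation_funE w : dilation (dilation_vec w) = dilation_vec (lmap zmul w).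
Proof.
rewrite [LHS](@blockE R (cips B) zext zadj U _ _ _ _ _ (dilation_vec w) _ _ (@zadj_emb w) (@zext_emb w)).
congr pair; apply/val_inj/funext => v /=.
rewrite -[LHS](lmap_adj _ _ umul_adj) lmap_comp; congr (kform _ (lmap _ _) _).
by apply/funext => s /=; rewrite umul'K.
Qed.

Lemma dilation_inner v w : '[dilation_vec v, dilation_vec w] = kform phi_kernel v w.
Proof.
have -> : '[dilation_vec v, dilation_vec w] =
  (csip B (cemb B v) (cemb B w) + csip B (cemb B v) (cemb B w)) / 2 by [].
rewrite cdot_emb -[cemb B v w]/(kform phi_kernel v w).
by move: (kform _ _ _) => k; field.
Qed.

End Dilation.

(** * Embedding of S into the dilation of its kernel *)

Section KernelToSubnormal.
Variables (R : realType) (H : hilbertType R) (S : linop H).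
Hypothesis S_dense : densely_defined S.
Hypothesis S_inv : forall f : H, dom S f -> dom S (S f).
Local Notation D := (set_type (dom S)).
Local Notation E := {freeg (nplus * D) / R[i]}.
Variable phi : nplus -> D -> D -> R[i].
Hypothesis phi_ge0 : forall x : E, 0 <= kform (phi_kernel phi) x x.
Hypothesis phi_mon : forall p q f g,
  phi (npl_mon p q) f g = '[iter p S (val f), iter q S (val g)].

Local Notation vec s f := (dilation_vec phi_ge0 << (s, f) >>).

Lemma vec_inner s t f g :
  '[vec s f, vec t g] = phi (npl_mulstar s t) f g.
Proof. by rewrite dilation_inner kform1. Qed.

Definition dom_sub (h : H) (Dh : dom S h) : D := SigSub (mem_set Dh).

(** The vector 1 (x) h of the dilation space. The value outside D(S) is immaterial, since the
    embedding extends the restriction to D(S). *)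
Definition vec0 (h : H) := match pselect (dom S h) with
  left Dh => vec (npl_mon 0 0) (dom_sub Dh) | right _ => 0 end.

Lemma vec0E h (Dh : dom S h) : vec0 h = vec (npl_mon 0 0) (dom_sub Dh).
Proof.
rewrite /vec0; case: pselect => // Dh'.
by rewrite (_ : dom_sub Dh' = dom_sub Dh)//; apply/val_inj.
Qed.

Lemma kernel_subnormal : subnormal S.
Proof.
have m00 : npl_mulstar (npl_mon 0 0) (npl_mon 0 0) = npl_mon 0 0 by [].
have [f g Df Dg|J [J_iso JE]] := @isometric_extension R H _ (dom S) vec0 ((densely_definedP S).1 S_dense).
  by rewrite !vec0E vec_inner m00 phi_mon.
split=> //; exists (hilb (pair_ips (cips (phi_sip phi_ge0)))), J, (dilation phi_ge0).
split=> //; first exact: dilation_normal.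
move=> h Dh; have DSh := S_inv Dh; rewrite !JE// (vec0E Dh) (vec0E DSh).
split; first exact: dilation_dom.
rewrite dilation_funE lmap1 -[zmul _]/((1%N, 0) : nplus, dom_sub Dh).
have m10 : npl_mulstar (1%N, 0) (npl_mon 0 0) = npl_mon 1 0 by [].
have m01 : npl_mulstar (npl_mon 0 0) (1%N, 0) = npl_mon 0 1 by [].
have m11 : npl_mulstar (1%N, 0) (1%N, 0) = npl_mon 1 1 by [].
(* 1 (x) S h and z (x) h coincide, since the four inner products in the squared norm of their
   difference all equal <S h, S h>. *)
apply/eqP; rewrite -subr_eq0 -normr_eq0 -sqrf_eq0 -inner_norm; apply/eqP.
rewrite innerBl !innerBr !vec_inner m00 m10 m01 m11 !phi_mon /= !subrr //.
Qed.

End KernelToSubnormal.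

Theorem sos_subnormal (R : realType) (H : hilbertType R) (S : linop H)
    (S_dense : densely_defined S)
    (S_inv : forall f : H, dom S f -> dom S (S f))
    (Z : set R[i]) (Z_neq0 : Z `<=` [set z | z != 0]) :
  (forall (m n : nat) (a : 'I_m -> 'I_m -> 'I_n.+1 -> 'I_n.+1 -> R[i]),
    (0 < m)%N ->
    (exists (k : nat) (Q : 'I_m -> 'I_k -> R[i] -> R[i]),
       [/\ (0 < k)%N,
           forall i l, laurentNplus (Q i l)
         & forall lambda : R[i], Z lambda -> forall i j : 'I_m,
             \sum_(p < n.+1) \sum_(q < n.+1)
               a i j p q * lambda ^+ p * lambda^* ^+ q =
             \sum_(l < k) Q i l lambda * (Q j l lambda)^*]) ->
    forall f : 'I_m -> H, (forall i, dom S (f i)) ->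
      0 <= \sum_(i < m) \sum_(j < m) \sum_(p < n.+1) \sum_(q < n.+1)
             a i j p q * '[iter p S (f i), iter q S (f j)]) ->
  subnormal S.
Proof.
move=> iii; have [phi [phi_ge0 phi_mon]] := kernel_extension Z_neq0 iii.
exact: (kernel_subnormal S_dense S_inv phi_ge0 phi_mon).
Qed.

(** * Polynomials on a determining set *)

Section BivariatePoly.
Variable R : realType.
Implicit Types (f g : R[i] -> R[i]).

Definition bipoly f := exists p : {poly {poly R[i]}},
  forall z, z != 0 -> f z = p.[z, z^*].

Lemma bipoly_cst c : bipoly (fun=> c).
Proof. by exists (c%:P%:P) => z _; rewrite !hornerC. Qed.

Lemma bipolyD f g : bipoly f -> bipoly g -> bipoly (fun z => f z + g z).
Proof. by move=> [p pf] [q qg]; exists (p + q) => z z0; rewrite !hornerD pf// qg. Qed.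

Lemma bipolyM f g : bipoly f -> bipoly g -> bipoly (fun z => f z * g z).
Proof. by move=> [p pf] [q qg]; exists (p * q) => z z0; rewrite !hornerM pf// qg. Qed.

Lemma bipoly_sum I (r : seq I) (F : I -> R[i] -> R[i]) :
  (forall i, bipoly (F i)) -> bipoly (fun z => \sum_(i <- r) F i z).
Proof.
move=> FP; elim: r => [|i r IH].
  by have [p pP] := bipoly_cst 0; exists p => z z0; rewrite big_nil (pP z).
have [p pP] := bipolyD (FP i) IH; exists p => z z0; rewrite big_cons; exact: pP.
Qed.

Lemma bipoly_mon (p q : nat) : bipoly (fun z => z ^+ p * z^* ^+ q).
Proof.
exists ('X^p * ('X^q)%:P) => z _; rewrite hornerM hornerXn hornerC hornerM.
by rewrite -polyC_exp hornerC hornerXn.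
Qed.

Lemma bipoly_ext f g : (forall z, z != 0 -> f z = g z) -> bipoly f -> bipoly g.
Proof. by move=> fg [p pP]; exists p => z z0; rewrite -fg// pP. Qed.

Lemma bipoly_determined (Z : set R[i]) f g : determining Z ->
  Z `<=` [set z | z != 0] -> bipoly f -> bipoly g ->
  (forall z, Z z -> f z = g z) -> forall z, z != 0 -> f z = g z.
Proof.
move=> Zdet Z0 [p pf] [q qg] fg z z0; apply/eqP; rewrite -subr_eq0 pf// qg//; apply/eqP.
rewrite -hornerN -hornerD -hornerN -hornerD; apply: Zdet => {z0}z Zz.
by rewrite !hornerD !hornerN -pf ?Z0// -qg ?Z0// fg// subrr.
Qed.

Definition clears (N : nat) f := bipoly (fun z => (z * z^*) ^+ N * f z).

Lemma clearsW (M N : nat) f : (M <= N)%N -> clears M f -> clears N f.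
Proof.
move=> MN Mf; apply: bipoly_ext (bipolyM (bipoly_mon (N - M) (N - M)) Mf) => z _.
by rewrite -exprMn mulrA -exprD subnK.
Qed.

Lemma clearsD (M N : nat) f g : clears M f -> clears N g ->
  clears (maxn M N) (fun z => f z + g z).
Proof.
move=> /(clearsW (leq_maxl M N)) h /(clearsW (leq_maxr M N)) k.
by apply: bipoly_ext (bipolyD h k) => z _; rewrite mulrDr.
Qed.

Lemma clears_ext N f g : (forall z, z != 0 -> f z = g z) -> clears N f -> clears N g.
Proof. by move=> fg; apply: bipoly_ext => z z0; rewrite fg. Qed.

Lemma clears_mon c (m n : int) :
  clears (`|m| + `|n|)%N (fun z => c * z ^ m * z^* ^ n).
Proof.
set N := (_ + _)%N.
have shift (k : int) (z : R[i]) : z != 0 -> (`|k| <= N)%N ->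
    z ^+ N * z ^ k = z ^+ absz (N%:Z + k)%R.
  move=> z0 kN; rewrite [z ^+ N]exprnP -expfzDr// [RHS]exprnP; congr (_ ^ _).
  by rewrite gez0_abs//; lia.
have h := bipolyM (bipoly_cst c) (bipoly_mon (absz (N%:Z + m)%R) (absz (N%:Z + n)%R)).
apply: bipoly_ext h => z z0.
rewrite -shift ?leq_addr// -shift ?leq_addl ?conjC_eq0// exprMn; ring.
Qed.

Lemma laurent_clears f : laurentNplus f ->
  exists N, clears N f /\ clears N (fun z => (f z)^*).
Proof.
move=> [a fa aP].
have [r rP] := @fsum_seq R[i] _ [set mn : int * int | 0 <= mn.1 + mn.2] _ fa.
have {}aP z : z != 0 -> f z = \sum_(mn <- r) a mn * z ^ mn.1 * z^* ^ mn.2.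
  by move=> z0; rewrite aP// rP// => mn; apply: contra_neq => ->; rewrite !mul0r.
suff [N [h k]] : exists N, clears N (fun z => \sum_(mn <- r) a mn * z ^ mn.1 * z^* ^ mn.2) /\
    clears N (fun z => \sum_(mn <- r) (a mn)^* * z ^ mn.2 * z^* ^ mn.1).
  exists N; split; first by apply: clears_ext h => z z0; rewrite aP.
  apply: clears_ext k => z z0; rewrite aP// rmorph_sum; apply: eq_bigr => mn _.
  have cz (x : R[i]) k : (x ^ k)^* = x^* ^ k by exact: (fmorphXz Num.conj).
  have cM (x y : R[i]) : (x * y)^* = x^* * y^* by exact: rmorphM.
  have e := cz z^* mn.2; rewrite conjCK in e.
  rewrite [RHS]cM e [X in _ = X * _]cM [RHS]mulrAC; congr (_ * _); exact/esym/cz.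
elim: r {rP aP} => [|mn r [N [h k]]].
  exists 0%N; split; apply: bipoly_ext (bipoly_cst 0) => z _; by rewrite big_nil mulr0.
exists (maxn (`|mn.1| + `|mn.2|) N); split.
  apply: clears_ext (clearsD (clears_mon (a mn) mn.1 mn.2) h) => z _.
  by rewrite big_cons.
rewrite addnC; apply: clears_ext (clearsD (clears_mon (a mn)^* mn.2 mn.1) k) => z _.
by rewrite big_cons.
Qed.

End BivariatePoly.

(** * Continuity of polynomials *)

Section PolyLimit.
Variable R : realType.

Lemma tendsM (u v : nat -> R[i]) l m : tends u l -> tends v m ->
  tends (fun n => u n * v n) (l * m).
Proof.
move=> ul vm.
have a0 : tends (fun n => (`|m| + 1) * `|u n - l| + `|l| * `|v n - m|) 0.
  have h1 : tends (fun n => `|u n - l|) 0.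
    have := tends_norm (tends_lin 1 ul (tends_cst (- l))).
    by rewrite mul1r subrr normr0; apply: tends_ext => n; rewrite mul1r.
  have h2 : tends (fun n => `|v n - m|) 0.
    have := tends_norm (tends_lin 1 vm (tends_cst (- m))).
    by rewrite mul1r subrr normr0; apply: tends_ext => n; rewrite mul1r.
  have := tends_lin (`|m| + 1) h1 (tends_lin `|l| h2 (tends_cst 0)).
  by rewrite !mulr0 !addr0; apply: tends_ext => n; rewrite addr0.
apply: (tends_dom ler01 a0); have [N NP] := vm _ ltr01; exists N => n /NP vn.
rewrite mul1r [leRHS]ger0_norm; last by rewrite addr_ge0 ?mulr_ge0 ?addr_ge0.
have -> : u n * v n - l * m = (u n - l) * v n + l * (v n - m) by ring.
apply: le_trans (ler_normD _ _) _; rewrite !normrM lerD// mulrC ler_wpM2r//.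
rewrite -[v n](subrK m) addrC; apply: le_trans (ler_normD _ _) _.
by rewrite lerD2l ltW.
Qed.

Lemma tends_natSinv : tends (fun n => (n.+1%:R : R[i])^-1) 0.
Proof.
move=> e /cplx_natSinv[N NP]; exists N => n /NP.
by rewrite subr0 ger0_norm ?invr_ge0.
Qed.

Lemma tends_horner (p : {poly R[i]}) u l : tends u l -> tends (fun n => p.[u n]) p.[l].
Proof.
move=> ul; elim/poly_ind: p => [|p c IH].
  by rewrite horner0; apply: tends_ext (tends_cst 0) => n; rewrite horner0.
have := tends_lin 1 (tendsM IH ul) (tends_cst c).
by rewrite mul1r hornerMXaddC; apply: tends_ext => n; rewrite mul1r hornerMXaddC.
Qed.

(** Approach 0 along 1/(n+1). On positive reals conjugation is the identity, so polynomials in z and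
    conj z become polynomials in one variable there; this settles the point 0 left out by a
    division. *)
Lemma horner0_ge0 (p : {poly R[i]}) :
  (forall t : R[i], 0 < t -> 0 <= p.[t]) -> 0 <= p.[0].
Proof.
move=> pp; apply: tends_ge0 (tends_horner p tends_natSinv) => n.
by apply: pp; rewrite invr_gt0 ltr0Sn.
Qed.

End PolyLimit.

Theorem nonneg_sos (R : realType) (H : hilbertType R) (S : linop H) (Z : set R[i])
    (Z_neq0 : Z `<=` [set z | z != 0]) (Z_det : determining Z) :
  (forall (m n : nat) (a : 'I_m -> 'I_m -> 'I_n.+1 -> 'I_n.+1 -> R[i]),
     (0 < m)%N ->
     (forall (lambda : R[i]) (z : 'I_m -> R[i]),
        0 <= \sum_(i < m) \sum_(j < m) \sum_(p < n.+1) \sum_(q < n.+1)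
               a i j p q * lambda ^+ p * lambda^* ^+ q * z i * (z j)^*) ->
     forall f : 'I_m -> H, (forall i, dom S (f i)) ->
       0 <= \sum_(i < m) \sum_(j < m) \sum_(p < n.+1) \sum_(q < n.+1)
              a i j p q * '[iter p S (f i), iter q S (f j)]) ->
  forall (m n : nat) (a : 'I_m -> 'I_m -> 'I_n.+1 -> 'I_n.+1 -> R[i]),
    (0 < m)%N ->
    (exists (k : nat) (Q : 'I_m -> 'I_k -> R[i] -> R[i]),
       [/\ (0 < k)%N,
           forall i l, laurentNplus (Q i l)
         & forall lambda : R[i], Z lambda -> forall i j : 'I_m,
             \sum_(p < n.+1) \sum_(q < n.+1)
               a i j p q * lambda ^+ p * lambda^* ^+ q =
             \sum_(l < k) Q i l lambda * (Q j l lambda)^*]) ->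
    forall f : 'I_m -> H, (forall i, dom S (f i)) ->
      0 <= \sum_(i < m) \sum_(j < m) \sum_(p < n.+1) \sum_(q < n.+1)
             a i j p q * '[iter p S (f i), iter q S (f j)].
Proof.
move=> ii m n a m0 [k [Q [k0 Ql PQ]]]; apply: ii => //.
pose P i j (z : R[i]) := \sum_(p < n.+1) \sum_(q < n.+1) a i j p q * z ^+ p * z^* ^+ q.
have [M MP] := choice (fun il : 'I_m * 'I_k => laurent_clears (Ql il.1 il.2)).
pose N := \max_il M il.
have Qc i l : clears N (Q i l) by apply: clearsW (MP (i, l)).1; exact: leq_bigmax.
have Qc' i l : clears N (fun z => (Q i l z)^*) by apply: clearsW (MP (i, l)).2; exact: leq_bigmax.
have PQ0 i j z : z != 0 -> P i j z = \sum_(l < k) Q i l z * (Q j l z)^*.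
  (* One factor |z|^(2 N) is spent on [Q i l] and one on the conjugate of [Q j l]. *)
  move=> z0; have zz : (z * z^*) ^+ (N + N) != 0.
    by rewrite expf_neq0// mulf_neq0// conjC_eq0.
  have zN : bipoly (fun z : R[i] => (z * z^*) ^+ (N + N)).
    by have := bipoly_mon R (N + N) (N + N); apply: bipoly_ext => x _; rewrite exprMn.
  have Pb : bipoly (P i j).
    apply: bipoly_sum => p; apply: bipoly_sum => q.
    have := bipolyM (bipoly_cst (a i j p q)) (bipoly_mon R p q).
    by apply: bipoly_ext => x _; rewrite mulrA.
  have Qb : bipoly (fun z => (z * z^*) ^+ (N + N) * \sum_(l < k) Q i l z * (Q j l z)^*).
    have := bipoly_sum (index_enum _) (fun l => bipolyM (Qc i l) (Qc' j l)).
    apply: bipoly_ext => x _.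
    by rewrite mulr_sumr; apply: eq_bigr => l _; rewrite exprD mulrACA.
  apply: (mulfI zz); apply: (bipoly_determined Z_det Z_neq0 (bipolyM zN Pb) Qb) => // x Zx.
  by congr (_ * _); exact: PQ.
have expand z (w : 'I_m -> R[i]) : \sum_(i < m) \sum_(j < m) \sum_(p < n.+1) \sum_(q < n.+1)
    a i j p q * z ^+ p * z^* ^+ q * w i * (w j)^* =
    \sum_(i < m) \sum_(j < m) P i j z * (w i * (w j)^*).
  apply: eq_bigr => i _; apply: eq_bigr => j _; rewrite /P mulr_suml.
  by apply: eq_bigr => p _; rewrite mulr_suml; apply: eq_bigr => q _; rewrite mulrA.
have pos z w : z != 0 -> 0 <= \sum_(i < m) \sum_(j < m) P i j z * (w i * (w j)^*).
  move=> z0; rewrite (_ : \sum_(i < m) _ =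
    \sum_(l < k) (\sum_(i < m) Q i l z * w i) * (\sum_(i < m) Q i l z * w i)^*).
    by apply: sumr_ge0 => l _; rewrite -normCK exprn_ge0.
  under eq_bigr do under eq_bigr do rewrite PQ0// mulr_suml.
  under eq_bigr do rewrite exchange_big /=.
  rewrite exchange_big; apply: eq_bigr => l _ /=.
  rewrite rmorph_sum mulr_suml; apply: eq_bigr => i _; rewrite mulr_sumr.
  by apply: eq_bigr => j _; rewrite rmorphM; ring.
move=> z w; rewrite expand; have [->|] := eqVneq z 0; last exact: pos.
pose p : {poly R[i]} := \sum_(i < m) \sum_(j < m)
  (\sum_(p < n.+1) \sum_(q < n.+1) a i j p q *: ('X^p * 'X^q)) * (w i * (w j)^*)%:P.
have pE t : 0 <= t -> p.[t] = \sum_(i < m) \sum_(j < m) P i j t * (w i * (w j)^*).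
  move=> t0; have tc : t^* = t by apply: conj_Creal; rewrite realE t0.
  rewrite horner_sum; apply: eq_bigr => i _; rewrite horner_sum; apply: eq_bigr => j _.
  rewrite hornerM hornerC; congr (_ * _); rewrite horner_sum; apply: eq_bigr => r _.
  rewrite horner_sum; apply: eq_bigr => q _.
  by rewrite hornerZ hornerM !hornerXn tc mulrA.
rewrite -pE//; apply: horner0_ge0 => t t0; rewrite pE ?(ltW t0)//; apply: pos.
by rewrite gt_eqF.
Qed.

(** * Positivity of operator polynomials by a random walk *)

Section SchurProduct.
Local Open Scope sesquilinear_scope.
Variables (R : realType) (E : lmodType R[i]) (B : sip E) (m : nat).
Variable Q : 'I_m -> 'I_m -> R[i].
Hypothesis Q_ge0 : forall z : 'I_m -> R[i],
  0 <= \sum_(i < m) \sum_(j < m) Q i j * z i * (z j)^*.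

Let q (z w : 'I_m -> R[i]) := \sum_(i < m) \sum_(j < m) Q i j * z i * (w j)^*.

Let q_linl c x y z : q (c *: x + y) z = c * q x z + q y z.
Proof.
rewrite /q mulr_sumr -big_split; apply: eq_bigr => i _ /=.
rewrite mulr_sumr -big_split; apply: eq_bigr => j _ /=.
by rewrite -[(c *: x + y) i]/(c * x i + y i); ring.
Qed.

Let q_linr c x y z : q z (c *: x + y) = c^* * q z x + q z y.
Proof.
rewrite /q mulr_sumr -big_split; apply: eq_bigr => i _ /=.
rewrite mulr_sumr -big_split; apply: eq_bigr => j _ /=.
by rewrite -[(c *: x + y) j]/(c * x j + y j) rmorphD rmorphM /=; ring.
Qed.

Let Q_herm i j : Q i j = (Q j i)^*.
Proof.
pose d (k : 'I_m) : 'I_m -> R[i] := fun l => (l == k)%:R.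
have qd k l : q (d k) (d l) = Q k l.
  rewrite /q (bigD1 k) //= [X in _ + X]big1 ?addr0 => [|s sk]; last first.
    by apply: big1 => t _; rewrite /d (negbTE sk) mulr0 mul0r.
  rewrite (bigD1 l) //= [X in _ + X]big1 ?addr0 => [|t tl]; last first.
    by rewrite /d (negbTE tl) conjC0 mulr0.
  by rewrite /d !eqxx conjC1 !mulr1.
by rewrite -!qd; exact: (sipC (Sip q_linl q_linr Q_ge0)).
Qed.

(** Schur's product argument: after diagonalizing [Q] by a unitary matrix, the form is a sum of
    eigenvalues, which are nonnegative by [Q_ge0], times values [B g g]. *)
Lemma schur_ge0 (f : 'I_m -> E) :
  0 <= \sum_(i < m) \sum_(j < m) Q i j * B (f i) (f j).
Proof.
pose M : 'M[R[i]]_m := \matrix_(i, j) Q i j.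
have Mh : M \is hermsymmx.
  apply/is_hermitianmxP; rewrite expr0 scale1r; apply/matrixP => i j.
  by rewrite !mxE Q_herm.
have /orthomx_spectralP := hermitian_normalmx Mh.
move: (spectralmx M) (spectral_diag M) (spectral_unitarymx M) => P D Pu.
rewrite invmx_unitary// => ME.
have PP : P *m P^t* = 1%:M by apply/unitarymxP.
have D_ge0 k : 0 <= D 0 k.
  suff <- : \sum_(i < m) \sum_(j < m) Q i j * P k i * (P k j)^* = D 0 k by exact: Q_ge0.
  have : (P *m M *m P^t*) k k = D 0 k.
    by rewrite ME !mulmxA PP mul1mx -mulmxA PP mulmx1 mxE eqxx mulr1n.
  move=> <-; rewrite mxE exchange_big; apply: eq_bigr => j _ /=.
  rewrite mxE mulr_suml; apply: eq_bigr => i _; rewrite !mxE; ring.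
have QE i j : Q i j = \sum_(k < m) D 0 k * ((P k i)^* * P k j).
  have := congr1 (fun A : 'M[R[i]]_m => A i j) ME; rewrite mxE => ->.
  rewrite mul_mx_diag !mxE; apply: eq_bigr => k _; rewrite !mxE; ring.
rewrite (_ : \sum_(i < m) _ = \sum_(k < m) D 0 k *
    B (\sum_(i < m) (P k i)^* *: f i) (\sum_(i < m) (P k i)^* *: f i)).
  by apply: sumr_ge0 => k _; rewrite mulr_ge0// sip_ge0.
under [RHS]eq_bigr do rewrite sip_suml mulr_sumr.
rewrite [RHS]exchange_big; apply: eq_bigr => i _ /=.
under [RHS]eq_bigr do rewrite sip_sumr mulr_sumr.
rewrite [RHS]exchange_big; apply: eq_bigr => j _ /=.
rewrite QE mulr_suml; apply: eq_bigr => k _.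
by rewrite sipZl sipZr conjCK; ring.
Qed.

End SchurProduct.

Lemma sipDD (R : realType) (E : lmodType R[i]) (B : sip E) x y :
  B (x + y) (x + y) = B x x + B x y + (B y x + B y y).
Proof. by rewrite sipDl !sipDr. Qed.

Section RandomWalk.
Variables (R : realType) (E : lmodType R[i]) (B : sip E).
Variables (W W' T : {linear E -> E}).
Hypothesis W_adj : forall u v, B (W u) v = B u (W' v).
Hypothesis T_sym : forall u v, B (T u) v = B u (T v).
Hypothesis WT : forall u, W (T u) = T (W u).
Hypothesis W'T : forall u, W' (T u) = T (W' u).
Hypothesis WW' : forall u, W (W' u) = T u - T (T u).
Hypothesis W'W : forall u, W' (W u) = T u - T (T u).

Local Notation I := ('I_4 + bool)%type.

(* Positive operators summing to the identity, attached to the points [(wst c, tst c)]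
   of C x R, whose barycenter is [(W, T)]. *)
Definition Aop (c : I) : {linear E -> E} := match c with
  | inl k => 8^-1 \*: (idfun \+ ('i ^+ k)^* \*: W \+ 'i ^+ k \*: W')
  | inr true => 2^-1 \*: T
  | inr false => 2^-1 \*: (idfun \- T) end.

Definition wst (c : I) : R[i] := match c with inl k => 2 * 'i ^+ k | inr _ => 0 end.
Definition tst (c : I) : R[i] := match c with inr true => 2 | _ => 0 end.

Definition in_comm (F : {linear E -> E}) :=
  [/\ forall u, F (W u) = W (F u), forall u, F (W' u) = W' (F u)
    & forall u, F (T u) = T (F u)].

Definition pos_op (F : {linear E -> E}) := forall u, 0 <= B (F u) u.

Lemma Aop_comm F c u : in_comm F -> F (Aop c u) = Aop c (F u).
Proof.
move=> [FW FW' FT]; case: c => [k|[]] /=.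
- by rewrite linearZ /= !linearD /= !linearZ /= FW FW'.
- by rewrite linearZ /= FT.
- by rewrite linearZ linearB /= FT.
Qed.

Lemma in_comm_Aop c : in_comm (Aop c).
Proof.
split=> u; apply/esym.
- by apply: Aop_comm; split=> // v; rewrite W'W WW'.
- by apply: Aop_comm; split=> // v; rewrite W'W WW'.
- by apply: Aop_comm; split=> // v; rewrite ?WT ?W'T.
Qed.

(** Since [F] commutes with [G], the form equals [B (F (G u)) (G u)]. *)
Lemma sq_pos (G G' F : {linear E -> E}) u :
  (forall x y, B (G' x) y = B x (G y)) -> (forall x, F (G x) = G (F x)) ->
  pos_op F -> 0 <= B (G' (G (F u))) u.
Proof. by move=> adj FG Fp; rewrite adj -FG. Qed.

(** Each weight is a sum of squares modulo W W' = W' W = T - T^2. For w = i^k, the operator 1 +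
    conj(w) W + w W' equals (T + conj(w) W)(T + w W') + (w W' + 1 - T)(conj(w) W + 1 - T); moreover
    T = T^2 + W W' and 1 - T = (1 - T)^2 + W W'. The factor [F] stands for the product of the
    weights already collected. *)
Lemma Aop_pos c (F : {linear E -> E}) : in_comm F -> pos_op F -> pos_op (Aop c \o F).
Proof.
move=> [FW FW' FT] Fp u.
have W'_adj x y : B (W' x) y = B x (W y) by rewrite sipC -W_adj -sipC.
have sqW' := @sq_pos W' W F u W_adj FW' Fp.
case: c => [k|[]] /=; rewrite sipZl mulr_ge0 ?invr_ge0//.
- have ww : 'i ^+ k * ('i ^+ k)^* = 1 :> R[i].
    by rewrite -normCK normrX normCi expr1n expr1n.
  pose w : R[i] := 'i ^+ k.
  have h1 : 0 <= B ((T \+ w^* \*: W) ((T \+ w \*: W') (F u))) u.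
    apply: (@sq_pos (T \+ w \*: W') (T \+ w^* \*: W)) => //= [x y|x].
      by rewrite sipDl sipDr sipZl sipZr T_sym W_adj.
    by rewrite linearD linearZ /= FT FW'.
  have h2 : 0 <= B ((w \*: W' \+ (idfun \- T)) ((w^* \*: W \+ (idfun \- T)) (F u))) u.
    apply: (@sq_pos (w^* \*: W \+ (idfun \- T)) (w \*: W' \+ (idfun \- T))) => //= [x y|x].
      by rewrite !(sipDl, sipDr, sipNl, sipNr) sipZl sipZr conjCK T_sym W'_adj.
    by rewrite linearD linearB linearZ /= FT FW.
  rewrite (_ : B _ u = B ((T \+ w^* \*: W) ((T \+ w \*: W') (F u))) u +
    B ((w \*: W' \+ (idfun \- T)) ((w^* \*: W \+ (idfun \- T)) (F u))) u); first exact: addr_ge0.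
  rewrite /= !(linearD, linearN, linearZ) /= ?WT ?W'T ?WW' ?W'W.
  rewrite !(sipDl, sipNl, sipZl).
  have := congr1 (fun t => 2 * (B (T (F u)) u - B (T (T (F u))) u) * t) (esym ww).
  by rewrite -/w; apply: eq_from_diff; ring.
- have sqT := @sq_pos T T F u T_sym FT Fp.
  rewrite (_ : T (F u) = T (T (F u)) + W (W' (F u))) ?sipDl ?addr_ge0//.
  by rewrite WW' addrC subrK.
- have sqT := @sq_pos (idfun \- T) (idfun \- T) F u.
  rewrite (_ : B _ u = B ((idfun \- T) ((idfun \- T) (F u))) u + B (W (W' (F u))) u).
    rewrite addr_ge0//; apply: sqT => //= [x y|x]; last by rewrite linearB /= FT.
    by rewrite sipBl sipBr T_sym.
  by rewrite /= WW' !(sipBl, linearB) /=; ring.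
Qed.

Let sum_i : \sum_(k < 4) 'i ^+ k = 0 :> R[i].
Proof.
rewrite !big_ord_recr big_ord0 /=.
have -> : 0 + 'i ^+ 0 + 'i ^+ 1 + 'i ^+ 2 + 'i ^+ 3 = (1 + 'i) * (1 + 'i ^+ 2) :> R[i] by ring.
by rewrite sqrCi subrr mulr0.
Qed.

Let sum_i2 : \sum_(k < 4) 'i ^+ k * 'i ^+ k = 0 :> R[i].
Proof.
rewrite !big_ord_recr big_ord0 /=.
have -> : 0 + 'i ^+ 0 * 'i ^+ 0 + 'i ^+ 1 * 'i ^+ 1 + 'i ^+ 2 * 'i ^+ 2 + 'i ^+ 3 * 'i ^+ 3 =
   (1 + 'i ^+ 2) * (1 + 'i ^+ 4) :> R[i] by ring.
by rewrite sqrCi subrr mul0r.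
Qed.

Let sum_ibar : \sum_(k < 4) ('i ^+ k)^* = 0 :> R[i].
Proof. by rewrite -rmorph_sum sum_i rmorph0. Qed.

Lemma Aop_sum u : \sum_c Aop c u = u.
Proof.
rewrite big_sumType big_bool /= -scaler_sumr !big_split /= -!scaler_suml.
rewrite sum_i sum_ibar !scale0r !addr0 sumr_const card_ord -scalerDr subrKC.
rewrite -[u *+ 4]scaler_nat scalerA -scalerDl.
by rewrite (_ : _ + _ = 1) ?scale1r//; field.
Qed.

(** Summed over k, both i^k and i^(2 k) cancel, which leaves only the term in [W]. *)
Lemma Aop_wsum u : \sum_c wst c *: Aop c u = W u.
Proof.
rewrite big_sumType big_bool /= !scale0r !addr0.
rewrite (eq_bigr (fun k : 'I_4 => (4^-1 * 'i ^+ k) *: u + 4^-1 *: W u +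
    (4^-1 * ('i ^+ k * 'i ^+ k)) *: W' u)); last first.
  move=> k _; rewrite scalerA !scalerDr !scalerA; congr (_ *: _ + _ *: _ + _ *: _).
  - by field.
  - have := normCK ('i ^+ k : R[i]); rewrite normrX normCi !expr1n => h.
    by apply: (eq_from_diff _ (congr1 (fun t => 4^-1 * t) (esym h))); field.
  - by field.
rewrite !big_split /= -!scaler_suml -!mulr_sumr sum_i sum_i2 !mulr0 !scale0r add0r addr0.
by rewrite sumr_const card_ord -[4^-1 *+ 4]mulr_natr mulVf ?scale1r// pnatr_eq0.
Qed.

Lemma Aop_tsum u : \sum_c tst c *: Aop c u = T u.
Proof.
rewrite big_sumType big_bool /= big1 => [|k _]; last by rewrite scale0r.
by rewrite scale0r add0r addr0 scalerA mulfV ?scale1r// pnatr_eq0.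
Qed.

Lemma wst_le c : `|wst c| <= 2.
Proof.
by case: c => [k|b] /=; rewrite ?normr0// normrM normrX normCi expr1n mulr1 ger0_norm.
Qed.

Lemma tst_le c : `|tst c| <= 2.
Proof. by case: c => [k|[]] /=; rewrite ?normr0// ger0_norm. Qed.

Lemma tst_ge0 c : 0 <= tst c. Proof. by case: c => [k|[]] /=. Qed.

Fixpoint Ew (w : seq I) : {linear E -> E} :=
  if w is c :: w' then (Aop c \o Ew w') else idfun.

Lemma Ew_comm w : in_comm (Ew w).
Proof.
elim: w => [|c w [EW EW' ET]]; first by split.
have [AW AW' AT] := in_comm_Aop c.
by split=> u /=; rewrite (EW, EW', ET) (AW, AW', AT).
Qed.

Lemma Ew_pos w : pos_op (Ew w).
Proof.
elim: w => [u|c w IH]; first exact: sip_ge0.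
by move=> u; have := @Aop_pos c (Ew w) (Ew_comm w) IH u.
Qed.

Lemma Ew_Aop w c u : Ew w (Aop c u) = Aop c (Ew w u).
Proof. exact/Aop_comm/Ew_comm. Qed.

Lemma ew_linl w a u v z : B (Ew w (a *: u + v)) z = a * B (Ew w u) z + B (Ew w v) z.
Proof. by rewrite linearP sip_linl. Qed.

Lemma ew_linr w a u v z : B (Ew w z) (a *: u + v) = a^* * B (Ew w z) u + B (Ew w z) v.
Proof. exact: sip_linr. Qed.

(** The operators [Ew w] form an operator-valued probability on the words of a given length; this is
    its value at one word, read as a semi-inner product. *)
Definition ew_sip w : sip E := Sip (ew_linl w) (ew_linr w) (Ew_pos w).

Fixpoint words n : seq (seq I) :=
  if n is n'.+1 then [seq c :: w | c <- index_enum I, w <- words n'] else [:: [::]].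

Lemma words_sum (V : nmodType) n (F : seq I -> V) :
  \sum_(w <- words n.+1) F w = \sum_c \sum_(w <- words n) F (c :: w).
Proof. by rewrite /= big_allpairs_dep. Qed.

Lemma size_words n w : w \in words n -> size w = n.
Proof.
elim: n w => [|n IH] w /=; first by rewrite inE => /eqP ->.
by move=> /allpairsP[[c v] [_ /= /IH <- ->]].
Qed.

Lemma Ew_sum n u : \sum_(w <- words n) Ew w u = u.
Proof.
elim: n => [|n IH]; first by rewrite big_seq1.
rewrite words_sum -[RHS]Aop_sum; apply: eq_bigr => c _ /=.
by rewrite -[in RHS]IH linear_sum.
Qed.

Definition walk (st : I -> R[i]) (w : seq I) : R[i] := \sum_(c <- w) st c.

Section Variance.
Variables (X : {linear E -> E}) (st : I -> R[i]).
Hypothesis X_mean : forall u, \sum_c st c *: Aop c u = X u.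
Let dev c u := X u - st c *: u.

Definition step_var u : R[i] := \sum_c ew_sip [:: c] (dev c u) (dev c u).

(* The steps are orthogonal, so that variances add up. *)
Lemma walk_var n u :
  \sum_(w <- words n) ew_sip w (n%:R *: X u - walk st w *: u)
                                (n%:R *: X u - walk st w *: u) = n%:R * step_var u.
Proof.
elim: n => [|n IH].
  by rewrite big_seq1 /walk big_nil !scale0r subrr sip0l mul0r.
rewrite words_sum.
pose D w := n%:R *: X u - walk st w *: u.
have DE c w : n.+1%:R *: X u - walk st (c :: w) *: u = dev c u + D w.
  by rewrite /walk big_cons -nat1r !scalerDl scale1r opprD addrACA.
have dev0 : \sum_c Aop c (dev c u) = 0.
  under eq_bigr do rewrite /dev linearB linearZ /=.
  by rewrite sumrB Aop_sum X_mean subrr.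
(* [Ew w] commutes with [Aop c], so the sum over the new letter can be taken first, and there the
   deviation has mean 0. *)
have cross : \sum_c \sum_(w <- words n) ew_sip (c :: w) (dev c u) (D w) = 0.
  rewrite exchange_big big1_seq //= => w _.
  rewrite -(sip_suml B); under eq_bigr do rewrite -Ew_Aop.
  by rewrite -linear_sum dev0 linear0 sip0l.
have cross' : \sum_c \sum_(w <- words n) ew_sip (c :: w) (D w) (dev c u) = 0.
  have := congr1 Num.conj cross; rewrite conjC0 rmorph_sum => e.
  rewrite -[RHS]e; apply: eq_bigr => c _.
  by rewrite rmorph_sum; apply: eq_bigr => w _; exact: sipC.
under eq_bigr do under eq_bigr do rewrite DE sipDD.
under eq_bigr do rewrite !big_split /=.
rewrite !big_split /= cross cross' addr0 add0r -nat1r mulrDl mul1r -IH; congr (_ + _).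
  by apply: eq_bigr => c _; rewrite -(sip_suml B) -linear_sum Ew_sum.
rewrite exchange_big; apply: eq_bigr => w _ /=.
by rewrite -(sip_suml B) Aop_sum.
Qed.

End Variance.

Section Families.
Implicit Types (U V : seq I -> E) (k : seq I -> R[i]).

(** The L^2 inner product of [E]-valued functions on words of length [n] for the measure [Ew]. As
    its total mass is the identity, constants embed isometrically. *)
Definition fam (n : nat) U V := \sum_(w <- words n) ew_sip w (U w) (V w).

Lemma fam_linl n c U V U' : fam n (c *: U + V) U' = c * fam n U U' + fam n V U'.
Proof.
rewrite /fam mulr_sumr -big_split; apply: eq_bigr => w _.
exact: (sip_linl (ew_sip w)).
Qed.

Lemma fam_linr n c U V U' : fam n U' (c *: U + V) = c^* * fam n U' U + fam n U' V.
Proof.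
rewrite /fam mulr_sumr -big_split; apply: eq_bigr => w _.
exact: (sip_linr (ew_sip w)).
Qed.

Lemma fam_ge0 n U : 0 <= fam n U U.
Proof. by apply: sumr_ge0 => w _; exact: sip_ge0. Qed.

Definition fam_sip n : sip (seq I -> E) := Sip (@fam_linl n) (@fam_linr n) (@fam_ge0 n).

Definition cst u : seq I -> E := fun=> u.
Definition fscale k U : seq I -> E := fun w => k w *: U w.

Lemma fam_cst n u v : fam_sip n (cst u) (cst v) = B u v.
Proof. by rewrite /= /fam -(sip_suml B) Ew_sum. Qed.

Lemma snorm_cst n u : snorm (fam_sip n) (cst u) = snorm B u.
Proof. by rewrite /snorm fam_cst. Qed.

Lemma snorm_fscale n M k U : 0 <= M -> (forall w, w \in words n -> `|k w| <= M) ->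
  snorm (fam_sip n) (fscale k U) <= M * snorm (fam_sip n) U.
Proof.
move=> M0 kM; rewrite -(@ler_pXn2r _ 2) ?nnegrE ?mulr_ge0 ?snorm_ge0// exprMn !sqr_snorm.
rewrite /= /fam mulr_sumr !big_seq; apply: ler_sum => w wn.
rewrite -[leLHS]/(ew_sip w (k w *: U w) (k w *: U w)) sipZl sipZr mulrA -normCK.
rewrite -[X in _ <= _ * X]/(ew_sip w (U w) (U w)).
by rewrite ler_wpM2r ?sip_ge0// ler_pXn2r ?nnegrE ?kM.
Qed.

Definition avg (st : I -> R[i]) n w : R[i] := walk st w / n%:R.

Lemma avg_le st n w : (forall c, `|st c| <= 2) -> w \in words n.+1 -> `|avg st n.+1 w| <= 2.
Proof.
move=> st2 /size_words sw; rewrite normf_div [`|n.+1%:R|]ger0_norm// ler_pdivrMr ?ltr0Sn//.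
rewrite -sw; elim: w {sw} => [|c w IH] /=; first by rewrite /walk big_nil normr0 mulr0.
rewrite /walk big_cons -[(size w).+1%:R]nat1r mulrDr mulr1; apply: le_trans (ler_normD _ _) _.
exact: lerD.
Qed.

(** In L^2 over the words, the scalar function [k n] times the constant [u] tends to the constant
    [v]. The shift to [n.+1] avoids averaging over no steps. *)
Definition approx (k : nat -> seq I -> R[i]) u v :=
  tends (fun n => snorm (fam_sip n.+1) (cst v - fscale (k n.+1) (cst u))) 0.

Lemma approx_ext (k k' : nat -> seq I -> R[i]) u v :
  (forall n w, k n w = k' n w) -> approx k u v -> approx k' u v.
Proof. by move=> kk'; rewrite (_ : k = k')//; apply/funext => n; apply/funext. Qed.

(** The weak law of large numbers: by [walk_var] the squared distance from [X v] to the average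
    times [v] is the variance of one step divided by n+1. The error already present is multiplied by
    an average, hence by at most 2. *)
Lemma approx_step (X : {linear E -> E}) st (k : nat -> seq I -> R[i]) u v :
  (forall x, \sum_c st c *: Aop c x = X x) -> (forall c, `|st c| <= 2) ->
  approx k u v -> approx (fun n w => avg st n w * k n w) u (X v).
Proof.
move=> Xm st2 kuv.
pose s n := snorm (fam_sip n.+1) (cst (X v) - fscale (avg st n.+1) (cst v)).
have s0 : tends s 0.
  have h := tends_lin (step_var X st v) (@tends_natSinv R) (tends_cst 0).
  rewrite mulr0 addr0 in h.
  have sE n : step_var X st v * (n.+1%:R)^-1 + 0 =
      fam_sip n.+1 (cst (X v) - fscale (avg st n.+1) (cst v)) (cst (X v) - fscale (avg st n.+1) (cst v)).
    have n0 : n.+1%:R != 0 :> R[i] by rewrite pnatr_eq0.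
    have := walk_var Xm n.+1 v; rewrite addr0.
    rewrite (eq_bigr (fun w => n.+1%:R ^+ 2 * ew_sip w ((cst (X v) - fscale (avg st n.+1) (cst v)) w)
        ((cst (X v) - fscale (avg st n.+1) (cst v)) w))) => [|w _]; last first.
      have -> : n.+1%:R *: X v - walk st w *: v =
          n.+1%:R *: ((cst (X v) - fscale (avg st n.+1) (cst v)) w).
        by rewrite -[RHS]/(_ *: (_ - _ *: _)) scalerBr scalerA mulrC divfK.
      by rewrite sipZl sipZr conjC_nat; ring.
    rewrite -mulr_sumr => e; apply: (mulfI n0); apply: (mulfI n0).
    by rewrite mulrA -expr2 [RHS]mulrA -expr2 e; field.
  apply: tends_sqrt => [n|]; first exact: sip_ge0.
  exact: tends_ext h.
have := tends_lin 2 kuv s0; rewrite mulr0 addr0 => h.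
apply: (tends_dom ler01 h); exists 0%N => n _.
rewrite subr0 mul1r [leRHS]ger0_norm; last by rewrite addr_ge0 ?mulr_ge0 ?snorm_ge0.
rewrite ger0_norm ?snorm_ge0//.
apply: le_trans (snorm_dist _ _ (fscale (avg st n.+1) (cst v)) _) _.
rewrite addrC lerD2r.
rewrite (_ : _ - _ = fscale (avg st n.+1) (cst v - fscale (k n.+1) (cst u))).
  by apply: snorm_fscale => // w; exact: avg_le.
by apply/funext => w; rewrite -[RHS]/(_ *: (_ - _ *: _)) scalerBr scalerA.
Qed.

Lemma approx_mon p l u :
  approx (fun n w => avg wst n w ^+ p * avg tst n w ^+ l) u (iter p W (iter l T u)).
Proof.
elim: p => [|p IH].
  elim: l => [|l IH] /=.
    apply: tends_ext (tends_cst 0) => n; rewrite (_ : _ - _ = 0) ?snorm0//.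
    by apply/funext => w; rewrite -[LHS]/(_ - _ *: _) mulr1 scale1r subrr.
  apply: approx_ext (approx_step Aop_tsum tst_le IH) => n w.
  by rewrite !mul1r -exprS.
apply: approx_ext (approx_step Aop_wsum wst_le IH) => n w.
by rewrite mulrA -exprS.
Qed.

Lemma approx_dot (k k' : nat -> seq I -> R[i]) u v y z : approx k u y -> approx k' v z ->
  tends (fun n => fam_sip n.+1 (fscale (k n.+1) (cst u)) (fscale (k' n.+1) (cst v))) (B y z).
Proof.
rewrite /approx; set a := (fun n => snorm _ _); set b := (fun n => snorm _ _) => a0 b0.
have h : tends (fun n => snorm B z * a n + (snorm B y * b n + a n * b n)) 0.
  have := tends_lin (snorm B z) a0 (tends_lin (snorm B y) b0 (tendsM a0 b0)).
  by rewrite !mulr0 !addr0.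
have an n : 0 <= a n by exact: snorm_ge0.
have bn n : 0 <= b n by exact: snorm_ge0.
apply: (tends_dom ler01 h); exists 0%N => n _; rewrite mul1r [leRHS]ger0_norm; last first.
  by rewrite !addr_ge0 ?mulr_ge0 ?snorm_ge0.
set U := fscale _ _; set V := fscale _ _; rewrite -(fam_cst n.+1) distrC.
have -> : fam_sip n.+1 (cst y) (cst z) - fam_sip n.+1 U V =
  fam_sip n.+1 (cst y - U) (cst z) + fam_sip n.+1 U (cst z - V).
  by rewrite sipBl sipBr; ring.
have Ule : snorm (fam_sip n.+1) U <= snorm B y + a n.
  have := snormD (fam_sip n.+1) (cst y) (U - cst y).
  by rewrite [cst y + _]addrC subrK snorm_cst snormC.
apply: le_trans (ler_normD _ _) _; rewrite lerD//.
  by apply: le_trans (sip_CS _ _ _) _; rewrite snorm_cst mulrC.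
apply: le_trans (sip_CS _ _ _) _; rewrite -mulrDl ler_wpM2r ?snorm_ge0//.
Qed.

End Families.

Lemma tends_sum J (r : seq J) (u : J -> nat -> R[i]) (l : J -> R[i]) :
  (forall j, tends (u j) (l j)) ->
  tends (fun n => \sum_(j <- r) u j n) (\sum_(j <- r) l j).
Proof.
move=> ul; elim: r => [|j r IH].
  by rewrite big_nil; apply: tends_ext (tends_cst 0) => n; rewrite big_nil.
have := tends_lin 1 (ul j) IH; rewrite mul1r big_cons; apply: tends_ext => n.
by rewrite mul1r big_cons.
Qed.

(** For each word the averages form a point (x, t) with t >= 0, at which the coefficient matrix is
    positive semidefinite. Apply [schur_ge0] with [ew_sip w], sum over the words and let their
    length grow. *)
Theorem walk_ge0 m n (a : 'I_m -> 'I_m -> 'I_n.+1 -> 'I_n.+1 -> R[i]) (f : 'I_m -> E) :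
  (forall (x t : R[i]) (z : 'I_m -> R[i]), 0 <= t ->
    0 <= \sum_(i < m) \sum_(j < m) \sum_(p < n.+1) \sum_(q < n.+1)
      a i j p q * (x ^+ p * t ^+ (n - p)) * (x ^+ q * t ^+ (n - q))^* * z i * (z j)^*) ->
  0 <= \sum_(i < m) \sum_(j < m) \sum_(p < n.+1) \sum_(q < n.+1)
      a i j p q * B (iter p W (iter (n - p) T (f i))) (iter q W (iter (n - q) T (f j))).
Proof.
move=> a_ge0.
pose k p N w := avg wst N w ^+ p * avg tst N w ^+ (n - p).
have lim : tends (fun N => \sum_(i < m) \sum_(j < m) \sum_(p < n.+1) \sum_(q < n.+1)
    a i j p q * fam_sip N.+1 (fscale (k p N.+1) (cst (f i))) (fscale (k q N.+1) (cst (f j))))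
  (\sum_(i < m) \sum_(j < m) \sum_(p < n.+1) \sum_(q < n.+1)
      a i j p q * B (iter p W (iter (n - p) T (f i))) (iter q W (iter (n - q) T (f j)))).
  apply: tends_sum => i; apply: tends_sum => j; apply: tends_sum => p; apply: tends_sum => q.
  have h := approx_dot (@approx_mon p (n - p) (f i)) (@approx_mon q (n - q) (f j)).
  have := tends_lin (a i j p q) h (tends_cst 0).
  by rewrite addr0; apply: tends_ext => N; rewrite addr0.
apply: tends_ge0 lim => N.
pose Q w i j := \sum_(p < n.+1) \sum_(q < n.+1) a i j p q * k p N.+1 w * (k q N.+1 w)^*.
rewrite (_ : \sum_(i < m) _ = \sum_(w <- words N.+1) \sum_(i < m) \sum_(j < m)
    Q w i j * ew_sip w (f i) (f j)).
  apply: sumr_ge0 => w _; apply: schur_ge0 => z.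
  rewrite (_ : \sum_(i < m) _ = \sum_(i < m) \sum_(j < m) \sum_(p < n.+1) \sum_(q < n.+1)
      a i j p q * k p N.+1 w * (k q N.+1 w)^* * z i * (z j)^*); last first.
    apply: eq_bigr => i _; apply: eq_bigr => j _; rewrite /Q !mulr_suml.
    by apply: eq_bigr => p _; rewrite !mulr_suml.
  apply: a_ge0; rewrite divr_ge0//; apply: sumr_ge0 => c _; exact: tst_ge0.
rewrite [RHS]exchange_big; apply: eq_bigr => i _ /=.
rewrite [RHS]exchange_big; apply: eq_bigr => j _ /=.
under [RHS]eq_bigr do rewrite /Q mulr_suml.
rewrite [RHS]exchange_big; apply: eq_bigr => p _ /=.
under [RHS]eq_bigr do rewrite mulr_suml.
rewrite [RHS]exchange_big; apply: eq_bigr => q _ /=.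
rewrite mulr_sumr; apply: eq_bigr => w _.
rewrite -[X in _ * X = _]/(ew_sip w (k p N.+1 w *: f i) (k q N.+1 w *: f j)) sipZl sipZr.
ring.
Qed.

End RandomWalk.

(** * The resolvent of a normal operator *)

Section Projection.
Variables (R : realType) (E : lmodType R[i]) (B : sip E) (D : set E).
Hypothesis D0 : D 0.
Hypothesis D_lin : forall c x y, D x -> D y -> D (c *: x + y).
Hypothesis D_complete : forall u : nat -> E, (forall n, D (u n)) -> scauchy B u ->
  exists2 x, D x & tends (fun n => snorm B (u n - x)) 0.

(** A minimizing sequence is Cauchy by the parallelogram law. Near-minimality along [x n - t *: h]
    makes a quadratic form in [t] nonnegative, and [disc_le] then bounds [B (y - x n) h] by the gap
    to the infimum. *)
Lemma projection y : exists2 x, D x & forall h, D h -> B (y - x) h = 0.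
Proof.
pose r z : R := complex.Re (B z z).
have rE z : B z z = (r z)%:C%C.
  by rewrite -[LHS]RRe_real// realE sip_ge0.
have r_ge0 z : 0 <= r z by rewrite -ler0c -rE sip_ge0.
pose S := [set t | exists2 x, D x & t = r (y - x)].
have S_inf : has_inf S.
  split; first by exists (r (y - 0)), 0.
  by exists 0 => _ [x _ ->].
pose d := inf S.
have dP x : D x -> d <= r (y - x) by move=> Dx; apply: (inf_lbound S_inf.2); exists x.
have ex (n : nat) : exists x, D x /\ r (y - x) < d + n.+1%:R^-1.
  have [|_ [x Dx ->] lt] := @inf_adherent R S n.+1%:R^-1 _ S_inf; first by rewrite invr_gt0.
  by exists x.
have [x xP] := choice ex.
have para m n : r (x m - x n) <= 2 * m.+1%:R^-1 + 2 * n.+1%:R^-1.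
  have Dmid : D (2^-1 *: (x m + x n)).
    rewrite -[_ *: _]addr0; apply: D_lin D0; rewrite -[x m]scale1r.
    exact: D_lin (xP m).1 (xP n).1.
  have eC : B (x m - x n) (x m - x n) + 4 * B (y - 2^-1 *: (x m + x n)) (y - 2^-1 *: (x m + x n)) =
      2 * B (y - x m) (y - x m) + 2 * B (y - x n) (y - x n).
    rewrite !(sipBl, sipBr, sipDl, sipDr, sipZl, sipZr) fmorphV /= conjC_nat.
    by field.
  have : r (x m - x n) + 4 * r (y - 2^-1 *: (x m + x n)) = 2 * r (y - x m) + 2 * r (y - x n).
    apply: (@complexI R); move: eC; rewrite !rE => eC.
    by rewrite [LHS]rmorphD [RHS]rmorphD !rmorphM !rmorph_nat.
  have := dP _ Dmid; have := (xP m).2; have := (xP n).2.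
  move: (m.+1%:R^-1) (n.+1%:R^-1) => a b; lra.
have xC : scauchy B x.
  move=> e e0; have e4 : 0 < e ^+ 2 / 4 by rewrite divr_gt0 ?exprn_gt0.
  have [N NP] := cplx_natSinv e4.
  exists N => i j Ni Nj; rewrite -(@ltr_pXn2r _ 2) ?nnegrE ?snorm_ge0 ?(ltW e0)//.
  rewrite sqr_snorm rE; apply: le_lt_trans (_ : _ <= (2 * i.+1%:R^-1 + 2 * j.+1%:R^-1)%:C%C) _.
    by rewrite lecR.
  rewrite rmorphD !rmorphM /= !fmorphV /= !rmorph_nat.
  have -> : e ^+ 2 = 2 * (e ^+ 2 / 4) + 2 * (e ^+ 2 / 4) by field.
  by apply: ltrD; rewrite ltr_pM2l// NP.
have [l Dl xl] := D_complete (fun n => (xP n).1) xC.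
exists l => // h Dh.
have CSn n : `|B (y - x n) h| ^+ 2 <= (n.+1%:R)^-1 * B h h.
  apply: le_trans (_ : (r (y - x n) - d)%:C%C * B h h <= _); last first.
    rewrite ler_wpM2r ?sip_ge0//.
    rewrite (_ : (n.+1%:R)^-1 = (n.+1%:R^-1 : R)%:C%C); last by rewrite fmorphV rmorph_nat.
    rewrite lecR; have := (xP n).2; move: (n.+1%:R^-1) => a; lra.
  apply: disc_le => [|t]; first exact: sip_ge0.
  have Dt : D (x n - t *: h) by rewrite addrC -scaleNr; exact: D_lin Dh (xP n).1.
  have yt : y - (x n - t *: h) = (y - x n) + t *: h by rewrite opprB addrA addrAC.
  have := dP _ Dt; rewrite yt -lecR -rE -subr_ge0 sip_quad -sipC rmorphB /= -rE.
  by rewrite -!addrA [- d%:C%C + _]addrC !addrA.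
have t1 : tends (fun n => B (y - x n) h) 0.
  have h1 : tends (fun n => sqrtC ((n.+1%:R)^-1 * B h h)) 0.
    apply: tends_sqrt => [n|]; first by rewrite mulr_ge0 ?invr_ge0 ?sip_ge0.
    by have := tendsM (@tends_natSinv R) (tends_cst (B h h)); rewrite mul0r.
  apply: (tends_dom ler01 h1); exists 0%N => n _.
  rewrite subr0 mul1r [leRHS]ger0_norm ?sqrtC_ge0 ?mulr_ge0 ?invr_ge0 ?sip_ge0//.
  by rewrite -(@ler_pXn2r _ 2) ?nnegrE ?sqrtC_ge0 ?mulr_ge0 ?invr_ge0 ?sip_ge0// sqrtCK.
have t2 : tends (fun n => B (y - x n) h) (B (y - l) h).
  apply: (tends_dom (snorm_ge0 B h) xl); exists 0%N => n _.
  rewrite -sipBl [`| snorm _ _|]ger0_norm ?snorm_ge0// mulrC.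
  apply: le_trans (sip_CS _ _ _) _; rewrite (_ : _ - _ - _ = l - x n) ?[snorm B (l - _)]snormC//.
  by rewrite opprB addrC addrA subrK.
exact: tends_uniq t2 t1.
Qed.

End Projection.

Section Resolvent.
Variables (R : realType) (K : hilbertType R) (N : linop K).

Lemma inner_eq0 (x : K) : '[x, x] = 0 -> x = 0.
Proof. by rewrite inner_norm => /eqP; rewrite sqrf_eq0 normr_eq0 => /eqP. Qed.

Lemma hilbert_ips_complete (u : nat -> K) :
  (forall e, 0 < e -> exists N : nat, forall i j, (N <= i)%N -> (N <= j)%N ->
    snorm (inner_sip K) (u i - u j) < e) ->
  exists l, forall e, 0 < e -> exists N : nat, forall i, (N <= i)%N ->
    snorm (inner_sip K) (u i - l) < e.
Proof.
move=> uC; have [|l lP] := @hilbert_complete R K u.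
  by move=> e /uC[M MP]; exists M => i j Mi Mj; rewrite -snorm_inner MP.
by exists l => e /lP[M MP]; exists M => i Mi; rewrite snorm_inner MP.
Qed.

Definition hilbert_ips : ips R := @Ips R K (inner_sip K) inner_eq0 hilbert_ips_complete.

Hypothesis N_normal : normal_op N.
Variable s : R[i].
Hypothesis s_gt0 : 0 < s.

Let s_conj : s^* = s.
Proof. by apply: conj_Creal; rewrite realE (ltW s_gt0). Qed.

(** Project (y, 0) onto the graph of s N, which is complete because N is closed. Orthogonality to
    the graph reads <y - x, h> = s^2 <N x, N h>, that is, N^* N x = s^(-2) (y - x). *)
Lemma resolvent_ex y : exists x, dom N x /\ adjoint_at N (N x) (s ^- 2 *: (y - x)).
Proof.
have [_ N_closed _ _] := N_normal.
have s0 : s != 0 by rewrite gt_eqF.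
pose B := pair_sip hilbert_ips.
pose D : set (K * K)%type := [set p | dom N p.1 /\ p.2 = s *: N p.1].
have N0 : N 0 = 0.
  by have := linop_linear (-1) (dom0 N) (dom0 N); rewrite scaler0 addr0 scaleN1r addNr.
have [|c p q [p1 p2] [q1 q2]|u uD uC|[x ?] [/= Dx ->] xP] := @projection R _ B D _ _ _ (y, 0).
- by split; [exact: dom0|rewrite /= N0 scaler0].
- split; first exact: dom_linear.
  by rewrite /= p2 q2 linop_linear// scalerDr !scalerA mulrC.
- have [[l1 l2] lP] := pair_complete uC.
  have [Dl Nl] : dom N l1 /\ N l1 = s^-1 *: l2.
    apply/(closed_opP N).1 => // e e0.
    have e1 : 0 < e / 2 by rewrite divr_gt0.
    have [M1 M1P] := lP _ e1.
    have [M2 M2P] := lP _ (divr_gt0 (mulr_gt0 s_gt0 e0) (ltr0Sn _ 1)).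
    have [d1 d2] := uD (maxn M1 M2).
    exists (u (maxn M1 M2)).1; split=> //.
      rewrite distrC -snorm_inner; apply: le_lt_trans (snorm_fst (X := hilbert_ips) (u (maxn M1 M2) - (l1, l2))) _.
      by rewrite mulrC -ltr_pdivlMr// M1P// leq_maxl.
    have -> : s^-1 *: l2 - N (u (maxn M1 M2)).1 = s^-1 *: (l2 - (u (maxn M1 M2)).2).
      by rewrite d2 scalerBr scalerA mulVf// scale1r.
    rewrite normrZ normfV (gtr0_norm s_gt0) mulrC ltr_pdivrMr// distrC -snorm_inner [e * s]mulrC.
    apply: le_lt_trans (snorm_snd (X := hilbert_ips) (u (maxn M1 M2) - (l1, l2))) _.
    by rewrite [ltLHS]mulrC -ltr_pdivlMr// M2P// leq_maxr.
  exists (l1, l2); first by split=> //=; rewrite Nl scalerA mulfV// scale1r.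
  move=> e /lP[M MP]; exists M => n Mn.
  by rewrite subr0 ger0_norm ?snorm_ge0 ?MP.
- exists x; split=> // h Dh.
  have := xP (h, s *: N h) (conj Dh erefl); rewrite /= /pair_dot /= => /eqP.
  rewrite mulf_eq0 invr_eq0 pnatr_eq0 orbF sub0r => /eqP.
  rewrite -[X in X + _]/('[y - x, h]) -[X in _ + X]/('[- (s *: N x), s *: N h]).
  rewrite -scaleNr innerZl innerZr s_conj => e.
  rewrite innerZr innerC [in RHS]innerC.
  have -> : '[y - x, h] = s ^+ 2 * '[N x, N h] by apply: (eq_from_diff _ e); ring.
  by rewrite rmorphM /= fmorphV /= !rmorphXn /= s_conj mulrA mulVf ?mul1r// expf_neq0.
Qed.

End Resolvent.

Lemma inner_sipE (R : realType) (K : hilbertType R) (x y : K) :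
  inner_sip K x y = '[x, y].
Proof. by []. Qed.

Section ResolventTheory.
Variables (R : realType) (K : hilbertType R) (N : linop K).
Hypothesis N_normal : normal_op N.

Let N_dense := let: And4 h _ _ _ := N_normal in h.
Let N_dom := let: And4 _ _ h _ := N_normal in h.
Let N_comm := let: And4 _ _ _ h := N_normal in h.

Lemma adjoint_at_lin c y z y' z' : adjoint_at N y z -> adjoint_at N y' z' ->
  adjoint_at N (c *: y + y') (c *: z + z').
Proof. by move=> h h' x Dx; rewrite !inner_linr h// h'. Qed.

Lemma adjoint_at_uniq y z z' : adjoint_at N y z -> adjoint_at N y z' -> z = z'.
Proof.
move=> h h'; apply/eqP; rewrite -subr_eq0; apply/eqP.
apply: (@dense_eq0 R (hilbert_ips K) (dom N)) => [x e e0|x Dx].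
  have [x' Dx' xx'] := (densely_definedP N).1 N_dense x e e0.
  by exists x' => //; rewrite snorm_inner.
by rewrite -[LHS]/('[z - z', x]) innerC innerBr -h// -h'// subrr conjC0.
Qed.

Lemma adjointE y z : adjoint_at N y z -> adjoint N y = z.
Proof.
move=> yz; rewrite /adjoint; case: xgetP => [z' _ yz'|/(_ z)//].
exact: adjoint_at_uniq yz' yz.
Qed.

Lemma adjointP y : adjoint_dom N y -> adjoint_at N y (adjoint N y).
Proof. by move=> [z yz]; rewrite (adjointE yz). Qed.

Lemma linop_lin c x y : dom N x -> dom N y -> N (c *: x + y) = c *: N x + N y.
Proof. exact: linop_linear. Qed.

Lemma linopZ c x : dom N x -> N (c *: x) = c *: N x.
Proof.
move=> Dx; have N0 : N 0 = 0.
  by have := linop_lin (-1) (dom0 N) (dom0 N); rewrite scaler0 addr0 scaleN1r addNr.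
by have := linop_lin c Dx (dom0 N); rewrite !addr0 N0 addr0.
Qed.

Lemma domZ c x : dom N x -> dom N (c *: x).
Proof. by move=> Dx; rewrite -[_ *: _]addr0; apply: dom_linear => //; exact: dom0. Qed.

Lemma linopB x y : dom N x -> dom N y -> N (x - y) = N x - N y.
Proof.
move=> Dx Dy; rewrite addrC -scaleN1r linop_lin// scaleN1r.
by rewrite addrC.
Qed.

Lemma domB x y : dom N x -> dom N y -> dom N (x - y).
Proof. by move=> Dx Dy; rewrite addrC -scaleN1r; exact: dom_linear. Qed.

Variable s : R[i].
Hypothesis s_gt0 : 0 < s.

Let s0 : s != 0. Proof. by rewrite gt_eqF. Qed.
Let s2 : s ^+ 2 != 0. Proof. by rewrite expf_neq0. Qed.
Let s_conj : s^* = s. Proof. by apply: conj_Creal; rewrite realE (ltW s_gt0). Qed.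
Let s2_conj : (s ^- 2)^* = s ^- 2.
Proof. by rewrite fmorphV rmorphXn /= s_conj. Qed.

(* [res y] is (1 + s^2 N^* N)^{-1} y. *)
Definition res y : K := xget 0 [set x | dom N x /\ adjoint_at N (N x) (s ^- 2 *: (y - x))].

Lemma resP y : dom N (res y) /\ adjoint_at N (N (res y)) (s ^- 2 *: (y - res y)).
Proof.
by rewrite /res; case: xgetP => // H; have [x /(H x)] := resolvent_ex N_normal s_gt0 y.
Qed.

(** The difference d of two solutions satisfies N^* N d = - s^(-2) d, so <N d, N d> = - s^(-2) <d,
    d> with both inner products nonnegative. *)
Lemma res_uniq y x : dom N x -> adjoint_at N (N x) (s ^- 2 *: (y - x)) -> res y = x.
Proof.
move=> Dx Ax; have [Dr Ar] := resP y; apply/eqP; rewrite -subr_eq0; apply/eqP/inner_eq0.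
have Dd := domB Dr Dx.
have : adjoint_at N (N (res y - x)) (s ^- 2 *: (x - res y)).
  have := adjoint_at_lin (-1) Ax Ar.
  rewrite !scaleN1r -scalerN -scalerDr opprB addrA subrK.
  by rewrite [- N x + _]addrC -linopB.
move=> /(_ _ Dd); rewrite -[x - res y]opprB innerZr s2_conj => e.
have e' : '[res y - x, - (res y - x)] = - '[res y - x, res y - x].
    exact: (sipNr (inner_sip K)).
have := inner_ge0 (N (res y - x)); rewrite e e' mulrN oppr_ge0 pmulr_rle0 ?invr_gt0 ?exprn_gt0// => le.
by apply/eqP; rewrite eq_le le inner_ge0.
Qed.

Lemma res_lin : linear res.
Proof.
move=> c x y; have [[Dx Ax] [Dy Ay]] := conj (resP x) (resP y).
apply: res_uniq; first exact: dom_linear.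
rewrite linop_lin//; have := adjoint_at_lin c Ax Ay.
rewrite scalerA mulrC -scalerA -scalerDr scalerBr.
by rewrite (_ : _ - _ + _ = c *: x + y - (c *: res x + res y))// opprD addrACA.
Qed.

Definition star y := adjoint N (res y).

(** Normality enters through the domains: [res y] lies in the domain of N^* N, hence in that of N
    N^*, and the two products agree there. *)
Lemma starP y : [/\ adjoint_at N (res y) (star y), dom N (star y)
  & N (star y) = s ^- 2 *: (y - res y)].
Proof.
have [Dr Ar] := resP y; have Adr : adjoint_dom N (N (res y)) by exists (s ^- 2 *: (y - res y)).
have [h1 h2] := (N_dom (res y)).1 (conj Dr Adr).
split=> //; first exact: adjointP.
by rewrite /star -(N_comm Dr Adr) (adjointE Ar).
Qed.

Lemma star_lin : linear star.
Proof.
move=> c x y; have [[Ax _ _] [Ay _ _]] := conj (starP x) (starP y).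
by apply: adjointE; rewrite res_lin; exact: adjoint_at_lin.
Qed.

Lemma Nres_lin : linear (fun y => N (res y)).
Proof.
by move=> c x y; rewrite res_lin linop_lin//; have [] := resP x; have [] := resP y.
Qed.

(** N^* N (res x) = s^(-2) (x - res x) lies in D(N), so N (res x) belongs to the domain of N N^*,
    hence of N^* N. It then solves the equation that characterizes [res (N x)]. *)
Lemma res_N x : dom N x -> dom N (N (res x)) /\ res (N x) = N (res x).
Proof.
move=> Dx; have [Dr Ar] := resP x.
have Adr : adjoint_dom N (N (res x)) by exists (s ^- 2 *: (x - res x)).
have [h1 h2] : dom N (N (res x)) /\ adjoint_dom N (N (N (res x))).
  by apply/N_dom; split=> //; rewrite (adjointE Ar); apply/domZ/domB.
split=> //; apply: res_uniq => //.
have := adjointP h2; rewrite (N_comm h1 h2) (adjointE Ar) linopZ ?linopB//.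
exact: domB.
Qed.

Lemma res_star x : adjoint_dom N x -> res (adjoint N x) = star x.
Proof.
move=> /adjointP Ax; have [Ar Ds Ns] := starP x.
apply: res_uniq => //; rewrite Ns.
have h := adjoint_at_lin (-1) Ar Ax; rewrite !scaleN1r [- _ + x]addrC [- _ + adjoint N x]addrC in h.
have h0 : adjoint_at N 0 0 by move=> z _; rewrite -[0 in LHS](scale0r 0) -[0 in RHS](scale0r 0) !innerZr conjC0 !mul0r.
by have := adjoint_at_lin (s ^- 2) h h0; rewrite !addr0.
Qed.

Lemma res_innerE u v : '[res u, v] = '[res u, res v] + s ^+ 2 * '[N (res u), N (res v)].
Proof.
have [[Du _] [Dv Av]] := conj (resP u) (resP v).
by rewrite (Av _ Du) innerZr s2_conj mulrA mulfV// mul1r innerBr addrC subrK.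
Qed.
Lemma res_sym u v : '[res u, v] = '[u, res v].
Proof.
rewrite res_innerE [RHS]innerC (res_innerE v u) rmorphD rmorphM rmorphXn /= s_conj.
by rewrite -!innerC.
Qed.

(** Split v = s^2 N (star v) + res v. Moving N across the inner product turns the two parts into <u
    - res u, star v> and <res u, star v>. *)
Lemma Nres_adj u v : '[N (res u), v] = '[u, star v].
Proof.
have [[Du Au] [Av Ds Ns]] := conj (resP u) (starP v).
have e1 : '[N (res u), res v] = '[res u, star v] by exact: Av.
have e2 : s ^+ 2 * '[N (res u), N (star v)] = '[u - res u, star v].
  rewrite [X in _ * X]innerC (Au _ Ds) innerZr s2_conj rmorphM /= s2_conj -innerC.
  by rewrite mulrA mulfV// mul1r.
have ve : v = s ^+ 2 *: N (star v) + res v.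
  by rewrite Ns scalerA mulfV// scale1r subrK.
rewrite {1}ve inner_linr rmorphXn /= s_conj e2 e1 -[X in X + _](inner_sipE) -[X in _ + X]inner_sipE.
by rewrite -sipDl subrK.
Qed.

Lemma sN_lin : linear (fun y => s *: N (res y)).
Proof. by move=> c x y; rewrite Nres_lin scalerDr !scalerA mulrC. Qed.

Lemma sstar_lin : linear (fun y => s *: star y).
Proof. by move=> c x y; rewrite star_lin scalerDr !scalerA mulrC. Qed.

(* For the spectral variable l, [opT], [opW] and [opW'] are the multiplications by
   1 / (1 + s^2 |l|^2), s l / (1 + s^2 |l|^2) and its conjugate. *)
Definition opW : {linear K -> K} := HB.pack (fun y => s *: N (res y))
  (GRing.isLinear.Build _ _ _ _ (fun y => s *: N (res y)) sN_lin).

Definition opW' : {linear K -> K} := HB.pack (fun y => s *: star y)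
  (GRing.isLinear.Build _ _ _ _ (fun y => s *: star y) sstar_lin).

Definition opT : {linear K -> K} := HB.pack res (GRing.isLinear.Build _ _ _ _ res res_lin).

Lemma opW_adj u v : inner_sip K (opW u) v = inner_sip K u (opW' v).
Proof. by rewrite sipZl sipZr s_conj; congr (_ * _); exact: Nres_adj. Qed.

Lemma opT_sym u v : inner_sip K (opT u) v = inner_sip K u (opT v).
Proof. exact: res_sym. Qed.

Lemma opWT u : opW (opT u) = opT (opW u).
Proof.
rewrite [RHS]linearZ /=; congr (_ *: _).
by have [_ ->] := res_N (resP u).1.
Qed.

Lemma opW'T u : opW' (opT u) = opT (opW' u).
Proof.
rewrite [RHS]linearZ /=; congr (_ *: _).
by rewrite res_star//; have [h _ _] := starP u; exists (star u).
Qed.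

(** Spectrally, s^2 |l|^2 t^2 = t - t^2 for t = 1 / (1 + s^2 |l|^2). *)
Lemma opWW' u : opW (opW' u) = opT u - opT (opT u).
Proof.
rewrite -[LHS]/(s *: N (opT (opW' u))) -opW'T.
have [_ Ds Ns] := starP (res u).
by rewrite -[opW' _]/(s *: star (res u)) linopZ// Ns !scalerA -expr2 mulfV// scale1r.
Qed.

Lemma opW'W u : opW' (opW u) = opT u - opT (opT u).
Proof.
rewrite -[LHS]/(s *: adjoint N (opT (opW u))) -opWT.
have [_ Ar] := resP (res u).
have h0 : adjoint_at N 0 0 by move=> z _; rewrite -[0 in LHS](scale0r 0) -[0 in RHS](scale0r 0) !innerZr conjC0 !mul0r.
have := adjoint_at_lin s Ar h0; rewrite !addr0 => /adjointE h.
by rewrite -[opW _]/(s *: N (res (res u))) h !scalerA -expr2 mulfV// scale1r.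
Qed.

Lemma res_contract u : `|res u| <= `|u|.
Proof.
have h : `|res u| ^+ 2 <= `|res u| * `|u|.
  apply: le_trans (inner_CS (res u) u); rewrite res_innerE ger0_norm ?addr_ge0 ?mulr_ge0 ?inner_ge0 ?exprn_ge0 ?(ltW s_gt0)//.
  by rewrite inner_norm lerDl mulr_ge0 ?inner_ge0 ?exprn_ge0 ?(ltW s_gt0).
have [->|n0] := eqVneq (`|res u|) 0; first by rewrite normr_ge0.
by move: h; rewrite expr2 ler_pM2l// lt_def n0 normr_ge0.
Qed.

(** With a = |N x| and b = |N (res x)|, the squared distance is at most s^2 (a b - b^2), hence at
    most s^2 a^2. This gives a rate for [res] tending to the identity on D(N) as s tends to 0. *)
Lemma res_close x : dom N x -> `|x - res x| <= s * `|N x|.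
Proof.
move=> Dx; have [Dr Ar] := resP x.
rewrite -(@ler_pXn2r _ 2) ?nnegrE ?mulr_ge0 ?normr_ge0 ?(ltW s_gt0)//.
have e : `|x - res x| ^+ 2 = s ^+ 2 * ('[N x, N (res x)] - `|N (res x)| ^+ 2).
  rewrite -!inner_norm -innerBl -linopB// (Ar _ (domB Dx Dr)) innerZr s2_conj.
  by rewrite mulrA mulfV// mul1r.
have : 0 <= '[N x, N (res x)] - `|N (res x)| ^+ 2.
  by rewrite -(@pmulr_rge0 _ (s ^+ 2)) ?exprn_gt0// -e exprn_ge0.
rewrite e exprMn => pos; rewrite ler_pM2l ?exprn_gt0//.
set a := `|N x|; set b := `|N (res x)|.
have ab : '[N x, N (res x)] <= a * b.
  have ipR : '[N x, N (res x)] \is Num.real.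
    rewrite -['[N x, N (res x)]](subrK (b ^+ 2)) rpredD ?(ger0_real pos)//.
    by apply: ger0_real; rewrite exprn_ge0 // normr_ge0.
  exact: le_trans (real_ler_norm ipR) (inner_CS _ _).
apply: le_trans (lerD ab (lexx _)) _; rewrite -subr_ge0.
have -> : a ^+ 2 - (a * b - b ^+ 2) = (a - b) ^+ 2 + a * b by ring.
apply: addr_ge0; last by rewrite mulr_ge0 ?normr_ge0.
by apply: real_exprn_even_ge0 => //; rewrite rpredB ?normr_real.
Qed.

Lemma iter_res_lin k : linear (iter k res).
Proof. by elim: k => [|k IH] c x y //=; rewrite IH res_lin. Qed.

Lemma iter_resZ k c x : iter k res (c *: x) = c *: iter k res x.
Proof.
have h0 : iter k res 0 = 0.
  by have := iter_res_lin k (-1) 0 0; rewrite scaler0 addr0 scaleN1r addNr.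
by have := iter_res_lin k c x 0; rewrite h0 !addr0.
Qed.

Lemma iter_res_contract k x : `|iter k res x| <= `|x|.
Proof. by elim: k => //= k; apply: le_trans; exact: res_contract. Qed.

Lemma iter_res_close k x : dom N x -> `|iter k res x - x| <= k%:R * (s * `|N x|).
Proof.
move=> Dx; elim: k => [|k IH]; first by rewrite subrr normr0 mul0r.
rewrite iterSr.
have -> : iter k res (res x) - x = iter k res (res x - x) + (iter k res x - x).
  have -> : res x - x = (-1) *: x + res x by rewrite scaleN1r addrC.
  by rewrite iter_res_lin scaleN1r [- _ + iter _ _ (res x)]addrC addrA subrK.
apply: le_trans (ler_normD _ _) _; rewrite -nat1r mulrDl mul1r lerD//.
apply: le_trans (iter_res_contract _ _) _.
by rewrite distrC res_close.
Qed.

Lemma iter_res_N k x : dom N x -> dom N (iter k res x) /\ iter k res (N x) = N (iter k res x).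
Proof.
move=> Dx; elim: k => [|k [Dk IH]] //=; split; first by have [] := resP (iter k res x).
by rewrite IH; have [_] := res_N Dk.
Qed.

Lemma iter_opW p x : (forall i, dom N (iter i N x)) ->
  iter p opW x = s ^+ p *: iter p res (iter p N x).
Proof.
move=> Dx; elim: p => [|p IH]; first by rewrite scale1r.
rewrite iterS IH -[LHS]/(s *: N (iter 1 res (s ^+ p *: iter p res (iter p N x)))).
rewrite iter_resZ /= -iterS linopZ; last by have [] := resP (iter p res (iter p N x)).
rewrite scalerA -exprS; congr (_ *: _).
by have [_ <-] := iter_res_N p.+1 (Dx p).
Qed.

(** For l = n - p the power of the resolvent is n whatever p is, so all terms of degree at most n
    are damped by the same operator. *)
Lemma iter_opWT p l x : (forall i, dom N (iter i N x)) ->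
  iter p opW (iter l opT x) = s ^+ p *: iter (p + l) res (iter p N x).
Proof.
move=> Dx; have comm k y : iter k opW (opT y) = opT (iter k opW y).
  by elim: k => // k IH; rewrite !iterS IH opWT.
have -> : iter p opW (iter l opT x) = iter l res (iter p opW x).
  by elim: l => // l IH; rewrite !iterS comm IH.
by rewrite iter_opW// iter_resZ addnC iterD.
Qed.

End ResolventTheory.

(** * From a normal extension to (ii) *)

Section SubnormalPositive.
Variable R : realType.

(** For t > 0 this is the given inequality at lambda = x / (s t), multiplied by t^(2 n); the case t
    = 0 follows by continuity in t. *)
Lemma poly_psd_homogeneous m n (a : 'I_m -> 'I_m -> 'I_n.+1 -> 'I_n.+1 -> R[i]) :
  (forall (lambda : R[i]) (z : 'I_m -> R[i]),
     0 <= \sum_(i < m) \sum_(j < m) \sum_(p < n.+1) \sum_(q < n.+1)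
            a i j p q * lambda ^+ p * lambda^* ^+ q * z i * (z j)^*) ->
  forall (s : R[i]), 0 < s -> forall (x t : R[i]) (z : 'I_m -> R[i]), 0 <= t ->
    0 <= \sum_(i < m) \sum_(j < m) \sum_(p < n.+1) \sum_(q < n.+1)
      (a i j p q * s ^- p * s ^- q) * (x ^+ p * t ^+ (n - p)) * (x ^+ q * t ^+ (n - q))^* * z i * (z j)^*.
Proof.
move=> a_ge0 s s0 x t z t_ge0.
have sr : s^* = s by apply: conj_Creal; rewrite realE (ltW s0).
have sn0 : s != 0 by rewrite gt_eqF.
have pos u : 0 < u -> 0 <= \sum_(i < m) \sum_(j < m) \sum_(p < n.+1) \sum_(q < n.+1)
      (a i j p q * s ^- p * s ^- q) * (x ^+ p * u ^+ (n - p)) * (x ^+ q * u ^+ (n - q))^* * z i * (z j)^*.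
  move=> u0; have ur : u^* = u by apply: conj_Creal; rewrite realE (ltW u0).
  have un0 : u != 0 by rewrite gt_eqF.
  rewrite (_ : \sum_(i < m) _ = (u ^+ n * u ^+ n) * \sum_(i < m) \sum_(j < m) \sum_(p < n.+1) \sum_(q < n.+1)
            a i j p q * (x / (s * u)) ^+ p * (x / (s * u))^* ^+ q * z i * (z j)^*).
    by rewrite mulr_ge0 ?a_ge0// mulr_ge0// exprn_ge0// ltW.
  rewrite mulr_sumr; apply: eq_bigr => i _; rewrite mulr_sumr; apply: eq_bigr => j _.
  rewrite mulr_sumr; apply: eq_bigr => p _; rewrite mulr_sumr; apply: eq_bigr => q _.
  have un (r : 'I_n.+1) : u ^+ n = u ^+ (n - r) * u ^+ r by rewrite -exprD subnK// -ltnS.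
  rewrite {1}(un p) (un q) !(rmorphM, rmorphXn, fmorphV) /= sr ur.
  rewrite !expr_div_n !exprMn_comm; try exact: mulrC.
  by field; rewrite ?expf_neq0.
have [t0|] := eqVneq t 0; last by move=> tn0; apply: pos; rewrite lt_def tn0.
pose P : {poly R[i]} := \sum_(i < m) \sum_(j < m) \sum_(p < n.+1) \sum_(q < n.+1)
  ((a i j p q * s ^- p * s ^- q) * x ^+ p * (x ^+ q)^* * z i * (z j)^*) *:
    ('X^(n - p) * 'X^(n - q)).
have PE u : 0 <= u -> P.[u] = \sum_(i < m) \sum_(j < m) \sum_(p < n.+1) \sum_(q < n.+1)
    (a i j p q * s ^- p * s ^- q) * (x ^+ p * u ^+ (n - p)) * (x ^+ q * u ^+ (n - q))^* * z i * (z j)^*.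
  move=> u0; have ur : u^* = u by apply: conj_Creal; rewrite realE u0.
  rewrite horner_sum; apply: eq_bigr => i _; rewrite horner_sum; apply: eq_bigr => j _.
  rewrite horner_sum; apply: eq_bigr => p _; rewrite horner_sum; apply: eq_bigr => q _.
  have -> : (x ^+ q * u ^+ (n - q))^* = (x ^+ q)^* * u ^+ (n - q) by rewrite rmorphM /= [X in _ * X]rmorphXn /= ur.
  rewrite hornerZ hornerM !hornerXn; set xq := (x ^+ q)^*; ring.
rewrite -PE// t0; apply: horner0_ge0 => u u0; rewrite PE ?(ltW u0)//; exact: pos.
Qed.

End SubnormalPositive.

Theorem subnormal_nonneg (R : realType) (H : hilbertType R) (S : linop H)
    (S_inv : forall f : H, dom S f -> dom S (S f)) :
  subnormal S ->
  forall (m n : nat) (a : 'I_m -> 'I_m -> 'I_n.+1 -> 'I_n.+1 -> R[i]),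
    (forall (lambda : R[i]) (z : 'I_m -> R[i]),
       0 <= \sum_(i < m) \sum_(j < m) \sum_(p < n.+1) \sum_(q < n.+1)
              a i j p q * lambda ^+ p * lambda^* ^+ q * z i * (z j)^*) ->
    forall f : 'I_m -> H, (forall i, dom S (f i)) ->
      0 <= \sum_(i < m) \sum_(j < m) \sum_(p < n.+1) \sum_(q < n.+1)
             a i j p q * '[iter p S (f i), iter q S (f j)].
Proof.
move=> [_ [K [J [N [J_iso N_normal JN]]]]] m n a a_ge0 f Df.
have DS k i : dom S (iter k S (f i)) by elim: k => //= k; exact: S_inv.
have iterJ k i : iter k N (J (f i)) = J (iter k S (f i)).
  by elim: k => //= k ->; have [_ ->] := JN _ (DS k i).
have DN i k : dom N (iter k N (J (f i))).
  by rewrite iterJ; have [] := JN _ (DS k i).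
pose s k : R[i] := (k.+1%:R)^-1.
have s_gt0 k : 0 < s k by rewrite invr_gt0 ltr0Sn.
pose x k p i := iter n (res N (s k)) (iter p N (J (f i))).
have xlim p i : tends (fun k => `|x k p i - J (iter p S (f i))|) 0.
  have h := tends_lin (n%:R * `|N (iter p N (J (f i)))|) (@tends_natSinv R) (tends_cst 0).
  rewrite mulr0 addr0 in h; apply: (tends_dom ler01 h); exists 0%N => k _.
  rewrite subr0 mul1r addr0 normr_id ger0_norm ?mulr_ge0 ?ler0n ?(ltW (s_gt0 k))//.
  by rewrite -iterJ -mulrA [_ * (k.+1%:R)^-1]mulrC; exact: iter_res_close.
have lim : tends (fun k => \sum_(i < m) \sum_(j < m) \sum_(p < n.+1) \sum_(q < n.+1)
    a i j p q * '[x k p i, x k q j])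
  (\sum_(i < m) \sum_(j < m) \sum_(p < n.+1) \sum_(q < n.+1)
      a i j p q * '[iter p S (f i), iter q S (f j)]).
  apply: tends_sum => i; apply: tends_sum => j; apply: tends_sum => p; apply: tends_sum => q.
  have h := inner_tends (xlim p i) (xlim q j).
  have := tends_lin (a i j p q) h (tends_cst 0).
  by rewrite addr0 J_iso; apply: tends_ext => k; rewrite addr0.
apply: tends_ge0 lim => k.
have h := @walk_ge0 R K (inner_sip K) _ _ _ (opW_adj N_normal (s_gt0 k)) (opT_sym N_normal (s_gt0 k))
  (opWT N_normal (s_gt0 k)) (opW'T N_normal (s_gt0 k)) (opWW' N_normal (s_gt0 k))
  (opW'W N_normal (s_gt0 k)) m n _ (fun i => J (f i)) (poly_psd_homogeneous a_ge0 (s_gt0 k)).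
(* Each W^p T^(n - p) J f_i is s^p times [x k p i], and the factors s^p s^q cancel those divided out
   of the coefficients. *)
congr (0 <= _) : h; apply: eq_bigr => i _; apply: eq_bigr => j _.
apply: eq_bigr => p _; apply: eq_bigr => q _.
have E (r : 'I_n.+1) l : iter r (opW N_normal (s_gt0 k))
    (iter (n - r) (opT N_normal (s_gt0 k)) (J (f l))) = s k ^+ r *: x k r l.
  by rewrite (@iter_opWT R K N N_normal (s k) (s_gt0 k) r _ _ (DN l)) subnKC// -ltnS.
rewrite (E p i) (E q j) inner_sipE innerZl innerZr.
have s_real : (s k)^* = s k by apply: conj_Creal; rewrite realE (ltW (s_gt0 k)).
have s0 : s k != 0 by rewrite gt_eqF.
by rewrite rmorphXn /= s_real; field; rewrite ?expf_neq0.
Qed.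

Theorem theorem29 (R : realType) (H : hilbertType R) (S : linop H)
    (S_dense : densely_defined S)
    (S_inv : forall f : H, dom S f -> dom S (S f))
    (Z : set R[i]) (Z_neq0 : Z `<=` [set z | z != 0])
    (Z_det : determining Z) :
  [<-> (* (i) *)
       subnormal S;
       (* (ii) *)
       forall (m n : nat) (a : 'I_m -> 'I_m -> 'I_n.+1 -> 'I_n.+1 -> R[i]),
         (0 < m)%N ->
         (forall (lambda : R[i]) (z : 'I_m -> R[i]),
            0 <= \sum_(i < m) \sum_(j < m) \sum_(p < n.+1) \sum_(q < n.+1)
                   a i j p q * lambda ^+ p * lambda^* ^+ q * z i * (z j)^*) ->
         forall f : 'I_m -> H, (forall i, dom S (f i)) ->
           0 <= \sum_(i < m) \sum_(j < m) \sum_(p < n.+1) \sum_(q < n.+1)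
                  a i j p q * '[iter p S (f i), iter q S (f j)];
       (* (iii) *)
       forall (m n : nat) (a : 'I_m -> 'I_m -> 'I_n.+1 -> 'I_n.+1 -> R[i]),
         (0 < m)%N ->
         (exists (k : nat) (Q : 'I_m -> 'I_k -> R[i] -> R[i]),
            [/\ (0 < k)%N,
                forall i l, laurentNplus (Q i l)
              & forall lambda : R[i], Z lambda -> forall i j : 'I_m,
                  \sum_(p < n.+1) \sum_(q < n.+1)
                    a i j p q * lambda ^+ p * lambda^* ^+ q =
                  \sum_(l < k) Q i l lambda * (Q j l lambda)^*]) ->
         forall f : 'I_m -> H, (forall i, dom S (f i)) ->
           0 <= \sum_(i < m) \sum_(j < m) \sum_(p < n.+1) \sum_(q < n.+1)
                  a i j p q * '[iter p S (f i), iter q S (f j)]].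
Proof.
split; first by move=> subS m n a _; exact: subnormal_nonneg S_inv subS m n a.
split; first exact: nonneg_sos Z_neq0 Z_det.
exact: (sos_subnormal S_dense S_inv Z_neq0).
Qed.
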